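(* Let $1<p,q<\infty$, let $g\in\mathrm{Hol}(\Omega)$, and let $C_g=C_{g,\mathrm{id}}$. (i) If $p<q$: $C_g:A^p(\Omega)\to A^q(\Omega)$ is bounded if and only if $g=0$. (ii) If $p=q$: $C_g:A^p(\Omega)\to A^p(\Omega)$ is bounded if and only if $g\in H^\infty(\Omega)$. (iii) If $p=q$: $C_g:A^p(\Omega)\to A^p(\Omega)$ is compact if and only if $g=0$. (iv) If $q<p$: $g\in H^\infty(\Omega)$ implies that $C_g:A^p(\Omega)\to A^q(\Omega)$ is compact.
   Context: $\Omega\subset\mathbb C^n$ ($n\ge1$) is a bounded convex domain with smooth ($C^\infty$) boundary of finite type, with $0\in\Omega$. $\mathrm{Hol}(\Omega)$ is the space of holomorphic functions on $\Omega$, and for $1<p<\infty$, $A^p(\Omega)=\mathrm{Hol}(\Omega)\cap L^p(\Omega,dv)$ ($dv$ Lebesgue volume) with the $L^p$ norm. $H^\infty(\Omega)$ is the space of bounded holomorphic functions on $\Omega$. $Rf(z)=\sum_{k=1}^n z_k\partial_kf(z)$. $$C_gf(z)=\int_0^1Rf(tz)\,g(tz)\,\frac{dt}{t}.$$ The operator is first defined for $f$ holomorphic in a neighbourhood of $\overline\Omega$ (a dense subspace of $A^p(\Omega)$); it is bounded if it extends boundedly to $A^p(\Omega)\to A^q(\Omega)$, and the same symbol denotes the unique bounded extension. *)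

(* Defs.v *)
From HB Require Import structures.
From mathcomp Require Import all_boot all_order all_algebra.
From mathcomp Require Import complex.
From mathcomp Require Import lra.
From mathcomp Require Import all_classical all_reals all_analysis.
From mathcomp Require Import measurable_realfun.
Set Implicit Arguments.
Unset Strict Implicit.
Unset Printing Implicit Defensive.
Import Order.TTheory GRing.Theory Num.Theory.
Import numFieldNormedType.Exports.
Local Open Scope classical_set_scope.
Local Open Scope ring_scope.
Local Open Scope complex_scope.

(* The topology of R[i] is the one of its modulus `|z| : R[i] (a real number seen
   in R[i]); ['rV[R[i]]_n] then carries the library's sup norm. *)
HB.instance Definition _ (R : rcfType) := NormedModule.copy R[i] R[i]^o.

Section tuple_measure.
Context d (T : measurableType d) (R : realType).
Variable mu : {sigma_finite_measure set T -> \bar R}.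

Definition tuple_cons n (x : T * n.-tuple T) : n.+1.-tuple T :=
  [tuple of x.1 :: x.2].

Definition tuple_uncons n (t : n.+1.-tuple T) : T * n.-tuple T :=
  (thead t, [tuple of behead t]).

Lemma tuple_consK n : cancel (@tuple_cons n) (@tuple_uncons n).
Proof.
by case=> x t; rewrite /tuple_uncons theadE; congr pair; apply: val_inj.
Qed.

Lemma tuple_unconsK n : cancel (@tuple_uncons n) (@tuple_cons n).
Proof. by move=> t; rewrite [RHS]tuple_eta; apply: val_inj. Qed.

Lemma measurable_tuple_cons n : measurable_fun setT (@tuple_cons n).
Proof. exact: measurable_cons. Qed.

Lemma measurable_tuple_uncons n : measurable_fun setT (@tuple_uncons n).
Proof.
apply: measurable_fun_pair; last exact: measurable_behead.
exact: (@measurable_tnth _ T n.+1 ord0).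
Qed.

Section step.
Variables (n : nat) (nu : {sigma_finite_measure set (n.-tuple T) -> \bar R}).

Definition tuple_measureS : set (n.+1.-tuple T) -> \bar R :=
  pushforward (mu \x nu)%E (@tuple_cons n).

HB.instance Definition _ := Measure.copy tuple_measureS
  (measure_function_pushforward__canonical__measure_function_Measure
     (mu \x nu)%E (@measurable_tuple_cons n)).

Lemma tuple_measureS_sigma_finite : sigma_finite setT tuple_measureS.
Proof.
have /sigma_finiteP[F [TF ndF Foo]] := sigma_finiteT mu.
have /sigma_finiteP[G [TG ndG Goo]] := sigma_finiteT nu.
exists (fun k => @tuple_uncons n @^-1` (F k `*` G k)).
  rewrite -preimage_bigcup -[LHS](preimage_setT (@tuple_uncons n)).
  congr (_ @^-1` _); apply/seteqP; split => // -[x t] _.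
  have [i _ Fix] : (\bigcup_i F i) x by rewrite -TF.
  have [j _ Gjt] : (\bigcup_i G i) t by rewrite -TG.
  exists (maxn i j) => //; split => /=.
  - by move: x Fix; exact/subsetPset/ndF/leq_maxl.
  - by move: t Gjt; exact/subsetPset/ndG/leq_maxr.
move=> k; have [mF Fk] := Foo k; have [mG Gk] := Goo k; split.
  rewrite -[X in measurable X]setTI; apply: measurable_tuple_uncons => //.
  exact: measurableX.
rewrite /= /tuple_measureS /pushforward -comp_preimage.
rewrite (_ : _ \o _ = id) ?preimage_id; last first.
  by apply/funext => x; exact: tuple_consK.
by rewrite product_measure1E// lte_mul_pinfty// ge0_fin_numE.
Qed.

HB.instance Definition _ := Measure_isSigmaFinite.Build _ _ _ tuple_measureS
  tuple_measureS_sigma_finite.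
End step.

Fixpoint tuple_measure n : {sigma_finite_measure set (n.-tuple T) -> \bar R} :=
  if n is n'.+1 then tuple_measureS (tuple_measure n') else dirac [tuple].

End tuple_measure.

Section tuple_box.
Context d (T : measurableType d) (R : realType).
Variable mu : {sigma_finite_measure set T -> \bar R}.

Definition tuple_box n (A : 'I_n -> set T) : set (n.-tuple T) :=
  [set t | forall k, A k (tnth t k)].

Lemma measurable_tuple_box n (A : 'I_n -> set T) :
  (forall k, measurable (A k)) -> measurable (tuple_box A).
Proof.
move=> mA.
have -> : tuple_box A = \bigcap_k ((fun t : n.-tuple T => tnth t k) @^-1` A k).
  by apply/seteqP; split => [t At k _|t At k]; [exact: At|exact: (At k)].
apply: fin_bigcap_measurable => // k _.
rewrite -[X in measurable X]setTI; exact: measurable_tnth.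
Qed.

Lemma tuple_measure_box n (A : 'I_n -> set T) : (forall k, measurable (A k)) ->
  (tuple_measure mu n (tuple_box A) = \prod_(k < n) mu (A k))%E.
Proof.
elim: n A => [|n IH] A mA.
  rewrite big_ord0 /= diracE mem_set//; first by case.
rewrite big_ord_recl -IH //= /tuple_measureS /pushforward.
rewrite (_ : _ @^-1` _ = A ord0 `*` tuple_box (fun k => A (lift ord0 k))).
  by rewrite product_measure1E//; exact: measurable_tuple_box.
apply/seteqP; split => [[x t] /= At|[x t] /= [Ax At] k].
  split => /=; first exact: (At ord0).
  by move=> k; have := At (lift ord0 k); rewrite tnthS.
by case: (unliftP ord0 k) => [j ->|->//]; rewrite tnthS; exact: At.
Qed.
End tuple_box.


Section Cn_measure.
Variable R : realType.

Definition borel_Cn n := g_sigma_algebraType (@open 'rV[R[i]]_n).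

Definition Cn_of_tuple n (t : (n + n).-tuple (measurableTypeR R)) : borel_Cn n :=
  (\row_k (tnth t (lshift n k) +i* tnth t (rshift n k)) : 'rV[R[i]]_n).

Lemma normc_le_ReIm (z : R[i]) :
  Normc.normc z <= `|complex.Re z| + `|complex.Im z|.
Proof.
case: z => a b /=; rewrite -[leRHS]ger0_norm ?addr_ge0// -sqrtr_sqr.
rewrite ler_wsqrtr// sqrrD !real_normK ?num_real// lerD2r lerDl.
by rewrite mulrn_wge0// mulr_ge0.
Qed.

Lemma Cn_ballP n (z w : 'rV[R[i]]_n) (e : R) : 0 < e ->
  (forall k, `|complex.Re (z 0 k - w 0 k)| < e / 2 /\
             `|complex.Im (z 0 k - w 0 k)| < e / 2) -> ball z (e%:C) w.
Proof.
move=> e0 h; split => [|i j]; first by rewrite ltcR.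
rewrite ord1 /ball /= ltcR; have [h1 h2] := h j.
rewrite (le_lt_trans (normc_le_ReIm _))//.
by rewrite [ltRHS](splitr e) ltrD.
Qed.

Lemma open_Cn_ball n (U : set 'rV[R[i]]_n) z : open U -> U z ->
  exists2 e : R, 0 < e & ball z (e%:C) `<=` U.
Proof.
move=> oU Uz; have /nbhs_ballP[[e e'] /= e0 eU] := open_nbhs_nbhs (conj oU Uz).
move: e0 eU; rewrite ltcE /= => /andP[/eqP e'0 e0]; rewrite {}e'0 => eU.
by exists e.
Qed.

Lemma measurable_Cn_of_tuple n : measurable_fun setT (@Cn_of_tuple n).
Proof.
apply: (@measurability _ _ _ (borel_Cn n) _ _ (@open 'rV[R[i]]_n)) => [//|_ [U oU <-]].
rewrite setTI.
pose Q := ((n + n).-tuple rat * nat)%type.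
pose I (q : rat) (d : R) : set R := `](ratr q - d), (ratr q + d)[%classic.
pose B (q : Q) : set ((n + n).-tuple (measurableTypeR R)) :=
  tuple_box (fun k => I (tnth q.1 k) q.2.+1%:R^-1).
pose F (q : Q) := if `[< B q `<=` @Cn_of_tuple n @^-1` U >] then B q else set0.
have -> : @Cn_of_tuple n @^-1` U = \bigcup_q F q.
  apply/seteqP; split => [t Ut|t [q _]]; last first.
    by rewrite /F; case: asboolP => // + Bt; exact.
  have [e e0 eU] := open_Cn_ball oU Ut.
  have [m me] : exists m, 0 + m.+1%:R^-1 < e / 4.
    by apply: ltr_add_invr; rewrite divr_gt0.
  rewrite add0r in me.
  set d := m.+1%:R^-1 in me.
  have d0 : 0 < d by rewrite invr_gt0.
  have /choice[a aP] : forall k : 'I_(n + n), exists q : rat, I q d (tnth t k).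
    move=> k; set x := tnth t k.
    have [q] : exists q, ratr q \in `]x - d, x + d[.
      by apply: rat_in_itvoo; rewrite ltrD2l gtrN.
    rewrite in_itv/= => /andP[h1 h2]; exists q.
    by rewrite /I/= in_itv/= ltrBlDr h2 -ltrBlDr h1.
  exists ([tuple a k | k < n + n], m) => //; rewrite /F.
  have Bt : B ([tuple a k | k < n + n], m) t by move=> k; rewrite /= tnth_mktuple.
  case: asboolP => // -[]; move=> s Bs; apply: eU; apply: Cn_ballP => // k.
  have h l : `|tnth t l - tnth s l| < e / 2.
    have := Bs l; have := Bt l; rewrite /= -/d /I/= !in_itv/=.
    by rewrite ltr_norml => /andP[? ?] /andP[? ?]; lra.
  by rewrite !mxE /=; split; exact: h.
apply: countable_bigcupT_measurable => [|q]; first exact: countableP.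
rewrite /F; case: asboolP => // _; apply: measurable_tuple_box => k.
exact: measurable_itv.
Qed.

(* Lebesgue measure on the Borel sets of C^n, identified with R^(2n). *)
Definition lebesgue_Cn n : set (borel_Cn n) -> \bar R :=
  pushforward (tuple_measure lebesgue_measure (n + n)) (@Cn_of_tuple n).

HB.instance Definition _ n := Measure.copy (@lebesgue_Cn n)
  (measure_function_pushforward__canonical__measure_function_Measure
     (tuple_measure lebesgue_measure (n + n)) (@measurable_Cn_of_tuple n)).

Lemma lebesgue_Cn_open_gt0 n (U : set 'rV[R[i]]_n) : open U -> U !=set0 ->
  (0 < lebesgue_Cn (U : set (borel_Cn n)))%E.
Proof.
move=> oU [z Uz]; have [e e0 eU] := open_Cn_ball oU Uz.
pose c (k : 'I_(n + n)) := match fintype.split k with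
  | inl l => complex.Re (z 0 l) | inr l => complex.Im (z 0 l) end.
pose A k : set (measurableTypeR R) := `](c k - e / 2), (c k + e / 2)[%classic.
have mA k : measurable (A k) by exact: measurable_itv.
have mu0 : (0 < tuple_measure lebesgue_measure (n + n) (tuple_box A))%E.
  rewrite tuple_measure_box//; elim/big_ind : _ => //; first exact: mule_gt0.
  move=> k _; rewrite /A /= lebesgue_measure_itv/= lte_fin ifT; last by lra.
  by rewrite lte_fin; lra.
apply: (lt_le_trans mu0); rewrite /lebesgue_Cn /pushforward.
apply: le_measure; rewrite ?inE; [exact: measurable_tuple_box| |].
  rewrite -[X in measurable X]setTI; apply: measurable_Cn_of_tuple => //.
  exact: sub_sigma_algebra.
move=> t At; apply: eU; apply: Cn_ballP => // k.
have h l : `|c l - tnth t l| < e / 2.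
  have := At l; rewrite /A/= in_itv/= ltr_norml => /andP[? ?]; lra.
have := h (lshift n k); have := h (rshift n k); rewrite /c.
rewrite !(unsplitK (inl _)) !(unsplitK (inr _)) !mxE.
by case: (z 0 k) => a b /= ? ?; split.
Qed.

End Cn_measure.

(* Complex differentiability: the field of scalars is R[i]. *)
Definition holomorphic_on (R : rcfType) (V W : normedModType R[i])
  (U : set V) (f : V -> W) := forall z, U z -> differentiable f z.

Section Bergman.
Variables (R : realType) (n : nat) (Omega : set 'rV[R[i]]_n) (p : R).

Definition Lp_norm (f : 'rV[R[i]]_n -> R[i]) : \bar R :=
  'N[@lebesgue_Cn R n]_p%:E[EFin \o (fun z : borel_Cn R n => Normc.normc (f z))]%E.

(* Elements of A^p(Omega) are extended by 0 outside Omega, so that equality of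
   functions on Omega is Leibniz equality and [Lp_norm] over C^n is the norm of
   L^p(Omega). *)
Definition bergman_pred : {pred 'rV[R[i]]_n -> R[i]} :=
  fun f => `[< [/\ holomorphic_on Omega f, (Lp_norm f < +oo)%E
                 & forall z, ~ Omega z -> f z = 0] >].

Record bergman (oOmega : open Omega) (p1 : 1 < p) := Bergman {
  bergman_fun :> 'rV[R[i]]_n -> R[i];
  bergman_funP : bergman_fun \in bergman_pred }.

Hypotheses (oOmega : open Omega) (p1 : 1 < p).

Let p0 : 0 < p. Proof. exact: lt_trans p1. Qed.

Let normc_ge0 (z : R[i]) : 0 <= Normc.normc z.
Proof. by case: z => x y; exact: sqrtr_ge0. Qed.

Lemma bergmanP f : reflect [/\ holomorphic_on Omega f, (Lp_norm f < +oo)%E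
  & forall z, ~ Omega z -> f z = 0] (f \in bergman_pred).
Proof. exact: asboolP. Qed.

Lemma open_normc_gt f a : 0 <= a -> holomorphic_on Omega f ->
  (forall z, ~ Omega z -> f z = 0) -> open [set z | a < Normc.normc (f z)].
Proof.
move=> a0 hf f0; rewrite openE => z /= az; rewrite /interior.
have Oz : Omega z.
  by apply: contrapT => /f0 fz; move: az; rewrite fz Normc.normc0 ltNge a0.
have e0 : 0 < (Normc.normc (f z) - a)%:C :> R[i] by rewrite ltcR subr_gt0.
have /cvgrPdist_lt/(_ _ e0) := differentiable_continuous (hf _ Oz).
apply: filterS => w /=; rewrite ltcR => h.
have := le_normcD (f z - f w) (f w); rewrite subrK => h'.
lra.
Qed.

Lemma measurable_normc_holomorphic f : holomorphic_on Omega f ->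
  (forall z, ~ Omega z -> f z = 0) ->
  measurable_fun setT (fun z : borel_Cn R n => Normc.normc (f z)).
Proof.
move=> hf f0.
apply: (measurability _ (RGenOInfty.measurableE R)).
move=> _ [_ [a ->] <-]; rewrite setTI.
have [a0|a0] := ltP a 0.
  rewrite (_ : _ @^-1` _ = setT); first exact: measurableT.
  apply/seteqP; split=> // z _; rewrite /= in_itv/= andbT.
  exact: lt_le_trans a0 _.
apply: sub_sigma_algebra.
rewrite (_ : _ @^-1` _ = [set z | a < Normc.normc (f z)]).
  exact: open_normc_gt.
by apply/seteqP; split=> z /=; rewrite in_itv/= andbT.
Qed.

Lemma Lp_norm0 : Lp_norm 0 = 0%E.
Proof.
rewrite /Lp_norm -[RHS](@Lnorm0 _ _ _ (@lebesgue_Cn R n) p%:E).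
  by apply: eq_Lnorm => z; congr EFin; exact: Normc.normc0.
by rewrite eqe gt_eqF.
Qed.

Let measurable_powR (h : borel_Cn R n -> R) : measurable_fun setT h ->
  measurable_fun setT (fun z => (`|(EFin \o h) z| `^ p)%E).
Proof.
move=> mh; apply: (measurableT_comp (measurable_poweR p)).
by apply: measurableT_comp => //; exact: measurableT_comp.
Qed.

Lemma Lp_normD f g : f \in bergman_pred -> g \in bergman_pred ->
  (Lp_norm (f + g)%R <= Lp_norm f + Lp_norm g)%E.
Proof.
move=> /bergmanP[hf _ f0] /bergmanP[hg _ g0].
have mf := measurable_normc_holomorphic hf f0.
have mg := measurable_normc_holomorphic hg g0.
apply: le_trans (minkowski_EFin (@lebesgue_Cn R n) mf mg (ltW p1)).
have mfg : measurable_fun setT (fun z : borel_Cn R n => Normc.normc ((f + g) z)).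
  apply: measurable_normc_holomorphic.
    by move=> z Oz; apply: differentiableD; [exact: hf|exact: hg].
  by move=> z Oz; rewrite fctE f0// g0// addr0.
rewrite /Lp_norm unlock; apply: gt0_ler_poweR.
- by rewrite invr_ge0 ltW.
- by rewrite in_itv/= leey andbT integral_ge0// => z _; exact: poweR_ge0.
- by rewrite in_itv/= leey andbT integral_ge0// => z _; exact: poweR_ge0.
apply: ge0_le_integral => //.
- by move=> z _; exact: poweR_ge0.
- exact: measurable_powR.
- by apply: measurable_powR; exact: measurable_funD.
- move=> z _; rewrite /= !ger0_norm ?addr_ge0// lee_fin.
  apply: ge0_ler_powR; rewrite ?nnegrE ?addr_ge0//; first exact: ltW.
  exact: le_normcD.
Qed.

Lemma Lp_normZ (a : R[i]) f : f \in bergman_pred ->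
  (Lp_norm (a *: f) = (Normc.normc a)%:E * Lp_norm f)%E.
Proof.
move=> /bergmanP[hf _ f0].
have mf := measurable_normc_holomorphic hf f0.
have cpK (c : R) : 0 <= c -> ((c `^ p)%:E `^ p^-1 = c%:E)%E.
  by move=> c0; rewrite poweR_EFin -powRrM mulfV ?gt_eqF// powRr1.
rewrite /Lp_norm unlock -[X in (X * _)%E]cpK//.
rewrite -poweRM ?lee_fin ?powR_ge0//; last first.
  by apply: integral_ge0 => z _; exact: poweR_ge0.
congr (_ `^ _)%E; rewrite -ge0_integralZl_EFin ?powR_ge0//.
- apply: eq_integral => z _.
  rewrite -poweR_EFin -poweRM ?lee_fin//.
  by congr (_ `^ _)%E; rewrite /= Normc.normcM normrM (ger0_norm (normc_ge0 a)).
- by move=> z _; exact: poweR_ge0.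
- exact: measurable_powR.
Qed.

Lemma bergman_submod_closed : submod_closed bergman_pred.
Proof.
split.
  by apply/bergmanP; split => //; rewrite Lp_norm0.
move=> a f g fB gB.
have afB : a *: f \in bergman_pred.
  move: (fB) => /bergmanP[hf foo f0]; apply/bergmanP; split.
  - by move=> z Oz; apply: differentiableZ; exact: hf.
  - by rewrite Lp_normZ// lte_mul_pinfty// lee_fin.
  - by move=> z Oz; rewrite fctE f0// scaler0.
have le := Lp_normD afB gB.
move: afB gB => /bergmanP[hf foo f0] /bergmanP[hg goo g0].
apply/bergmanP; split.
- by move=> z Oz; apply: differentiableD; [exact: hf|exact: hg].
- by apply: le_lt_trans le _; rewrite lte_add_pinfty.
- by move=> z Oz; rewrite fctE f0// g0// addr0.
Qed.

HB.instance Definition _ := GRing.isSubmodClosed.Build _ _ bergman_pred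
  bergman_submod_closed.

HB.instance Definition _ := [isSub for @bergman_fun oOmega p1].
HB.instance Definition _ := [Choice of bergman oOmega p1 by <:].
HB.instance Definition _ := [SubChoice_isSubLmodule of bergman oOmega p1 by <:].

Definition bergman_norm (f : bergman oOmega p1) : R[i] := (fine (Lp_norm f))%:C.

Let Lp_norm_fin (f : bergman oOmega p1) : (Lp_norm f \is a fin_num)%E.
Proof. by case: f => f /= /bergmanP[_ foo _]; rewrite ge0_fin_numE ?Lnorm_ge0. Qed.

Lemma bergman_normD f g :
  bergman_norm (f + g) <= bergman_norm f + bergman_norm g.
Proof.
rewrite /bergman_norm -rmorphD/= lecR -fineD//.
apply: fine_le; rewrite ?fin_numD ?Lp_norm_fin//; first exact: (Lp_norm_fin (f + g)).
exact: (Lp_normD (bergman_funP f) (bergman_funP g)).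
Qed.

Lemma bergman_normZ a f : bergman_norm (a *: f) = `|a| * bergman_norm f.
Proof.
rewrite /bergman_norm (Lp_normZ a (bergman_funP f)) fineM//.
by rewrite rmorphM.
Qed.

Lemma bergman_norm_eq0 f : bergman_norm f = 0 -> f = 0.
Proof.
rewrite /bergman_norm => -[] Nf.
have {}Nf : Lp_norm f = 0%E by rewrite -(fineK (Lp_norm_fin f)) Nf.
have [hf _ f0] := bergmanP _ (bergman_funP f).
have mf := measurable_normc_holomorphic hf f0.
apply: val_inj; apply/funext => z /=; apply: contrapT => fz.
have oU := open_normc_gt (lexx 0) hf f0.
have U0 : [set z | 0 < Normc.normc (f z)] !=set0.
  exists z; rewrite /= lt_neqAle normc_ge0 andbT eq_sym; apply/eqP.
  by move/Normc.eq0_normc.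
have := lebesgue_Cn_open_gt0 oU U0; apply/negP; rewrite -leNgt.
have /(_ _ _)[//||] := Lnorm_eq0_eq0 _ _ Nf; rewrite ?lte_fin//.
  exact/measurable_EFinP.
move=> N [mN N0 sN]; rewrite -N0; apply: le_measure; rewrite ?inE//.
  exact: sub_sigma_algebra.
move=> w /= fw; apply: sN => /= /(_ I) /eqP.
by rewrite eqe gt_eqF.
Qed.

HB.instance Definition _ := @Lmodule_isNormed.Build R[i] (bergman oOmega p1)
  bergman_norm bergman_normD bergman_normZ bergman_norm_eq0.

End Bergman.

Section Domain.
Variables (R : realType) (n : nat).
Local Notation Cn := 'rV[R[i]]_n.
Implicit Types (Omega U : set Cn) (zeta : Cn) (r : Cn -> R).

Definition boundary Omega : set Cn := closure Omega `\` Omega°.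

(* Real directional derivatives, C^n being regarded as R^(2n). *)
Definition real_derivable (v : Cn) r (z : Cn) : Prop :=
  derivable (fun t : R => r (z + t%:C *: v)) 0 1.

Definition real_derive (v : Cn) r (z : Cn) : R :=
  derive1 (fun t : R => r (z + t%:C *: v)) 0.

Fixpoint Ck (k : nat) U r : Prop :=
  (forall z, U z -> {for z, continuous r}) /\
  if k is k'.+1 then
    forall v, (forall z, U z -> real_derivable v r z) /\
              Ck k' U (real_derive v r)
  else True.

Definition local_defining_function Omega zeta r : Prop :=
  exists U : set Cn, [/\ open U, U zeta, (forall k, Ck k U r),
    (forall z, U z -> exists v, real_derive v r z != 0) &
    (forall z, U z -> (Omega z <-> r z < 0))].

Definition smooth_boundary Omega : Prop :=
  forall zeta, boundary Omega zeta ->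
    exists r, local_defining_function Omega zeta r.

Definition vanishing_order (u : R[i] -> R) : \bar R :=
  ereal_sup [set m%:R%:E | m in [set m : nat | exists M : R,
    \forall w \near (0 : R[i]), `|u w| <= M * Normc.normc w ^+ m]].

Definition holomorphic_curve_at zeta (phi : R[i] -> Cn) : Prop :=
  [/\ phi 0 = zeta, (\forall w \near (0 : R[i]), differentiable phi w) &
      ~ (\forall w \near (0 : R[i]), phi w = zeta)].

(* The D'Angelo type sup_phi nu(r o phi) / nu(phi - zeta). *)
Definition dangelo_type r zeta : \bar R :=
  ereal_sup [set (vanishing_order (r \o phi) /
                  vanishing_order (fun w => complex.Re `|phi w - zeta|)%R)%E
            | phi in holomorphic_curve_at zeta].

Definition finite_type Omega : Prop :=
  forall zeta, boundary Omega zeta ->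
    exists2 r, local_defining_function Omega zeta r
             & (dangelo_type r zeta < +oo)%E.

End Domain.

Section Operator.
Variables (R : realType) (n : nat) (Omega : set 'rV[R[i]]_n).
Local Notation Cn := 'rV[R[i]]_n.
Implicit Types f g : Cn -> R[i].

Definition Hinfty g : Prop :=
  holomorphic_on Omega g /\
  exists M : R, forall z, Omega z -> Normc.normc (g z) <= M.

Definition radial_derivative f (z : Cn) : R[i] :=
  \sum_(k < n) z 0 k * 'D_(delta_mx 0 k) f z.

Definition integral01 (h : R -> R[i]) : R[i] :=
  (\int[lebesgue_measure]_(t in `[0, 1]) complex.Re (h t)) +i*
  (\int[lebesgue_measure]_(t in `[0, 1]) complex.Im (h t)).

Definition Cg g f (z : Cn) : R[i] :=
  integral01 (fun t =>
    radial_derivative f (t%:C *: z) * g (t%:C *: z) / t%:C).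

Definition holomorphic_near_closure f : Prop :=
  exists U F, [/\ open U, closure Omega `<=` U, holomorphic_on U F &
                  forall z, Omega z -> f z = F z].

Variables (oOmega : open Omega) (p q : R) (p1 : 1 < p) (q1 : 1 < q).

Definition bounded_extension_Cg g
    (T : {linear bergman oOmega p1 -> bergman oOmega q1}) : Prop :=
  (exists M : R, forall f : bergman oOmega p1, `|T f| <= M%:C * `|f|) /\
  forall f : bergman oOmega p1, holomorphic_near_closure f ->
    forall z, Omega z -> T f z = Cg g f z.

Definition Cg_bounded g : Prop := exists T, bounded_extension_Cg g T.

(* The bounded extension is unique, by density. *)
Definition Cg_compact g : Prop :=
  exists2 T, bounded_extension_Cg g T & precompact (T @` [set f : bergman oOmega p1 | `|f| <= 1]).

End Operator.

(* Main.v *)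
Require Import Defs.
From HB Require Import structures.
From mathcomp Require Import all_boot all_order all_algebra.
From mathcomp Require Import complex.
From mathcomp Require Import ring lra zify.
From mathcomp Require Import all_classical all_reals all_analysis.
From mathcomp Require Import measurable_realfun.
Set Implicit Arguments.
Unset Strict Implicit.
Unset Printing Implicit Defensive.
Import Order.TTheory GRing.Theory Num.Theory.
Import numFieldNormedType.Exports.
Local Open Scope classical_set_scope.
Local Open Scope ring_scope.
Local Open Scope complex_scope.

(** Write D f (z)(v) for the differential of f at z applied to v, so that the radial
    derivative of f at z is D f (z)(z). Differentiating the integral along the ray of z
    shows that the radial derivative of C_g f is g times that of f ([Cg_radial]).
    Functions holomorphic near the closure are dense, because dilations converge in
    norm ([dilate_density]), and derivatives at a point are bounded functionals
    ([dder_bound]), so every bounded extension T satisfies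
    D (T f)(z)(z) = g z * D f (z)(z) for all f ([extension_radial]). In other words the
    evaluation e_z : f -> D f (z)(z) satisfies e_z (T f) = g z * e_z f.

    All the necessary conditions follow from this relation. For p = q it gives
    |g z| * ||e_z|| <= ||T|| * ||e_z||, so that g is bounded ([symbol_bounded]).
    If g z0 <> 0, Riesz's argument produces a sequence in the unit ball whose images
    are uniformly separated in L^p ([symbol_zero]): at points where |g| is bounded
    below, choose functions annihilated by the previous evaluations and nearly
    extremal for the next one. This is impossible when p = q and T is compact, and also
    when p < q, since A^q is compactly included in A^p ([compact_inclusion]): local bounds
    give locally uniform convergence along an ultrafilter, and near the boundary the
    larger exponent controls the smaller one.

    Conversely let g be bounded by M. Integration by parts along the ray of z
    ([fg_primitive]) gives

      C_g f z = f z * g z - f 0 * g 0 - int_0^1 f (t z) D g (t z)(z) dt.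

    With N the gauge of the domain, Cauchy's estimate on the ball of radius
    (1 - t N z) rho around t z ([domain_ball]) bounds |D g (t z)(z)| by a constant times
    M / (1 - t N z). The averages int |f (t z)| / (1 - t N z) dt are bounded in L^p by a
    Hardy inequality along rays ([hardy_inequality]): Hoelder's inequality with inverse
    square roots as weights, Tonelli's theorem, and the change of variable z -> t z. So
    C_g is bounded on A^p ([Cg_extension]), and composing with the compact inclusion of
    A^p into A^q makes it compact into A^q for q < p ([compact_ball]).

    The function theory rests on one complex variable: Goursat's theorem for
    rectangles by bisection ([goursat]), the residue of a simple pole ([residue]), and from
    these Cauchy's estimate for the derivative ([cauchy_derivative]) and the sub-mean
    value property over squares ([submean_square]). Restriction to complex lines and
    iteration over coordinates give the second-order Taylor estimate [holo_taylor2], which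
    makes limits of bounded families holomorphic ([limit_differentiable]), and the bound
    of point values by L^1 norms ([point_bound]). *)

Local Notation normc := Normc.normc.

(** * Moduli and complex-valued integrals over segments *)

Section modulus.
Variable R : realType.
Implicit Types z w : R[i].

Lemma normc_ge0 z : 0 <= normc z.
Proof. by case: z => x y; exact: sqrtr_ge0. Qed.

Lemma normcE z : `|z| = (normc z)%:C.
Proof. by []. Qed.

Lemma normcR (x : R) : normc x%:C = `|x|.
Proof. by rewrite /= expr0n/= addr0 sqrtr_sqr. Qed.

Lemma normc_distC z w : normc (z - w) = normc (w - z).
Proof. by rewrite -normcN opprB. Qed.

Lemma le_normcB z w : normc (z - w) <= normc z + normc w.
Proof. by rewrite -(normcN w) le_normcD. Qed.

Lemma normc_gt0 z : (0 < normc z) = (z != 0).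
Proof.
rewrite lt_neqAle normc_ge0 andbT; apply/idP/idP; apply: contraNN => /eqP.
  by move=> ->; rewrite Normc.normc0.
by move=> /esym/Normc.eq0_normc ->.
Qed.

Lemma Re_le_normc z : `|complex.Re z| <= normc z.
Proof. by have := normc_ge_Re z; rewrite normcE lecR. Qed.

Lemma Im_le_normc z : `|complex.Im z| <= normc z.
Proof.
case: z => x y /=; rewrite -[leLHS]ger0_norm// -sqrtr_sqr ler_wsqrtr//.
by rewrite real_normK ?num_real// lerDr sqr_ge0.
Qed.

Lemma normc_sum I (r : seq I) (F : I -> R[i]) :
  normc (\sum_(k <- r) F k) <= \sum_(k <- r) normc (F k).
Proof.
elim/big_rec2 : _ => [|k y x _ h]; first by rewrite Normc.normc0.
by apply: le_trans (le_normcD _ _) _; rewrite lerD2l.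
Qed.

Lemma normc_eqP z w : (forall e : R, 0 < e -> normc (z - w) <= e) -> z = w.
Proof.
move=> h; apply/eqP; rewrite -subr_eq0; apply: contraT.
rewrite -normc_gt0 => h0; have := h (normc (z - w) / 2).
rewrite divr_gt0// => /(_ isT); lra.
Qed.

End modulus.

Section complex_integral.
Variable R : realType.
Local Notation mu := (@lebesgue_measure R).
Implicit Types (a b : R) (h : R -> R[i]).

Definition cintegrable a b h :=
  mu.-integrable `[a, b] (EFin \o (fun t => complex.Re (h t))) /\
  mu.-integrable `[a, b] (EFin \o (fun t => complex.Im (h t))).

Definition cint a b h : R[i] :=
  (\int[mu]_(t in `[a, b]) complex.Re (h t)) +i*
  (\int[mu]_(t in `[a, b]) complex.Im (h t)).

Definition ccontinuous_on a b h := forall t, a <= t <= b ->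
  forall e : R, 0 < e -> exists2 d : R, 0 < d &
    forall s, a <= s <= b -> `|s - t| < d -> normc (h s - h t) <= e.

Lemma within_continuousP a b (f : R -> R) :
  (forall t, a <= t <= b -> forall e : R, 0 < e -> exists2 d : R, 0 < d &
    forall s, a <= s <= b -> `|s - t| < d -> `|f s - f t| <= e) ->
  {within `[a, b], continuous f}.
Proof.
move=> H; apply/subspace_continuousP => t; rewrite /= in_itv/= => tab'.
apply/cvgrPdist_le => e e0; have [d d0 hd] := H t tab' e e0.
rewrite near_withinE; near=> s; rewrite /= in_itv/= => sab.
rewrite distrC; apply: (hd s sab).
rewrite distrC; near: s; exact: (@nbhsx_ballx _ _ t d d0).
Unshelve. all: by end_near.
Qed.

Lemma ccontinuous_integrable a b h : ccontinuous_on a b h -> cintegrable a b h.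
Proof.
move=> H; split; apply: continuous_compact_integrable;
  (try exact: segment_compact); apply: within_continuousP => t tab e e0.
- have [d d0 hd] := H t tab e e0; exists d => // s sab st.
  apply: le_trans (hd s sab st); rewrite -raddfB; exact: Re_le_normc.
- have [d d0 hd] := H t tab e e0; exists d => // s sab st.
  apply: le_trans (hd s sab st); rewrite -raddfB; exact: Im_le_normc.
Qed.

Lemma eq_cint a b h k : (forall t, a <= t <= b -> h t = k t) ->
  cint a b h = cint a b k.
Proof.
move=> hk; rewrite /cint; congr (_ +i* _); apply: eq_Rintegral => t;
  by rewrite inE/= in_itv/= => /hk ->.
Qed.

Lemma eq_cintegrable a b h k : (forall t, a <= t <= b -> h t = k t) ->
  cintegrable a b h -> cintegrable a b k.
Proof.
move=> hk [h1 h2]; split;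
  [apply: eq_integrable h1|apply: eq_integrable h2] => //= t;
  by rewrite inE/= in_itv/= => /hk ->.
Qed.

Lemma cintegrableD a b h k : cintegrable a b h -> cintegrable a b k ->
  cintegrable a b (fun t => h t + k t).
Proof.
move=> [h1 h2] [k1 k2]; split.
- rewrite (_ : _ \o _ = (EFin \o (fun t => complex.Re (h t))) \+
      (EFin \o (fun t => complex.Re (k t))))%E; last first.
    by apply/funext => t /=; rewrite raddfD.
  exact: integrableD.
- rewrite (_ : _ \o _ = (EFin \o (fun t => complex.Im (h t))) \+
      (EFin \o (fun t => complex.Im (k t))))%E; last first.
    by apply/funext => t /=; rewrite raddfD.
  exact: integrableD.
Qed.

Lemma cintD a b h k : cintegrable a b h -> cintegrable a b k ->
  cint a b (fun t => h t + k t) = cint a b h + cint a b k.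
Proof.
move=> [h1 h2] [k1 k2]; rewrite /cint.
under eq_Rintegral do rewrite raddfD.
rewrite RintegralD//.
under [X in _ +i* X]eq_Rintegral do rewrite raddfD.
by rewrite RintegralD.
Qed.

Lemma ReM (z w : R[i]) : complex.Re (z * w) =
  complex.Re z * complex.Re w - complex.Im z * complex.Im w.
Proof. by case: z; case: w. Qed.

Lemma ImM (z w : R[i]) : complex.Im (z * w) =
  complex.Re z * complex.Im w + complex.Im z * complex.Re w.
Proof. by case: z; case: w. Qed.

Let integrable_lin a b (u v : R) (f g : R -> R) :
  mu.-integrable `[a, b] (EFin \o f) -> mu.-integrable `[a, b] (EFin \o g) ->
  mu.-integrable `[a, b] (EFin \o (fun t => u * f t + v * g t)).
Proof.
move=> hf hg.
rewrite (_ : _ \o _ = (fun t => u%:E * (EFin \o f) t)%E \+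
  (fun t => v%:E * (EFin \o g) t)%E)%E; last by [].
by apply: integrableD => //; exact: integrableZl.
Qed.

Let Rintegral_lin a b (u v : R) (f g : R -> R) :
  mu.-integrable `[a, b] (EFin \o f) -> mu.-integrable `[a, b] (EFin \o g) ->
  \int[mu]_(t in `[a, b]) (u * f t + v * g t) =
  u * \int[mu]_(t in `[a, b]) f t + v * \int[mu]_(t in `[a, b]) g t.
Proof.
move=> hf hg; rewrite RintegralD//.
- by rewrite !RintegralZl.
- exact: (@integrableZl _ _ _ mu `[a, b] _ u (EFin \o f)).
- exact: (@integrableZl _ _ _ mu `[a, b] _ v (EFin \o g)).
Qed.

Lemma cintegrableZ a b c h : cintegrable a b h ->
  cintegrable a b (fun t => c * h t).
Proof.
move=> [h1 h2]; split.
- have := integrable_lin (complex.Re c) (- complex.Im c) h1 h2.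
  by apply: eq_integrable => //= t _; rewrite ReM mulNr.
- have := integrable_lin (complex.Re c) (complex.Im c) h2 h1.
  by apply: eq_integrable => //= t _; rewrite ImM.
Qed.

Lemma cintZ a b c h : cintegrable a b h ->
  cint a b (fun t => c * h t) = c * cint a b h.
Proof.
move=> [h1 h2]; rewrite /cint.
under eq_Rintegral do rewrite ReM -mulNr.
rewrite Rintegral_lin//.
under [X in _ +i* X]eq_Rintegral do rewrite ImM.
rewrite Rintegral_lin//.
by case: c => c1 c2 /=; simpc.
Qed.

Lemma cintegrableN a b h : cintegrable a b h -> cintegrable a b (fun t => - h t).
Proof.
move=> /(cintegrableZ (-1)); apply: eq_cintegrable => t _; by rewrite mulN1r.
Qed.

Lemma cintN a b h : cintegrable a b h ->
  cint a b (fun t => - h t) = - cint a b h.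
Proof.
move=> hh; rewrite -mulN1r -cintZ//; apply: eq_cint => t _; by rewrite mulN1r.
Qed.

Lemma cintB a b h k : cintegrable a b h -> cintegrable a b k ->
  cint a b (fun t => h t - k t) = cint a b h - cint a b k.
Proof.
by move=> hh hk; rewrite cintD ?cintN//; exact: cintegrableN.
Qed.

Lemma cint_cat a m b h : a <= m -> m <= b -> cintegrable a b h ->
  cint a b h = cint a m h + cint m b h.
Proof.
move=> am mb [h1 h2].
have K (f : R -> R) : mu.-integrable `[a, b] (EFin \o f) ->
    \int[mu]_(t in `[a, b]) f t =
    \int[mu]_(t in `[a, m]) f t + \int[mu]_(t in `[m, b]) f t.
  move=> hf; apply/eqP; rewrite addrC -subr_eq; apply/eqP.
  rewrite Rintegral_itvB ?bnd_simp// Rintegral_itv_obnd_cbnd//.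
  apply: integrableS hf => //; apply: subset_itvr; by rewrite bnd_simp.
by rewrite /cint !K.
Qed.

Lemma cintegrableS a b a' b' h : a <= a' -> b' <= b -> cintegrable a b h ->
  cintegrable a' b' h.
Proof.
move=> aa bb [h1 h2]; split; [apply: integrableS h1|apply: integrableS h2] => //;
  by apply: subset_itvScc.
Qed.

Lemma cint_point a h : cint a a h = 0.
Proof. by rewrite /cint set_itv1 !Rintegral_set1. Qed.

Lemma cintegrable_normc a b h : cintegrable a b h ->
  mu.-integrable `[a, b] (EFin \o (fun t => normc (h t))).
Proof.
move=> [h1 h2].
have [m1 m2] : measurable_fun `[a, b] (fun t => complex.Re (h t)) /\
    measurable_fun `[a, b] (fun t => complex.Im (h t)).
  by split; apply/measurable_EFinP; [case/integrableP: h1|case/integrableP: h2].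
have mN : measurable_fun `[a, b] (fun t => normc (h t)).
  rewrite (_ : (fun t => normc (h t)) = (fun t =>
      Num.sqrt (complex.Re (h t) ^+ 2 + complex.Im (h t) ^+ 2))); last first.
    by apply/funext => t; case: (h t).
  apply: (measurableT_comp (continuous_measurable_fun (@sqrt_continuous R))).
  by apply: measurable_funD; exact: measurable_funX.
have h3 : mu.-integrable `[a, b]
    ((EFin \o (fun t => `|complex.Re (h t)|%R)) \+
     (EFin \o (fun t => `|complex.Im (h t)|%R)))%E.
  by apply: integrableD => //; exact: integrable_norm.
apply: (le_integrable _ _ _ h3) => //=; first exact/measurable_EFinP.
move=> t tab; rewrite lee_fin ger0_norm ?normc_ge0// ger0_norm ?addr_ge0//.
exact: normc_le_ReIm.
Qed.

(** Rotating [cint a b h] to the positive reals turns the modulus of the integral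
    into the integral of a real part. *)
Lemma normc_cint a b h : cintegrable a b h ->
  normc (cint a b h) <= \int[mu]_(t in `[a, b]) normc (h t).
Proof.
move=> hh; set I := cint a b h.
have [->|I0] := eqVneq I 0.
  by rewrite Normc.normc0; apply: Rintegral_ge0 => t _; exact: normc_ge0.
have nI : normc I != 0 by rewrite gt_eqF// normc_gt0.
pose c : R[i] := I^* / (normc I)%:C.
have nc : normc c = 1.
  rewrite Normc.normcM Normc.normcV normcR ger0_norm ?normc_ge0//.
  have -> : normc I^* = normc I by have := normcJ I; rewrite !normcE => -[].
  by rewrite divff.
have cI : c * I = (normc I)%:C.
  rewrite /c mulrAC mulrC; apply: (canLR (mulKf _)).
    by apply/eqP => -[] /eqP; apply/negP.
  rewrite mulrC -sqr_normc normcE; ring.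
have -> : normc I = \int[mu]_(t in `[a, b]) complex.Re (c * h t).
  by have := cintZ c hh; rewrite -/I cI => -[].
apply: le_Rintegral => //.
- by have [] := cintegrableZ c hh.
- exact: cintegrable_normc.
- move=> t _; apply: le_trans (ler_norm _) _; apply: le_trans (Re_le_normc _) _.
  by rewrite Normc.normcM nc mul1r.
Qed.

Lemma normc_cint_le a b h (M : R) : a <= b -> cintegrable a b h ->
  (forall t, a <= t <= b -> normc (h t) <= M) ->
  normc (cint a b h) <= M * (b - a).
Proof.
move=> ab hh hM; apply: le_trans (normc_cint hh) _.
apply: (@le_trans _ _ (\int[mu]_(t in `[a, b]) M)).
  apply: le_Rintegral => //; first exact: cintegrable_normc.
    apply: continuous_compact_integrable; first exact: segment_compact.
    by apply: continuous_subspaceT => x; exact: cst_continuous.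
have E : mu `[a, b] = (b - a)%:E.
  rewrite lebesgue_measure_itv/= lte_fin; case: ltP => // ba.
  by rewrite (@le_anti _ _ a b) ?subrr// ab ba.
by rewrite Rintegral_cst// le_eqVlt; apply/orP; left; apply/eqP; congr (_ * _); exact: (congr1 fine E).
Qed.

End complex_integral.

(** * Differentiability and integrals around rectangles *)

Section real_norm.
Variables (R : realType) (V : normedModType R[i]).
Implicit Types v w : V.

(** The norm of a normed space over [R[i]] takes values in [R[i]]; the real
    number that it represents is what the estimates below speak of. *)
Definition rnorm v : R := complex.Re `|v|.

Lemma rnormE v : `|v| = (rnorm v)%:C.
Proof. by rewrite /rnorm RRe_real// ger0_real. Qed.

Lemma rnorm_ge0 v : 0 <= rnorm v.
Proof. by rewrite -ler0c -rnormE. Qed.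

Lemma rnorm0 : rnorm (0 : V) = 0.
Proof. by rewrite /rnorm normr0. Qed.

Lemma rnorm_distC v w : rnorm (v - w) = rnorm (w - v).
Proof. by rewrite /rnorm distrC. Qed.

Lemma le_rnormD v w : rnorm (v + w) <= rnorm v + rnorm w.
Proof. by rewrite -lecR rmorphD/= -!rnormE ler_normD. Qed.

Lemma rnormZ (a : R[i]) v : rnorm (a *: v) = normc a * rnorm v.
Proof. by apply: complexI; rewrite rmorphM/= -!rnormE normrZ. Qed.

Lemma rnorm_eq0 v : rnorm v = 0 -> v = 0.
Proof. by move=> h; apply/eqP; rewrite -normr_eq0 rnormE h. Qed.

Lemma rnorm_gt0 v : (0 < rnorm v) = (v != 0).
Proof. by rewrite -ltcR -rnormE normr_gt0. Qed.

Lemma le_norm_rnorm (z : R[i]) (e : R) v :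
  (`|z| <= e%:C * `|v|) = (normc z <= e * rnorm v).
Proof. by rewrite rnormE normcE -rmorphM lecR. Qed.

Lemma near_rnormP v (P : V -> Prop) : (\forall w \near v, P w) <->
  exists2 d : R, 0 < d & forall w, rnorm (w - v) < d -> P w.
Proof.
split.
  move=> /nbhs_ballP[e e0 eP]; move: (e0); rewrite /= ltcE => /andP[/eqP ime ree].
  have eE : e = (complex.Re e)%:C by case: e ime {e0 eP ree} => a b /= ->.
  exists (complex.Re e) => // w wv; apply: eP; rewrite -ball_normE /=.
  by rewrite eE rnormE ltcR rnorm_distC.
move=> [d d0 dP]; apply/nbhs_ballP; exists d%:C; first by rewrite /= ltcR.
move=> w; rewrite -ball_normE /= rnormE ltcR rnorm_distC; exact: dP.
Qed.

End real_norm.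

Lemma rnorm_normc (R : realType) (z : R[i]) : rnorm (z : R[i]) = normc z.
Proof. by []. Qed.

Section differentiability.
Variables (R : realType) (V : normedModType R[i]).
Implicit Types (f : V -> R[i]) (x : V).

Lemma differentiable_epsP f x : differentiable f x ->
  forall e : R, 0 < e -> exists2 d : R, 0 < d & forall w, rnorm (w - x) < d ->
    normc (f w - f x - 'd f x (w - x)) <= e * rnorm (w - x).
Proof.
move=> /diff_locallyP[_ /eqaddoP h] e e0.
have e0' : 0 < e%:C by rewrite ltcR.
have /near_rnormP[d d0 hd] := h _ e0'.
exists d => // w wx; have := hd (w - x); rewrite subr0 => /(_ wx).
by rewrite le_norm_rnorm !fctE /= subrK opprD addrA.
Qed.

Lemma differentiable_cvg f x : differentiable f x ->
  forall e : R, 0 < e -> exists2 d : R, 0 < d & forall w, rnorm (w - x) < d ->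
    normc (f w - f x) <= e.
Proof.
move=> /differentiable_continuous fx e e0.
have e0' : 0 < e%:C by rewrite ltcR.
have /near_rnormP[d d0 hd] : \forall w \near x, `|f x - f w| <= e%:C.
  by have /cvgrPdist_le := fx; exact.
exists d => // w /hd; by rewrite normcE lecR normc_distC.
Qed.

Lemma epsP_differentiable f x (L : {linear V -> R[i]}) : continuous L ->
  (forall e : R, 0 < e -> exists2 d : R, 0 < d & forall w, rnorm (w - x) < d ->
    normc (f w - f x - L (w - x)) <= e * rnorm (w - x)) ->
  differentiable f x /\ 'd f x = L :> (V -> R[i]).
Proof.
move=> cL h.
have fE : f \o shift x = cst (f x) + L +o_ 0 id.
  apply/eqaddoP => e e0.
  have [Ee Ree] : e = (complex.Re e)%:C /\ 0 < complex.Re e.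
    by move: e0; rewrite ltcE; case: e => a b /= /andP[/eqP -> ->].
  have [d d0 hd] := h _ Ree.
  apply/near_rnormP; exists d => // w; rewrite subr0 => wd.
  rewrite Ee le_norm_rnorm !fctE /= opprD addrA.
  by have := hd (w + x); rewrite addrK; exact.
have dE := diff_unique cL fE; split; last exact: dE.
by apply/diff_locallyP; rewrite dE; split; [exact: cL|exact: fE].
Qed.

End differentiability.

Section rectangle_integral.
Variable R : realType.
Implicit Types (f : R[i] -> R[i]) (a b c d : R).

Definition in_rect a b c d (z : R[i]) :=
  (a <= complex.Re z <= b) && (c <= complex.Im z <= d).

Definition rint a b c d f : R[i] :=
  cint a b (fun x => f (x +i* c)) - cint a b (fun x => f (x +i* d)) +
  'i * (cint c d (fun y => f (b +i* y)) - cint c d (fun y => f (a +i* y))).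

Definition hside a b (y : R) f := cintegrable a b (fun x => f (x +i* y)).
Definition vside c d (x : R) f := cintegrable c d (fun y => f (x +i* y)).

Lemma hside_differentiable a b y f :
  (forall x, a <= x <= b -> differentiable f (x +i* y)) -> hside a b y f.
Proof.
move=> H; apply: ccontinuous_integrable => t tab e e0.
have [d d0 hd] := differentiable_cvg (H t tab) e0; exists d => // s sab st.
apply: hd; rewrite rnorm_normc [X in normc X](_ : _ = (s - t)%:C) ?normcR//.
by simpc.
Qed.

Lemma vside_differentiable c d x f :
  (forall y, c <= y <= d -> differentiable f (x +i* y)) -> vside c d x f.
Proof.
move=> H; apply: ccontinuous_integrable => t tab e e0.
have [r d0 hd] := differentiable_cvg (H t tab) e0; exists r => // s sab st.
apply: hd; rewrite rnorm_normc [X in normc X](_ : _ = 'i * (s - t)%:C).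
  by rewrite Normc.normcM normcR /= expr0n expr1n/= add0r sqrtr1 mul1r.
by simpc.
Qed.

Lemma rint_catx a m b c d f : a <= m -> m <= b -> hside a b c f -> hside a b d f ->
  rint a b c d f = rint a m c d f + rint m b c d f.
Proof.
move=> am mb hc hd; rewrite /rint (cint_cat am mb hc) (cint_cat am mb hd); ring.
Qed.

Lemma rint_caty a b c m d f : c <= m -> m <= d -> vside c d a f -> vside c d b f ->
  rint a b c d f = rint a b c m f + rint a b m d f.
Proof.
move=> cm md ha hb; rewrite /rint (cint_cat cm md ha) (cint_cat cm md hb); ring.
Qed.

Definition sides a b c d f :=
  [/\ hside a b c f, hside a b d f, vside c d a f & vside c d b f].

Lemma rintB a b c d f g : sides a b c d f -> sides a b c d g ->
  rint a b c d (fun z => f z - g z) = rint a b c d f - rint a b c d g.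
Proof.
move=> [f1 f2 f3 f4] [g1 g2 g3 g4]; rewrite /rint !cintB//; ring.
Qed.

Lemma rintZ a b c d k f : sides a b c d f ->
  rint a b c d (fun z => k * f z) = k * rint a b c d f.
Proof. by move=> [f1 f2 f3 f4]; rewrite /rint !cintZ//; ring. Qed.

Lemma sides_differentiable a b c d f : a <= b -> c <= d ->
  (forall x, a <= x <= b -> differentiable f (x +i* c) /\ differentiable f (x +i* d)) ->
  (forall y, c <= y <= d -> differentiable f (a +i* y) /\ differentiable f (b +i* y)) ->
  sides a b c d f.
Proof.
move=> ab cd h v; split.
- apply: hside_differentiable => t ht; exact: (h t ht).1.
- apply: hside_differentiable => t ht; exact: (h t ht).2.
- apply: vside_differentiable => t ht; exact: (v t ht).1.
- apply: vside_differentiable => t ht; exact: (v t ht).2.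
Qed.

Lemma normc_rint_le a b c d f (M : R) : a <= b -> c <= d -> sides a b c d f ->
  (forall x, a <= x <= b -> normc (f (x +i* c)) <= M /\ normc (f (x +i* d)) <= M) ->
  (forall y, c <= y <= d -> normc (f (a +i* y)) <= M /\ normc (f (b +i* y)) <= M) ->
  normc (rint a b c d f) <= 2 * M * ((b - a) + (d - c)).
Proof.
move=> ab cd [f1 f2 f3 f4] h v.
apply: le_trans (le_normcD _ _) _.
rewrite Normc.normcM [X in X * _](_ : _ = 1) ?mul1r; last first.
  by rewrite /= expr0n expr1n/= add0r sqrtr1.
have := le_normcB (cint a b (fun x => f (x +i* c))) (cint a b (fun x => f (x +i* d))).
have := le_normcB (cint c d (fun y => f (b +i* y))) (cint c d (fun y => f (a +i* y))).
have := normc_cint_le ab f1 (fun x hx => (h x hx).1).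
have := normc_cint_le ab f2 (fun x hx => (h x hx).2).
have := normc_cint_le cd f3 (fun x hx => (v x hx).1).
have := normc_cint_le cd f4 (fun x hx => (v x hx).2).
lra.
Qed.

Lemma integral_id a b : a <= b ->
  \int[lebesgue_measure]_(t in `[a, b]) t = (b ^+ 2 - a ^+ 2) / 2.
Proof.
rewrite le_eqVlt => /predU1P[->|ab]; first by rewrite set_itv1 Rintegral_set1 subrr mul0r.
rewrite /Rintegral (@continuous_FTC2 _ id (fun x => x ^+ 2 / 2))//=.
- by rewrite mulrBl.
- by apply: continuous_subspaceT => x; exact: cvg_id.
- split.
  + by move=> x _; apply: derivableM; [exact: exprn_derivable|exact: derivable_cst].
  + apply: cvg_at_right_filter.
    by apply: cvgM; [exact: exprn_continuous|exact: cvg_cst].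
  + apply: cvg_at_left_filter.
    by apply: cvgM; [exact: exprn_continuous|exact: cvg_cst].
- move=> x _; rewrite derive1E.
  apply: (@derive_val _ _ _ _ _ _ x).
  apply: is_derive_eq; rewrite /GRing.scale/= ; lra.
Qed.

Lemma cint_affine a b (u v : R[i]) : a <= b ->
  cintegrable a b (fun t => u + v * t%:C) /\
  cint a b (fun t => u + v * t%:C) = u * (b - a)%:C + v * ((b ^+ 2 - a ^+ 2) / 2)%:C.
Proof.
move=> ab.
have cc (k : R -> R[i]) (K : R) : (forall s t, normc (k s - k t) <= K * `|s - t|) -> cintegrable a b k.
  move=> hk; apply: ccontinuous_integrable => t tab e e0.
  exists (e / (`|K| + 1)); first by rewrite divr_gt0// ltr_wpDl.
  move=> s sab; rewrite ltr_pdivlMr ?ltr_wpDl// => st; apply: le_trans (hk s t) _.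
  apply: le_trans (ltW st); rewrite mulrC ler_wpM2l//.
  by rewrite (le_trans (ler_norm _))// lerDl.
have iC : cintegrable a b (fun t => t%:C).
  by apply: (cc _ 1) => s t; rewrite -(rmorphB (real_complex R)) normcR mul1r.
have i1 (k : R[i]) : cintegrable a b (fun t => k).
  by apply: (cc _ 0) => s t; rewrite subrr Normc.normc0 mul0r.
split; first by apply: cintegrableD => //; exact: cintegrableZ.
rewrite cintD ?cintZ//; last exact: cintegrableZ.
congr (_ + _ * _).
  rewrite (@eq_cint _ _ _ _ (fun t => u * 1)); last by move=> t _; rewrite mulr1.
  rewrite cintZ//; congr (_ * _); rewrite /cint /=.
  rewrite !Rintegral_cst// mul0r mul1r.
  have -> // : fine (lebesgue_measure `[a, b]) = b - a.
  rewrite lebesgue_measure_itv/= lte_fin; case: ltP => //= ba.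
  by rewrite (@le_anti _ _ a b) ?subrr// ab ba.
by rewrite /cint/= integral_id// Rintegral_cst// mul0r.
Qed.

Lemma rint_affine a b c d (u v : R[i]) : a <= b -> c <= d ->
  sides a b c d (fun z => u + v * z) /\ rint a b c d (fun z => u + v * z) = 0.
Proof.
move=> ab cd.
have cE (x y : R) : x +i* y = x%:C + 'i * y%:C := complexE _.
have HE (y : R) (x : R) : u + v * (x +i* y) = (u + v * ('i * y%:C)) + v * x%:C.
  by rewrite cE; ring.
have VE (x : R) (y : R) : u + v * (x +i* y) = (u + v * x%:C) + (v * 'i) * y%:C.
  by rewrite cE; ring.
split.
  split.
  - by apply: eq_cintegrable (cint_affine _ _ ab).1 => x _; rewrite HE.
  - by apply: eq_cintegrable (cint_affine _ _ ab).1 => x _; rewrite HE.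
  - by apply: eq_cintegrable (cint_affine _ _ cd).1 => x _; rewrite VE.
  - by apply: eq_cintegrable (cint_affine _ _ cd).1 => x _; rewrite VE.
rewrite /rint.
under [cint a b (fun x => u + v * (x +i* c))]eq_cint do rewrite HE.
under [cint a b (fun x => u + v * (x +i* d))]eq_cint do rewrite HE.
under [cint c d (fun y => u + v * (b +i* y))]eq_cint do rewrite VE.
under [cint c d (fun y => u + v * (a +i* y))]eq_cint do rewrite VE.
rewrite !(cint_affine _ _ _).2// !rmorphB/=; ring.
Qed.

End rectangle_integral.

(** If the property failed, so would it for one quarter at each stage; these
    rectangles shrink to a point, around which the property holds. *)
Lemma rectangle_bisection (R : realType) (P : R -> R -> R -> R -> Prop) (a b c d : R) :
  a <= b -> c <= d ->
  (forall a b c d, a <= b -> c <= d ->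
    let m := (a + b) / 2 in let n := (c + d) / 2 in
    P a m c n -> P m b c n -> P a m n d -> P m b n d -> P a b c d) ->
  (forall x y, a <= x <= b -> c <= y <= d -> exists2 r : R, 0 < r &
    forall a' b' c' d', a <= a' -> a' <= x <= b' -> b' <= b ->
      c <= c' -> c' <= y <= d' -> d' <= d -> b' - a' < r -> d' - c' < r ->
      P a' b' c' d') ->
  P a b c d.
Proof.
move=> ab cd quarter small; apply: contrapT => nP.
pose Q := ((R * R) * (R * R))%type.
pose bad (q : Q) := [/\ q.1.1 <= q.1.2, q.2.1 <= q.2.2 & ~ P q.1.1 q.1.2 q.2.1 q.2.2].
pose sub (q q' : Q) := [/\ q.1.1 <= q'.1.1, q'.1.2 <= q.1.2, q.2.1 <= q'.2.1,
  q'.2.2 <= q.2.2 & (q'.1.2 - q'.1.1 = (q.1.2 - q.1.1) / 2) /\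
  (q'.2.2 - q'.2.1 = (q.2.2 - q.2.1) / 2)].
have half (x y : R) : x <= y -> [/\ x <= (x + y) / 2, (x + y) / 2 <= y,
    (x + y) / 2 - x = (y - x) / 2 & y - (x + y) / 2 = (y - x) / 2].
  by move=> xy; split; lra.
have /choice[s sP] : forall q, exists q', bad q -> bad q' /\ sub q q'.
  move=> q; case: (pselect (bad q)) => [[q1 q2 q3]|nb]; last by exists q.
  pose m := (q.1.1 + q.1.2) / 2; pose n := (q.2.1 + q.2.2) / 2.
  have [m1 m2 m3 m4] := half _ _ q1; have [n1 n2 n3 n4] := half _ _ q2.
  have [H1|nP'] := pselect (P q.1.1 m q.2.1 n); last first.
    exists ((q.1.1, m), (q.2.1, n)) => _; split; split => //=.
  have [H2|nP'] := pselect (P m q.1.2 q.2.1 n); last first.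
    exists ((m, q.1.2), (q.2.1, n)) => _; split; split => //=.
  have [H3|nP'] := pselect (P q.1.1 m n q.2.2); last first.
    exists ((q.1.1, m), (n, q.2.2)) => _; split; split => //=.
  have [H4|nP'] := pselect (P m q.1.2 n q.2.2); last first.
    exists ((m, q.1.2), (n, q.2.2)) => _; split; split => //=.
  by case: q3; exact: quarter.
pose u n := iter n s ((a, b), (c, d)).
have ub n : bad (u n).
  by elim: n => [|n IH]; [split|exact: (sP _ IH).1].
have us n : sub (u n) (u n.+1) by exact: (sP _ (ub n)).2.
have um n k : [/\ (u n).1.1 <= (u (n + k)%N).1.1, (u (n + k)%N).1.2 <= (u n).1.2,
    (u n).2.1 <= (u (n + k)%N).2.1 & (u (n + k)%N).2.2 <= (u n).2.2].
  elim: k => [|k [h1 h2 h3 h4]]; first by rewrite addn0.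
  have [] := us (n + k)%N; rewrite addnS => g1 g2 g3 g4 _.
  by split; [exact: le_trans g1|exact: le_trans h2|exact: le_trans g3|exact: le_trans h4].
have ul n : (u n).1.2 - (u n).1.1 = (b - a) / 2 ^+ n /\
            (u n).2.2 - (u n).2.1 = (d - c) / 2 ^+ n.
  elim: n => [|n [h1 h2]]; first by rewrite expr0 !divr1.
  have [_ _ _ _ [-> ->]] := us n; rewrite h1 h2 exprS invfM; split; ring.
have cross n m : (u n).1.1 <= (u m).1.2 /\ (u n).2.1 <= (u m).2.2.
  have [h1 _ h3 _] := um n m; have [_ g2 _ g4] := um m n.
  have [k1 k2 _] := ub (n + m)%N; rewrite addnC in g2 g4.
  split; first exact: le_trans h1 (le_trans k1 g2).
  exact: le_trans h3 (le_trans k2 g4).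
have limit (e1 e2 : nat -> R) : (forall n m, e1 n <= e2 m) ->
    exists x, forall n, e1 n <= x <= e2 n.
  move=> h; exists (sup (range e1)) => n.
  have hs : has_sup (range e1).
    by split; [exists (e1 0%N), 0%N|exists (e2 0%N) => _ [k _ <-]; exact: h].
  apply/andP; split; first by apply: (sup_upper_bound hs); exists n.
  by apply: (sup_le_ub hs.1) => _ [k _ <-]; exact: h.
have [x hx] := limit (fun n => (u n).1.1) (fun n => (u n).1.2) (fun n m => (cross n m).1).
have [y hy] := limit (fun n => (u n).2.1) (fun n => (u n).2.2) (fun n m => (cross n m).2).
have [r r0 hr] := small x y (hx 0%N) (hy 0%N).
have small_n (l : R) : 0 <= l -> exists N, forall n, (N <= n)%N -> l / 2 ^+ n < r.
  move=> l0; have e0 : 0 < r / (l + 1) by rewrite divr_gt0// ltr_wpDl.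
  have [N _ hN] := near_infty_natSinv_expn_lt (PosNum e0).
  exists N => n Nn; have := hN n Nn; rewrite /= ltr_pdivlMr ?ltr_wpDl//.
  rewrite mul1r mulrC => h; apply: le_lt_trans h; apply: ler_wpM2r => //.
  by rewrite lerDl.
have [N1 h1] := small_n (b - a) ltac:(lra).
have [N2 h2] := small_n (d - c) ltac:(lra).
pose n := maxn N1 N2.
have [_ _] := ub n; apply.
have [g1 g2 g3 g4] := um 0%N n; have [l1 l2] := ul n.
apply: (hr _ _ _ _ g1 (hx n) g2 g3 (hy n) g4).
  by rewrite l1; apply: h1; exact: leq_maxl.
by rewrite l2; apply: h2; exact: leq_maxr.
Qed.

(** * Cauchy theory in one variable *)

Section cauchy.
Variable R : realType.
Implicit Types (f : R[i] -> R[i]) (a b c d s S : R).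

Lemma diff1E_mul f z (h : R[i]) : differentiable f z -> 'd f z h = h * 'd f z 1.
Proof. by move=> _; rewrite -[in LHS](mulr1 h) -[h * 1]/(h *: (1 : R[i]^o)) linearZ. Qed.

Lemma normc_i_mul (x : R[i]) : normc ('i * x) = normc x.
Proof. by rewrite Normc.normcM /= expr0n expr1n/= add0r sqrtr1 mul1r. Qed.

Lemma sides_in_rect f a b c d : a <= b -> c <= d ->
  (forall z, in_rect a b c d z -> differentiable f z) -> sides a b c d f.
Proof.
move=> ab cd df; apply: sides_differentiable => //.
- move=> t tt; split; apply: df; apply/andP; split => //=; by rewrite lexx ?andbT.
- move=> t tt; split; apply: df; apply/andP; split => //=; by rewrite lexx ?andbT.
Qed.

Lemma in_rect_sub a b c d a' b' c' d' z : a <= a' -> b' <= b -> c <= c' ->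
  d' <= d -> in_rect a' b' c' d' z -> in_rect a b c d z.
Proof. by rewrite /in_rect => *; lra. Qed.

Let normc_sum4 (z1 z2 z3 z4 : R[i]) q : normc z1 <= q -> normc z2 <= q ->
  normc z3 <= q -> normc z4 <= q -> normc (z1 + z2 + (z3 + z4)) <= q + q + (q + q).
Proof.
move=> h1 h2 h3 h4; apply: le_trans (le_normcD _ _) _; apply: lerD;
  by apply: le_trans (le_normcD _ _) _; exact: lerD.
Qed.

(** Goursat: on a small rectangle around a point of differentiability the
    function is affine up to an error that is small compared with the diameter, and
    affine functions integrate to zero, so the integral is small compared with the
    squared diameter; bisection transfers this bound to the whole rectangle. *)
Lemma goursat f a b c d : a <= b -> c <= d ->
  (forall z, in_rect a b c d z -> differentiable f z) -> rint a b c d f = 0.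
Proof.
move=> ab cd df; apply: normc_eqP => e0 e0_gt0; rewrite subr0.
pose L := (b - a) + (d - c).
have L0 : 0 <= L by rewrite /L; lra.
pose e := e0 / (L ^+ 2 + 1).
have e_gt0 : 0 < e by rewrite divr_gt0// ltr_wpDl// sqr_ge0.
suff : normc (rint a b c d f) <= e * L ^+ 2.
  move=> h; apply: le_trans h _; rewrite /e mulrAC ler_pdivrMr ?ltr_wpDl ?sqr_ge0//.
  by rewrite ler_wpM2l ?(ltW e0_gt0)// lerDl.
pose P a' b' c' d' := a <= a' -> b' <= b -> c <= c' -> d' <= d ->
  normc (rint a' b' c' d' f) <= e * ((b' - a') + (d' - c')) ^+ 2.
suff : P a b c d by apply; rewrite lexx.
apply: rectangle_bisection => //.
  move=> a' b' c' d' ab' cd' m n P1 P2 P3 P4 aa bb cc dd.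
  have am : a' <= m /\ m <= b' by rewrite /m; lra.
  have cn : c' <= n /\ n <= d' by rewrite /n; lra.
  have dfh y : c' <= y <= d' -> hside a' b' y f.
    move=> yy; apply: hside_differentiable => x xx; apply: df.
    move: xx yy => /andP[x1 x2] /andP[y1 y2]; rewrite /in_rect /=.
    by rewrite (le_trans aa x1) (le_trans x2 bb) (le_trans cc y1) (le_trans y2 dd).
  have dfv x : a' <= x <= b' -> vside c' d' x f.
    move=> xx; apply: vside_differentiable => y yy; apply: df.
    move: xx yy => /andP[x1 x2] /andP[y1 y2]; rewrite /in_rect /=.
    by rewrite (le_trans aa x1) (le_trans x2 bb) (le_trans cc y1) (le_trans y2 dd).
  have [am1 am2] := am; have [cn1 cn2] := cn.
  rewrite (@rint_caty _ a' b' c' n d' _ cn1 cn2); [|by apply: dfv; rewrite lexx|by apply: dfv; rewrite lexx andbT].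
  rewrite (@rint_catx _ a' m b' c' n _ am1 am2); [|by apply: dfh; rewrite lexx|by apply: dfh; rewrite cn1].
  rewrite (@rint_catx _ a' m b' n d' _ am1 am2); [|by apply: dfh; rewrite cn1|by apply: dfh; rewrite lexx andbT].
  have ma := le_trans aa am1; have mb := le_trans am2 bb.
  have nc := le_trans cc cn1; have nd := le_trans cn2 dd.
  pose q := e * ((b' - a') + (d' - c')) ^+ 2 / 4.
  have qE : e * ((b' - a') + (d' - c')) ^+ 2 = q + q + (q + q) by rewrite /q; field.
  have h1 : normc (rint a' m c' n f) <= q.
    have -> : q = e * ((m - a') + (n - c')) ^+ 2 by rewrite /q /m /n; field.
    exact: P1.
  have h2 : normc (rint m b' c' n f) <= q.
    have -> : q = e * ((b' - m) + (n - c')) ^+ 2 by rewrite /q /m /n; field.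
    exact: P2.
  have h3 : normc (rint a' m n d' f) <= q.
    have -> : q = e * ((m - a') + (d' - n)) ^+ 2 by rewrite /q /m /n; field.
    exact: P3.
  have h4 : normc (rint m b' n d' f) <= q.
    have -> : q = e * ((b' - m) + (d' - n)) ^+ 2 by rewrite /q /m /n; field.
    exact: P4.
  by rewrite qE; exact: normc_sum4.
move=> x y xx yy; pose z0 := x +i* y.
have dz0 : differentiable f z0 by apply: df; apply/andP.
have e2 : 0 < e / 2 by rewrite divr_gt0.
have [r r0 hr] := differentiable_epsP dz0 e2.
exists (r / 2); first by rewrite divr_gt0.
move=> a' b' c' d' aa xx' bb cc yy' dd br dr _ _ _ _.
have ab' : a' <= b' by move: xx' => /andP[]; exact: le_trans.
have cd' : c' <= d' by move: yy' => /andP[]; exact: le_trans.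
have [sA rA] := rint_affine (f z0 - 'd f z0 1 * z0) ('d f z0 1) ab' cd'.
have sF : sides a' b' c' d' f.
  apply: sides_in_rect; [exact: ab'|exact: cd'|] => z zz; apply: df.
  exact: in_rect_sub zz.
have -> : rint a' b' c' d' f =
    rint a' b' c' d' (fun z => f z - (f z0 - 'd f z0 1 * z0 + 'd f z0 1 * z)).
  by rewrite rintB// rA subr0.
set rho := fun z => _.
have hrho u v : a' <= u <= b' -> c' <= v <= d' ->
    normc (rho (u +i* v)) <= e / 2 * ((b' - a') + (d' - c')).
  move=> uu vv; clear -uu vv hr dz0 xx' yy' br dr r0 e_gt0 e2.
  have zz : normc (u +i* v - z0) <= (b' - a') + (d' - c').
    apply: le_trans (normc_le_ReIm _) _; rewrite /z0 /=.
    by apply: lerD; rewrite ler_norml; lra.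
  have -> : rho (u +i* v) = f (u +i* v) - f z0 - 'd f z0 (u +i* v - z0).
    by rewrite (diff1E_mul _ dz0) /rho; ring.
  apply: le_trans (hr _ _) _; rewrite rnorm_normc; first by lra.
  by rewrite ler_wpM2l// ltW.
have E : e * (b' - a' + (d' - c')) ^+ 2 =
  2 * (e / 2 * ((b' - a') + (d' - c'))) * ((b' - a') + (d' - c')) by field.
rewrite E; apply: normc_rint_le => //.
- have := sF => -[? ? ? ?]; have := sA => -[? ? ? ?].
  by split; apply: cintegrableD => //; exact: cintegrableN.
- by move=> u uu; split; apply: hrho => //; rewrite lexx ?cd'.
- by move=> u uu; split; apply: hrho => //; rewrite lexx ?ab'.
Qed.

(** Squares replace discs: the integrals over their sides are integrals over segments
    and need no parametrization of the circle. *)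
Definition in_square S := in_rect (- S) S (- S) S.
Definition qint S f := rint (- S) S (- S) S f.

Lemma in_square_le s S z : s <= S -> in_square s z -> in_square S z.
Proof. by rewrite /in_square /in_rect => sS /andP[? ?]; apply/andP; split; lra. Qed.

Lemma side_square S t : 0 < S -> - S <= t <= S ->
  [/\ in_square S (t +i* - S), in_square S (t +i* S), in_square S (- S +i* t) &
      in_square S (S +i* t)] /\
  [/\ S <= normc (t +i* - S), S <= normc (t +i* S), S <= normc (- S +i* t) &
      S <= normc (S +i* t)].
Proof.
move=> S0 tt; split; first by split; apply/andP; split => /=; lra.
split.
- by apply: le_trans (Im_le_normc _); rewrite /= normrN ler_norm.
- by apply: le_trans (Im_le_normc _); rewrite /= ler_norm.
- by apply: le_trans (Re_le_normc _); rewrite /= normrN ler_norm.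
- by apply: le_trans (Re_le_normc _); rewrite /= ler_norm.
Qed.

Lemma normc_neq0 (z : R[i]) (x : R) : 0 < x -> x <= normc z -> z != 0.
Proof. by move=> x0 xz; rewrite -normc_gt0; exact: lt_le_trans xz. Qed.

Definition holo_punctured S f :=
  forall z, in_square S z -> z != 0 -> differentiable f z.

Lemma holo_punctured_sides S f : 0 < S -> holo_punctured S f ->
  sides (- S) S (- S) S f.
Proof.
move=> S0 hf; apply: sides_differentiable; [lra|lra| |] => t tt;
  have [[i1 i2 i3 i4] [j1 j2 j3 j4]] := side_square S0 tt;
  by split; apply: hf => //; exact: (normc_neq0 S0).
Qed.

(** The frame between the two squares is cut into four rectangles that avoid the
    centre, where the integrals vanish by Goursat's theorem. *)
Lemma qint_shrink f s S : 0 < s -> s <= S -> holo_punctured S f ->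
  qint S f = qint s f.
Proof.
move=> s0 sS hf.
have df x y : - S <= x <= S -> - S <= y <= S -> (s <= `|x| \/ s <= `|y|) ->
    differentiable f (x +i* y).
  move=> xx yy h; apply: hf; first by apply/andP.
  apply: (normc_neq0 s0); case: h => h; apply: le_trans h _.
    exact: (Re_le_normc (x +i* y)).
  exact: (Im_le_normc (x +i* y)).
have nS : s <= `|S| by rewrite ger0_norm; lra.
have nmS : s <= `|- S| by rewrite normrN.
have ns : s <= `|s| by rewrite ger0_norm; lra.
have nms : s <= `|- s| by rewrite normrN.
have Ss : - S <= - s by rewrite lerN2.
have ss : - s <= s by rewrite ge0_cp// ltW.
have sS' : - s <= S := le_trans ss sS.
have Ss' : - S <= s := le_trans Ss ss.
have SS : - S <= S := le_trans Ss sS'.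
have low x : - S <= x <= - s -> - S <= x <= S /\ s <= `|x|.
  move=> /andP[h1 h2]; rewrite h1 (le_trans h2 sS') -normrN; split=> //.
  by apply: le_trans (ler_norm _); rewrite lerNr.
have high x : s <= x <= S -> - S <= x <= S /\ s <= `|x|.
  move=> /andP[h1 h2]; rewrite (le_trans Ss' h1) h2; split=> //.
  exact: le_trans h1 (ler_norm _).
have wide c d x : - S <= c -> d <= S -> c <= x <= d -> - S <= x <= S.
  by move=> hc hd /andP[h1 h2]; rewrite (le_trans hc h1) (le_trans h2 hd).
have SSr : - S <= S <= S by rewrite SS lexx.
have SSl : - S <= - S <= S by rewrite SS lexx.
have Sr : - S <= s <= S by rewrite Ss' sS.
have Sl : - S <= - s <= S by rewrite Ss sS'.
have vS c d : - S <= c -> d <= S -> vside c d S f.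
  move=> hc hd; apply: vside_differentiable => y /(wide _ _ _ hc hd) yy.
  by apply: df => //; left.
have vmS c d : - S <= c -> d <= S -> vside c d (- S) f.
  move=> hc hd; apply: vside_differentiable => y /(wide _ _ _ hc hd) yy.
  by apply: df => //; left.
rewrite /qint (@rint_caty _ _ _ _ (- s))//; [|exact: vmS|exact: vS].
rewrite [X in X + _]goursat//; last first.
  by case=> x y /andP[/= h1 /low[h2 h3]]; apply: df => //; right.
rewrite add0r (@rint_caty _ _ _ _ s)//; [|exact: vmS|exact: vS].
rewrite [X in _ + X]goursat//; last first.
  by case=> x y /andP[/= h1 /high[h2 h3]]; apply: df => //; right.
rewrite addr0.
have hs a b : - S <= a -> b <= S -> hside a b s f.
  move=> hc hd; apply: hside_differentiable => y /(wide _ _ _ hc hd) yy.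
  by apply: df => //; right.
have hms a b : - S <= a -> b <= S -> hside a b (- s) f.
  move=> hc hd; apply: hside_differentiable => y /(wide _ _ _ hc hd) yy.
  by apply: df => //; right.
rewrite (@rint_catx _ _ (- s))//; [|exact: hms|exact: hs].
rewrite [X in X + _]goursat//; last first.
  case=> x y /andP[/= /low[h1 h3] h2]; apply: df => //; last by left.
  exact: wide h2.
rewrite add0r (@rint_catx _ _ s)//; [|exact: hms|exact: hs].
rewrite [X in _ + X]goursat//; last first.
  case=> x y /andP[/= /high[h1 h3] h2]; apply: df => //; last by left.
  exact: wide h2.
by rewrite addr0.
Qed.

Lemma differentiable_inv (z : R[i]) : z != 0 ->
  differentiable (fun w : R[i] => w^-1) z.
Proof.
by move=> z0; apply: (@differentiableV _ _ id) => //; exact: differentiable_id.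
Qed.

(** The winding integral [qint S (fun w => w^-1)] equals 2 pi i; a lower bound on its
    modulus is all that the estimates use. *)
Lemma normc_winding S : 0 < S -> 4 <= normc (qint S (fun w => w^-1)).
Proof.
move=> S0.
have hinv : holo_punctured S (fun w => w^-1).
  by move=> z _ z0; exact: differentiable_inv.
have [s1 s2 s3 s4] := holo_punctured_sides S0 hinv.
have iv (x y : R) : (x +i* y)^-1 =
    (x / (x ^+ 2 + y ^+ 2)) +i* - (y / (x ^+ 2 + y ^+ 2)) by [].
have SS : - S <= S by lra.
pose k t := S / (S ^+ 2 + t ^+ 2).
have kb t : - S <= t <= S -> (2 * S)^-1 <= k t.
  move=> tt; have t2 : t ^+ 2 <= S ^+ 2.
    have : 0 <= (S - t) * (S + t) by rewrite mulr_ge0//; lra.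
    nra.
  have S2 : 0 < S ^+ 2 by rewrite exprn_gt0.
  have t20 := sqr_ge0 t.
  rewrite /k ler_pdivlMr; last by lra.
  rewrite mulrC ler_pdivrMr; last by lra.
  nra.
have ik : lebesgue_measure.-integrable `[- S, S] (EFin \o k).
  have [h _] := s4; apply: eq_integrable h => //= t _.
have I1 : 1 <= \int[lebesgue_measure]_(t in `[- S, S]) k t.
  apply: (@le_trans _ _ (\int[lebesgue_measure]_(t in `[- S, S]) (2 * S)^-1)).
    rewrite Rintegral_cst//.
    have -> // : fine (lebesgue_measure `[- S, S]) = 2 * S.
      rewrite lebesgue_measure_itv/= lte_fin; case: ltP => //= ba; lra.
    by rewrite mulVf// gt_eqF//; lra.
  apply: le_Rintegral => //.
    apply: continuous_compact_integrable; first exact: segment_compact.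
    by apply: continuous_subspaceT => x; exact: cst_continuous.
apply: le_trans (Im_le_normc _); apply: le_trans (ler_norm _).
have ImB (z w : R[i]) : complex.Im (z - w) = complex.Im z - complex.Im w by case: z; case: w.
have ReB (z w : R[i]) : complex.Re (z - w) = complex.Re z - complex.Re w by case: z; case: w.
have ImDi (z w : R[i]) : complex.Im (z + 'i * w) = complex.Im z + complex.Re w.
  by case: z => z1 z2; case: w => w1 w2; rewrite /= mul0r add0r mul1r.
rewrite /qint /rint ImDi ImB ReB /=.
rewrite [leRHS](_ : _ = 4 * \int[lebesgue_measure]_(t in `[- S, S]) k t); first by lra.
have E (h : R -> R) (c : R) : (forall t, h t = c * k t) ->
    \int[lebesgue_measure]_(t in `[- S, S]) h t =
    c * \int[lebesgue_measure]_(t in `[- S, S]) k t.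
  move=> hk; rewrite -RintegralZl//; apply: eq_Rintegral => t _; exact: hk.
rewrite (E (fun t => - (- S / (t ^+ 2 + (- S) ^+ 2))) 1); last first.
  by move=> t; rewrite /k sqrrN mulNr opprK mul1r addrC.
rewrite (E (fun t => - (S / (t ^+ 2 + S ^+ 2))) (-1)); last first.
  by move=> t; rewrite /k mulN1r addrC.
rewrite (E (fun t => S / (S ^+ 2 + t ^+ 2)) 1); last first.
  by move=> t; rewrite /k mul1r.
rewrite (E (fun t => - S / ((- S) ^+ 2 + t ^+ 2)) (-1)); last first.
  by move=> t; rewrite /k sqrrN mulN1r mulNr.
ring.
Qed.

(** The difference [f w - A / w] is o(1 / w) at the centre, so its integral over small
    squares tends to zero; by [qint_shrink] it does not depend on the square. *)
Lemma residue f (A : R[i]) S : 0 < S -> holo_punctured S f ->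
  (forall e : R, 0 < e -> exists2 r : R, 0 < r &
    forall w, w != 0 -> normc w < r -> normc (w * f w - A) <= e) ->
  qint S f = A * qint S (fun w => w^-1).
Proof.
move=> S0 hf hA.
have hinv : holo_punctured S (fun w => w^-1).
  by move=> z _ z0; exact: differentiable_inv.
have sinv := holo_punctured_sides S0 hinv.
pose k w := f w - A * w^-1.
have hk : holo_punctured S k.
  move=> z zS z0; apply: differentiableB; first exact: hf.
  by apply: (@differentiableZ _ _ _ (fun w : R[i] => w^-1)); exact: differentiable_inv.
have hAinv : sides (- S) S (- S) S (fun w => A * w^-1).
  by have [? ? ? ?] := sinv; split; exact: cintegrableZ.
apply: normc_eqP => e0 e0_gt0.
rewrite /qint -rintZ// -rintB//; last exact: holo_punctured_sides.
rewrite -/(qint S k).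
have [r r0 hr] := hA (e0 / 8) ltac:(lra).
pose s := Num.min S (r / 4).
have s0 : 0 < s by rewrite lt_min S0/=; lra.
have sS : s <= S by rewrite ge_min lexx.
have sr : s <= r / 4 by rewrite ge_min lexx orbT.
rewrite (qint_shrink s0 sS hk).
have hks : holo_punctured s k.
  by move=> z zs; apply: hk; exact: in_square_le zs.
have kb w : in_square s w -> s <= normc w -> normc (k w) <= e0 / 8 / s.
  move=> ws sw; have w0 := normc_neq0 s0 sw.
  have -> : k w = (w * f w - A) * w^-1.
    by rewrite /k mulrBl mulrAC divff// mul1r.
  rewrite Normc.normcM Normc.normcV.
  apply: ler_pM; rewrite ?invr_ge0 ?normc_ge0//.
    apply: hr => //; apply: le_lt_trans (normc_le_ReIm _) _.
    move: ws => /andP[/andP[a1 a2] /andP[a3 a4]].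
    have n1 : `|complex.Re w| <= s by rewrite ler_norml; lra.
    have n2 : `|complex.Im w| <= s by rewrite ler_norml; lra.
    lra.
  by rewrite lef_pV2 ?posrE// (lt_le_trans s0).
have -> : e0 = 2 * (e0 / 8 / s) * ((s - - s) + (s - - s)) by field; rewrite gt_eqF.
apply: normc_rint_le; [lra|lra|exact: holo_punctured_sides| |] => t tt;
  have [[? ? ? ?] [? ? ? ?]] := side_square s0 tt; split; exact: kb.
Qed.

(** Cauchy's estimate: the derivative at the centre is the residue of
    [(f w - f 0) / w ^+ 2]. *)
Lemma cauchy_derivative f M S : 0 < S ->
  (forall z, in_square S z -> differentiable f z) ->
  (forall z, in_square S z -> normc (f z) <= M) ->
  normc ('d f 0 1) <= 4 * M / S.
Proof.
move=> S0 df fM.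
have S00 : in_square S 0 by apply/andP; split => /=; lra.
pose k w := (f w - f 0) * (w^-1 * w^-1).
have hk : holo_punctured S k.
  move=> z zS z0; apply: differentiableM.
    by apply: differentiableB; [exact: df|exact: differentiable_cst].
  by apply: differentiableM; exact: differentiable_inv.
have df0 := df _ S00.
have resE : qint S k = 'd f 0 1 * qint S (fun w => w^-1).
  apply: residue => // e e0.
  have [r r0 hr] := differentiable_epsP df0 e0.
  exists r => // w w0 wr; have := hr w; rewrite subr0 => /(_ wr).
  rewrite (diff1E_mul _ df0) rnorm_normc => h.
  have -> : w * k w - 'd f 0 1 = (f w - f 0 - w * 'd f 0 1) * w^-1.
    by rewrite /k; field.
  rewrite Normc.normcM Normc.normcV ler_pdivrMr ?normc_gt0//.
have b := normc_winding S0.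
have kb w : in_square S w -> S <= normc w -> normc (k w) <= 2 * M / S ^+ 2.
  move=> ws sw; have w0 := normc_neq0 S0 sw.
  rewrite /k !Normc.normcM !Normc.normcV.
  apply: ler_pM; rewrite ?mulr_ge0 ?invr_ge0 ?normc_ge0//.
    apply: le_trans (le_normcB _ _) _; have := fM _ ws; have := fM _ S00; lra.
  by rewrite -invfM -expr2 lef_pV2 ?posrE ?exprn_gt0 ?normc_gt0// ler_pXn2r ?nnegrE ?normc_ge0// ltW.
have : normc (qint S k) <= 2 * (2 * M / S ^+ 2) * ((S - - S) + (S - - S)).
  apply: normc_rint_le; [lra|lra|exact: holo_punctured_sides| |] => t tt;
    have [[? ? ? ?] [? ? ? ?]] := side_square S0 tt; split; exact: kb.
rewrite resE Normc.normcM.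
have -> : 2 * (2 * M / S ^+ 2) * ((S - - S) + (S - - S)) = 4 * (4 * M / S).
  by field; rewrite gt_eqF.
move=> h; have := ler_wpM2l (normc_ge0 ('d f 0 1)) b; lra.
Qed.

(** [f 0] is the residue of [f w / w], and [S <= normc w] on the sides. *)
Lemma cauchy_center f S : 0 < S ->
  (forall z, in_square S z -> differentiable f z) ->
  4 * S * normc (f 0) <=
    \int[lebesgue_measure]_(t in `[- S, S]) normc (f (t +i* - S)) +
    \int[lebesgue_measure]_(t in `[- S, S]) normc (f (t +i* S)) +
    \int[lebesgue_measure]_(t in `[- S, S]) normc (f (- S +i* t)) +
    \int[lebesgue_measure]_(t in `[- S, S]) normc (f (S +i* t)).
Proof.
move=> S0 df.
have S00 : in_square S 0 by apply/andP; split => /=; lra.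
pose k w := f w * w^-1.
have hk : holo_punctured S k.
  by move=> z zS z0; apply: differentiableM; [exact: df|exact: differentiable_inv].
have resE : qint S k = f 0 * qint S (fun w => w^-1).
  apply: residue => // e e0.
  have [r r0 hr] := differentiable_cvg (df _ S00) e0.
  exists r => // w w0 wr; have := hr w; rewrite subr0 => /(_ wr).
  by have -> : w * k w = f w by rewrite /k; field.
have b := normc_winding S0.
have sk : sides (- S) S (- S) S k by exact: holo_punctured_sides.
have sf : sides (- S) S (- S) S f.
  by apply: sides_differentiable; [lra|lra| |] => t tt;
    have [[? ? ? ?] _] := side_square S0 tt; split; exact: df.
have kf w : S <= normc w -> normc (k w) <= S^-1 * normc (f w).
  move=> sw; rewrite /k Normc.normcM Normc.normcV mulrC ler_wpM2r ?normc_ge0//.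
  by rewrite lef_pV2 ?posrE// (lt_le_trans S0).
have side (p : R -> R[i]) : cintegrable (- S) S (fun t => k (p t)) ->
    cintegrable (- S) S (fun t => f (p t)) ->
    (forall t, - S <= t <= S -> S <= normc (p t)) ->
    S * normc (cint (- S) S (fun t => k (p t))) <=
    \int[lebesgue_measure]_(t in `[- S, S]) normc (f (p t)).
  move=> ik iff hp; rewrite -ler_pdivlMl//.
  apply: le_trans (normc_cint ik) _; rewrite -RintegralZl//; last exact: cintegrable_normc.
  apply: le_Rintegral => //; first exact: cintegrable_normc.
    apply: (@integrableZl _ _ _ lebesgue_measure `[- S, S]%classic _ S^-1
      (EFin \o (fun t => normc (f (p t))))) => //.
    exact: cintegrable_normc.
  by move=> t; rewrite /= in_itv/= => tt; apply: kf; exact: hp.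
have [k1 k2 k3 k4] := sk; have [f1 f2 f3 f4] := sf.
have q1 := side _ k1 f1 (fun t tt => let: conj _ (And4 h _ _ _) := side_square S0 tt in h).
have q2 := side _ k2 f2 (fun t tt => let: conj _ (And4 _ h _ _) := side_square S0 tt in h).
have q3 := side _ k3 f3 (fun t tt => let: conj _ (And4 _ _ h _) := side_square S0 tt in h).
have q4 := side _ k4 f4 (fun t tt => let: conj _ (And4 _ _ _ h) := side_square S0 tt in h).
apply: le_trans (lerD (lerD (lerD q1 q2) q3) q4).
have : S * (4 * normc (f 0)) <= S * normc (qint S k).
  rewrite ler_pM2l// resE Normc.normcM mulrC ler_wpM2l ?normc_ge0//.
rewrite -!mulrDr mulrA [S * 4]mulrC => h; apply: le_trans h _; rewrite ler_pM2l//.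
apply: le_trans (le_normcD _ _) _; rewrite normc_i_mul.
apply: le_trans (lerD (le_normcB _ _) (le_normcB _ _)) _.
by rewrite [X in _ + X <= _]addrC addrA.
Qed.

End cauchy.

(** * Cauchy estimates in several variables *)

Section real_slices.
Variable R : realType.

Lemma eps_is_derive (f : R -> R) (t L : R) :
  (forall e : R, 0 < e -> exists2 d : R, 0 < d & forall s, `|s - t| < d ->
     `|f s - f t - L * (s - t)| <= e * `|s - t|) -> is_derive t 1 f L.
Proof.
move=> H.
have cv : h^-1 *: (f (h *: 1 + t) - f t) @[h --> 0^'] --> L.
  apply/cvgrPdist_le => e e0; have [d d0 hd] := H e e0.
  near=> h; have h0 : h != 0 by near: h; exact: nbhs_dnbhs_neq.
  have hd' : `|h| < d.
    near: h; apply: dnbhs0_lt => //.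
  have := hd (h *: 1 + t).
  rewrite addrK /GRing.scale/= mulr1 => /(_ hd').
  move=> {}hd.
  have -> : L - h^-1 * (f (h + t) - f t) = - (h^-1 * (f (h + t) - f t - L * h)).
    by field.
  rewrite normrN.
  by rewrite normrM normfV ler_pdivrMl ?normr_gt0// [leRHS]mulrC.
apply: DeriveDef; first by apply/cvg_ex; exists L.
by apply: cvg_lim.
Unshelve. all: by end_near. Qed.

Lemma is_derive_slice (phi : R[i] -> R[i]) (t : R) : differentiable phi t%:C ->
  is_derive t 1 (fun s : R => complex.Re (phi s%:C)) (complex.Re ('d phi (t%:C) 1)) /\
  is_derive t 1 (fun s : R => complex.Im (phi s%:C)) (complex.Im ('d phi (t%:C) 1)).
Proof.
move=> dphi.
have H e : 0 < e -> exists2 d : R, 0 < d & forall s, `|s - t| < d ->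
    normc (phi s%:C - phi t%:C - (s - t)%:C * 'd phi (t%:C) 1) <= e * `|s - t|.
  move=> e0; have [d d0 hd] := differentiable_epsP dphi e0; exists d => // s st.
  have := hd s%:C; rewrite -(rmorphB (real_complex R)) rnorm_normc normcR => /(_ st).
  by rewrite (diff1E_mul _ dphi).
split; apply: eps_is_derive => e e0; have [d d0 hd] := H e e0; exists d => // s st.
- apply: le_trans (hd s st); apply: le_trans (Re_le_normc _).
  rewrite [leLHS](_ : _ = `|complex.Re (phi s%:C - phi t%:C - (s - t)%:C * 'd phi (t%:C) 1)|)//.
  congr `| _ |; case: (phi _) => a b; case: (phi _) => a' b'; case: ('d _ _ _) => a'' b'' /=.
  ring.
- apply: le_trans (hd s st); apply: le_trans (Im_le_normc _).
  rewrite [leLHS](_ : _ = `|complex.Im (phi s%:C - phi t%:C - (s - t)%:C * 'd phi (t%:C) 1)|)//.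
  congr `| _ |; case: (phi _) => a b; case: (phi _) => a' b'; case: ('d _ _ _) => a'' b'' /=.
  ring.
Qed.

(** The mean value theorem is applied to the real part of [phi], rotated so that the
    increment of [phi] becomes real. *)
Lemma mean_value_inequality (phi : R[i] -> R[i]) (K : R) :
  (forall t : R, 0 <= t <= 1 -> differentiable phi t%:C) ->
  (forall t : R, 0 <= t <= 1 -> normc ('d phi (t%:C) 1) <= K) ->
  normc (phi 1 - phi 0) <= K.
Proof.
move=> dphi hK; set D := phi 1 - phi 0.
have [->|D0] := eqVneq D 0.
  by rewrite Normc.normc0; apply: le_trans (normc_ge0 ('d phi (0%:C) 1)) (hK 0 _); rewrite lexx ler01.
pose c : R[i] := D^*.
pose cr := complex.Re c; pose ci := complex.Im c.
pose u (s : R) := cr * complex.Re (phi s%:C) - ci * complex.Im (phi s%:C).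
pose du (s : R) := cr * complex.Re ('d phi (s%:C) 1) - ci * complex.Im ('d phi (s%:C) 1).
have uE s : u s = complex.Re (c * phi s%:C) by rewrite ReM.
have duE s : du s = complex.Re (c * 'd phi (s%:C) 1) by rewrite ReM.
have [||t tt E] := @MVT_segment R u du 0 1 ler01.
- move=> t; rewrite in_itv/= => /andP[t0 t1].
  have [d1 d2] := is_derive_slice (dphi t ltac:(by rewrite !ltW)).
  exact: is_deriveB.
- apply: within_continuousP => t tt e e0.
  have e1 : 0 < e / (normc c + 1) by rewrite divr_gt0// ltr_wpDl// normc_ge0.
  have [d d0 hd] := differentiable_cvg (dphi t tt) e1.
  exists d => // s ss st; have := hd s%:C.
  rewrite -(rmorphB (real_complex R)) rnorm_normc normcR => /(_ st) h.
  rewrite !uE -raddfB; apply: le_trans (Re_le_normc _) _.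
  rewrite -mulrBr Normc.normcM; apply: le_trans (ler_wpM2l (normc_ge0 c) h) _.
  rewrite mulrA ler_pdivrMr ?ltr_wpDl ?normc_ge0// mulrC ler_wpM2l// ?(ltW e0)//.
  by rewrite lerDl.
move: tt; rewrite in_itv/= => tt.
move: E; rewrite subr0 mulr1 !uE duE -raddfB -mulrBr.
have nc : normc c = normc D by have := normcJ D; rewrite !normcE => -[].
have -> : c * (phi 1%:C - phi 0%:C) = ((normc D) ^+ 2)%:C.
  by rewrite mulrC -/D -sqr_normc normcE rmorphXn.
rewrite /= => E.
have : normc D ^+ 2 <= normc D * K.
  rewrite E; apply: le_trans (ler_norm _) _; apply: le_trans (Re_le_normc _) _.
  by rewrite Normc.normcM nc ler_wpM2l ?normc_ge0// hK.
by rewrite expr2 ler_pM2l ?normc_gt0.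
Qed.

End real_slices.

(** The differential is locked to keep unification from unfolding it. *)
HB.lock Definition dder (R : realType) (V : normedModType R[i]) (f : V -> R[i])
  (x h : V) : R[i] := 'd f x h.

Section pointwise_calculus.
Variables (R : realType) (V : normedModType R[i]).
Implicit Types (f g : V -> R[i]) (x h : V).

Lemma dderE f x h : dder f x h = 'd f x h.
Proof. by rewrite dder.unlock. Qed.

Lemma dderD f x h k : dder f x (h + k) = dder f x h + dder f x k.
Proof. by rewrite !dderE linearD. Qed.

Lemma dderZ f x (a : R[i]) h : dder f x (a *: h) = a * dder f x h.
Proof. by rewrite !dderE linearZ. Qed.

Lemma dder0 f x : dder f x 0 = 0.
Proof. by rewrite dderE linear0. Qed.

Lemma dder_epsP f x : differentiable f x ->
  forall e : R, 0 < e -> exists2 d : R, 0 < d & forall w, rnorm (w - x) < d ->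
    normc (f w - f x - dder f x (w - x)) <= e * rnorm (w - x).
Proof.
move=> df e e0; have [d d0 hd] := differentiable_epsP df e0.
by exists d => // w wx; rewrite dderE; exact: hd.
Qed.

Lemma epsP_dder f x (L : {linear V -> R[i]}) : continuous L ->
  (forall e : R, 0 < e -> exists2 d : R, 0 < d & forall w, rnorm (w - x) < d ->
    normc (f w - f x - L (w - x)) <= e * rnorm (w - x)) ->
  differentiable f x /\ forall h, dder f x h = L h.
Proof.
move=> cL h; have [d1 d2] := epsP_differentiable cL h.
split; first exact: d1.
by move=> k; rewrite dderE; exact: (congr1 (fun F => F k) d2).
Qed.

Lemma differentiable_add f g x : differentiable f x -> differentiable g x ->
  differentiable (fun u => f u + g u) x.
Proof. by move=> df dg; exact: (differentiableD df dg). Qed.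

Lemma differentiable_sub f g x : differentiable f x -> differentiable g x ->
  differentiable (fun u => f u - g u) x.
Proof. by move=> df dg; exact: (differentiableB df dg). Qed.

Lemma differentiable_mul f g x : differentiable f x -> differentiable g x ->
  differentiable (fun u => f u * g u) x.
Proof. by move=> df dg; exact: (differentiableM df dg). Qed.

Lemma dder_add f g x h : differentiable f x -> differentiable g x ->
  dder (fun u => f u + g u) x h = dder f x h + dder g x h.
Proof. by move=> df dg; rewrite !dderE; exact: (congr1 (fun F => F h) (diffD df dg)). Qed.

Lemma dder_sub f g x h : differentiable f x -> differentiable g x ->
  dder (fun u => f u - g u) x h = dder f x h - dder g x h.
Proof. by move=> df dg; rewrite !dderE; exact: (congr1 (fun F => F h) (diffB df dg)). Qed.

Lemma dder_mul f g x h : differentiable f x -> differentiable g x ->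
  dder (fun u => f u * g u) x h = f x * dder g x h + g x * dder f x h.
Proof. by move=> df dg; rewrite !dderE; exact: (congr1 (fun F => F h) (diffM df dg)). Qed.

Lemma differentiable_dder f x y : differentiable f x ->
  differentiable (dder f x) y /\ forall h, dder (dder f x) y h = dder f x h.
Proof.
move=> df; have cL : continuous ('d f x) by exact: diff_continuous.
have [e e0|d1 d2] := @epsP_dder (dder f x) y ('d f x) cL.
  exists 1 => // w _; rewrite !dderE (linearB ('d f x)) subrr Normc.normc0.
  by rewrite mulr_ge0 ?rnorm_ge0// ltW.
by split => [|h]; [exact: d1|rewrite d2 dderE].
Qed.

End pointwise_calculus.

Section several_variables.
Variables (R : realType) (n : nat).
Local Notation Cn := 'rV[R[i]]_n.
Implicit Types (f : Cn -> R[i]) (z w h v : Cn).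

Lemma rnorm_coord v k : normc (v 0 k) <= rnorm v.
Proof.
rewrite -lecR -normcE -rnormE [`|v|]mx_normE.
have H : ((fun i : 'I_1 * 'I_n => `|v i.1 i.2|%:nng) (0, k))%:num <=
    (\big[Num.max/0%:nng]_i `|v i.1 i.2|%:nng)%:num.
  by rewrite num_le; exact: le_bigmax.
exact: H.
Qed.

Lemma rnorm_le v (e : R) : 0 <= e -> (forall k, normc (v 0 k) <= e) -> rnorm v <= e.
Proof.
move=> e0 h; rewrite -lecR -rnormE [`|v|]mx_normE.
have e0' : 0 <= e%:C :> R[i] by rewrite ler0c.
have -> : e%:C = (NngNum e0')%:num by [].
rewrite num_le; apply/bigmax_leP; split => [|[i k] _].
  by rewrite -num_le.
by rewrite -num_le /= ord1 normcE lecR.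
Qed.

Definition slice f z h (l : R[i]) : R[i] := f (z + l *: h).

Lemma slice_differentiable f z h (l : R[i]) : differentiable f (z + l *: h) ->
  differentiable (slice f z h) l /\ 'd (slice f z h) l 1 = dder f (z + l *: h) h.
Proof.
move=> df; rewrite dderE; pose a (l : R[i]) := z + l *: h.
have [da dE] : differentiable a l /\ 'd a l = (fun k : R[i] => k *: h) :> (R[i] -> Cn).
  have H : is_diff l a (0 + (fun k : R[i] => k *: h)).
    by apply: (@is_diffD _ _ _ (cst z) (fun k : R[i] => k *: h)).
  split; first by case: H.
  by case: H => _ ->; rewrite add0r.
split; first exact: (differentiable_comp da df).
rewrite -[slice f z h]/(f \o a) diff_comp//= dE scale1r; by [].
Qed.

Lemma differentiable_translate f z v : differentiable f (z + v) ->
  differentiable (fun u : Cn => f (u + v)) z /\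
  forall h, dder (fun u : Cn => f (u + v)) z h = dder f (z + v) h.
Proof.
move=> df; have cL : continuous ('d f (z + v)) by exact: diff_continuous.
have [e e0|d1 d2] := @epsP_dder _ _ (fun u : Cn => f (u + v)) z ('d f (z + v)) cL.
  have [d d0 hd] := differentiable_epsP df e0; exists d => // w wz.
  by have := hd (w + v); rewrite opprD addrACA subrr addr0 => /(_ wz).
by split => [|h]; [exact: d1|rewrite d2 dderE].
Qed.

Definition cball z (r : R) : set Cn := [set w | rnorm (w - z) < r].

Lemma cball_center z (r : R) : 0 < r -> cball z r z.
Proof. by rewrite /cball/= subrr rnorm0. Qed.

Lemma cballD z v (r : R) : rnorm v < r -> cball z r (z + v).
Proof. by rewrite /cball/= [z + v]addrC addrK. Qed.

Definition holo_bounded f z (r M : R) := forall w, cball z r w ->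
  differentiable f w /\ normc (f w) <= M.

Lemma cball_sub z w (r s : R) : rnorm (w - z) + s <= r -> cball w s `<=` cball z r.
Proof.
move=> h u; rewrite /cball/= => us; rewrite -(subrK w u) -addrA.
by apply: le_lt_trans (le_rnormD _ _) _; lra.
Qed.

Lemma holo_bounded_sub f z w (r s M : R) : rnorm (w - z) + s <= r ->
  holo_bounded f z r M -> holo_bounded f w s M.
Proof. by move=> h H u us; apply: H; exact: cball_sub us. Qed.

Lemma holo_bounded_ge0 f z (r M : R) : 0 < r -> holo_bounded f z r M -> 0 <= M.
Proof.
move=> r0 H; have [|_] := H z; first by rewrite /cball/= subrr rnorm0.
exact: le_trans (normc_ge0 _).
Qed.

(** [cauchy_derivative] on the complex line through z in the direction h; the square
    of half-side [r / (4 * rnorm h)] is mapped into the ball. *)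
Lemma cauchy_estimate f z (r M : R) h : 0 < r -> holo_bounded f z r M ->
  normc (dder f z h) <= 16 * M * rnorm h / r.
Proof.
move=> r0 H; have M0 := holo_bounded_ge0 r0 H.
have zz : cball z r z by rewrite /cball/= subrr rnorm0.
have [->|h0] := eqVneq h 0.
  by rewrite dder0 Normc.normc0 rnorm0 mulr0 mul0r.
have h0' : 0 < rnorm h by rewrite rnorm_gt0.
pose S := r / (4 * rnorm h).
have S0 : 0 < S by rewrite divr_gt0// mulr_gt0.
have Sb l : in_square S l -> cball z r (z + l *: h).
  move=> lS; rewrite /cball/= addrC addKr rnormZ.
  have : normc l <= 2 * S.
    apply: le_trans (normc_le_ReIm _) _; move: lS => /andP[/andP[a1 a2] /andP[a3 a4]].
    have n1 : `|complex.Re l| <= S by rewrite ler_norml; lra.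
    have n2 : `|complex.Im l| <= S by rewrite ler_norml; lra.
    lra.
  move=> lS2; apply: (@le_lt_trans _ _ (2 * S * rnorm h)); first by rewrite ler_pM2r.
  have -> : 2 * S * rnorm h = r / 2 by rewrite /S; field; rewrite gt_eqF.
  lra.
have dz0 : differentiable f (z + 0 *: h) by rewrite scale0r addr0; have [] := H z zz.
have := @cauchy_derivative R (slice f z h) M S S0
  (fun l lS => (slice_differentiable (H _ (Sb l lS)).1).1)
  (fun l lS => (H _ (Sb l lS)).2).
rewrite (slice_differentiable dz0).2 scale0r addr0 => hh.
apply: le_trans hh _; rewrite le_eqVlt; apply/orP; left; apply/eqP.
by rewrite /S; field; rewrite !gt_eqF.
Qed.

Lemma mean_value_segment f w w' (K : R) :
  (forall t : R, 0 <= t <= 1 -> differentiable f (w + t%:C *: (w' - w))) ->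
  (forall t : R, 0 <= t <= 1 -> normc (dder f (w + t%:C *: (w' - w)) (w' - w)) <= K) ->
  normc (f w' - f w) <= K.
Proof.
move=> df hK; have := @mean_value_inequality R (slice f w (w' - w)) K.
rewrite /slice scale1r scale0r addr0 [w + (w' - w)]addrC subrK; apply.
- by move=> t tt; have [] := slice_differentiable (df t tt).
- by move=> t tt; have [_ ->] := slice_differentiable (df t tt); exact: hK.
Qed.

Lemma cball_segment z w w' (r t : R) : 0 <= t <= 1 -> cball z r w -> cball z r w' ->
  cball z r (w + t%:C *: (w' - w)).
Proof.
rewrite /cball/= => /andP[t0 t1] h h'.
have -> : w + t%:C *: (w' - w) - z = (1 - t)%:C *: (w - z) + t%:C *: (w' - z).
  rewrite rmorphB/= rmorph1 !scalerBr !scalerBl !scale1r.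
  by apply/rowP => k; rewrite !mxE; ring.
apply: le_lt_trans (le_rnormD _ _) _; rewrite !rnormZ !normcR.
rewrite (ger0_norm t0) ger0_norm ?subr_ge0//.
case: (ltgtP t 0) t0 => // [t0 _|-> _]; last by rewrite subr0 mul1r mul0r addr0.
have -> : r = (1 - t) * r + t * r by ring.
by apply: ler_ltD; [apply: ler_wpM2l; lra|rewrite ltr_pM2l].
Qed.

Lemma holo_lipschitz f z (r M : R) w w' : 0 < r -> holo_bounded f z r M ->
  cball z (r / 2) w -> cball z (r / 2) w' ->
  normc (f w' - f w) <= 32 * M * rnorm (w' - w) / r.
Proof.
move=> r0 H hw hw'.
have sub t : 0 <= t <= 1 -> cball z (r / 2) (w + t%:C *: (w' - w)).
  by move=> tt; exact: cball_segment.
have hb t : 0 <= t <= 1 -> holo_bounded f (w + t%:C *: (w' - w)) (r / 2) M.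
  move=> tt; apply: holo_bounded_sub H; have := sub t tt; rewrite /cball/=; lra.
have r2 : 0 < r / 2 by lra.
apply: mean_value_segment => t tt.
  by have [] := hb t tt (w + t%:C *: (w' - w)); rewrite /cball/= ?subrr ?rnorm0.
apply: le_trans (cauchy_estimate _ r2 (hb t tt)) _.
rewrite le_eqVlt; apply/orP; left; apply/eqP; by field; rewrite gt_eqF.
Qed.

(** The derivative is Lipschitz: it is the derivative at a fixed point of the
    difference of two translates, and that difference is small. *)
Lemma holo_taylor2 f z (r M : R) h : 0 < r -> holo_bounded f z r M ->
  rnorm h < r / 4 ->
  normc (f (z + h) - f z - dder f z h) <= 2048 * M * rnorm h ^+ 2 / r ^+ 2.
Proof.
move=> r0 H hr; have M0 := holo_bounded_ge0 r0 H.
have r4 : 0 < r / 4 by lra.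
have r42 : r / 4 < r / 2 by lra.
have zr4 v : rnorm v < r / 4 -> cball z (r / 2) (z + v).
  by move=> ?; apply: cballD; lra.
have Hd v : rnorm v < r / 2 -> differentiable f (z + v).
  by move=> vr; have [] // := H (z + v); apply: cballD; lra.
have dz : differentiable f z by have := Hd 0; rewrite addr0; apply; rewrite rnorm0; lra.
have lip v : rnorm v < r / 4 ->
    normc (dder f (z + v) h - dder f z h) <= 2048 * M * rnorm v * rnorm h / r ^+ 2.
  move=> vr; pose fv (u : Cn) : R[i] := f (u + v); pose k (u : Cn) : R[i] := fv u - f u.
  have dk u : cball z (r / 4) u ->
      differentiable fv u /\ dder fv u h = dder f (u + v) h.
    move=> uz; have dfu : differentiable f (u + v).
      have [] := H (u + v) => //; rewrite /cball/= addrAC.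
      by apply: le_lt_trans (le_rnormD _ _) _; move: uz; rewrite /cball/=; lra.
    have [d1 d2] := differentiable_translate dfu.
    by split; [exact: d1|exact: d2].
  have dfu u : cball z (r / 4) u -> differentiable f u.
    by move=> uz; have [] := H u => //; move: uz; rewrite /cball/=; lra.
  have Hk : holo_bounded k z (r / 4) (32 * M * rnorm v / r).
    move=> u uz; split.
      by apply: differentiable_sub; [exact: (dk u uz).1|exact: dfu].
    rewrite /k /fv; have := @holo_lipschitz f z r M u (u + v) r0 H.
    rewrite [X in rnorm X](_ : _ = v); last by rewrite addrC addKr.
    apply; first by move: uz; rewrite /cball/=; lra.
    rewrite /cball/= addrAC.
    by apply: le_lt_trans (le_rnormD _ _) _; move: uz; rewrite /cball/=; lra.
  have zz : cball z (r / 4) z by rewrite /cball/= subrr rnorm0.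
  have kE : dder k z h = dder f (z + v) h - dder f z h.
    have [d1 d2] := dk z zz; rewrite -d2; exact: dder_sub d1 (dfu z zz).
  have := cauchy_estimate h r4 Hk; rewrite kE => hh; apply: le_trans hh _.
  rewrite le_eqVlt; apply/orP; left; apply/eqP; by field; rewrite gt_eqF.
pose F (u : Cn) : R[i] := f u - dder f z u.
have dF v : rnorm v < r / 2 -> differentiable F (z + v) /\
    dder F (z + v) h = dder f (z + v) h - dder f z h.
  move=> vr; have [dL LE] := differentiable_dder (z + v) dz.
  split; first by apply: differentiable_sub; [exact: Hd|exact: dL].
  by rewrite -(LE h); apply: dder_sub; [exact: Hd|exact: dL].
have := @mean_value_segment F z (z + h) (2048 * M * rnorm h ^+ 2 / r ^+ 2).
rewrite [X in normc X](_ : _ = f (z + h) - f z - dder f z h); last first.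
  by rewrite /F dderD; ring.
have tn t : 0 <= t <= 1 -> rnorm (t%:C *: h) <= rnorm h.
  move=> /andP[t0 t1]; rewrite rnormZ normcR ger0_norm//.
  by rewrite ler_piMl// rnorm_ge0.
rewrite [z + h - z](_ : _ = h); last by rewrite addrC addKr.
apply=> t tt; have th := tn t tt; have [d1 d2] := dF _ (lt_trans (le_lt_trans th hr) r42) => //.
rewrite d2; apply: le_trans (lip _ (le_lt_trans th hr)) _.
rewrite ler_pM2r ?invr_gt0 ?exprn_gt0// expr2 mulrA ler_wpM2r ?rnorm_ge0//.
by apply: ler_wpM2l; [apply: mulr_ge0; [exact: ler0n|exact: M0]|exact: th].
Qed.

End several_variables.

(** * Limits of holomorphic functions *)

Section limits.
Variables (R : realType) (I : Type).
Implicit Types (F : set_system I) (u : I -> R[i]).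

(** The radii are real, so that estimates of [normc] apply directly, whereas the
    library's convergence in [R[i]] has radii in [R[i]]. *)
Definition ccvg F u (l : R[i]) :=
  forall e : R, 0 < e -> \forall i \near F, normc (u i - l) <= e.

Lemma ccvg_sub F G u l : F `<=` G -> ccvg F u l -> ccvg G u l.
Proof. by move=> FG H e /H; exact: FG. Qed.

Lemma ccvgD F u v l m : Filter F -> ccvg F u l -> ccvg F v m ->
  ccvg F (fun i => u i + v i) (l + m).
Proof.
move=> FF hu hv e e0; have e2 : 0 < e / 2 by lra.
near=> i.
have h1 : normc (u i - l) <= e / 2 by near: i; exact: hu.
have h2 : normc (v i - m) <= e / 2 by near: i; exact: hv.
rewrite opprD addrACA; apply: le_trans (le_normcD _ _) _; lra.
Unshelve. all: by end_near. Qed.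

Lemma ccvgZ F u l (c : R[i]) : Filter F -> ccvg F u l -> ccvg F (fun i => c * u i) (c * l).
Proof.
move=> FF hu e e0; have e2 : 0 < e / (normc c + 1) by rewrite divr_gt0// ltr_wpDl// normc_ge0.
apply: filterS (hu _ e2) => i; rewrite -mulrBr Normc.normcM => h.
apply: le_trans (ler_wpM2l (normc_ge0 _) h) _.
rewrite mulrA ler_pdivrMr ?ltr_wpDl ?normc_ge0// mulrC ler_wpM2l ?(ltW e0)//.
by rewrite lerDl.
Qed.

Lemma ccvg_cst F (c : R[i]) : Filter F -> ccvg F (fun _ => c) c.
Proof. by move=> FF e e0; near=> i; rewrite subrr Normc.normc0 ltW.
Unshelve. all: by end_near. Qed.

Lemma ccvg_sum F (J : Type) (s : seq J) (u : J -> I -> R[i]) (l : J -> R[i]) :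
  Filter F -> (forall j, ccvg F (u j) (l j)) ->
  ccvg F (fun i => \sum_(j <- s) u j i) (\sum_(j <- s) l j).
Proof.
move=> FF H; elim: s => [|j s IH].
  rewrite big_nil; under [fun i => _]eq_fun do rewrite big_nil; exact: ccvg_cst.
rewrite big_cons; under [fun i => _]eq_fun do rewrite big_cons.
exact: ccvgD.
Qed.

Lemma ccvg_le F u l (M : R) : ProperFilter F -> ccvg F u l ->
  (\forall i \near F, normc (u i) <= M) -> normc l <= M.
Proof.
move=> FF hu hM; apply/ler_addgt0Pr => e e0.
have [i [h1 h2]] : exists i, normc (u i - l) <= e /\ normc (u i) <= M.
  by apply: (@filter_ex _ F); apply: filterI => //; exact: hu.
rewrite -(subKr (u i) l); apply: le_trans (le_normcB _ _) _; lra.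
Qed.

Let ultra_bounded_real F (u : I -> R) (M : R) : UltraFilter F ->
  (\forall i \near F, `|u i| <= M) ->
  exists l, forall e : R, 0 < e -> \forall i \near F, `|u i - l| <= e.
Proof.
move=> FU hM.
pose S : set R := [set x | \forall i \near F, x <= u i].
have hS : has_sup S.
  split; first exists (- M).
    by apply: filterS hM => i; rewrite ler_norml => /andP[].
  exists M => x Sx.
  have [i [h1 h2]] : exists i, `|u i| <= M /\ x <= u i.
    by apply: (@filter_ex _ F); exact: filterI.
  by apply: le_trans h2 _; move: h1; rewrite ler_norml => /andP[].
exists (sup S) => e e0.
have h1 : \forall i \near F, sup S - e <= u i.
  have [x Sx hx] := sup_adherent e0 hS.
  by apply: filterS Sx => i; apply: le_trans; exact: ltW.
have h2 : \forall i \near F, u i <= sup S + e.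
  have [h|h] := @in_ultra_setVsetC _ F [set i | sup S + e <= u i] FU.
    have := ub_le_sup hS.2 (h : S (sup S + e)); lra.
  by apply: filterS h => i /= /negP; rewrite -ltNge => /ltW.
near=> i; rewrite ler_norml.
have a1 : sup S - e <= u i by near: i.
have a2 : u i <= sup S + e by near: i.
lra.
Unshelve. all: by end_near. Qed.

Lemma ultra_bounded F u (M : R) : UltraFilter F ->
  (\forall i \near F, normc (u i) <= M) -> exists l, ccvg F u l.
Proof.
move=> FU hM.
have [|x hx] := @ultra_bounded_real F (fun i => complex.Re (u i)) M FU.
  by apply: filterS hM => i; apply: le_trans (Re_le_normc _).
have [|y hy] := @ultra_bounded_real F (fun i => complex.Im (u i)) M FU.
  by apply: filterS hM => i; apply: le_trans (Im_le_normc _).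
exists (x +i* y) => e e0; have e2 : 0 < e / 2 by lra.
near=> i.
have h1 : `|complex.Re (u i) - x| <= e / 2 by near: i; exact: hx.
have h2 : `|complex.Im (u i) - y| <= e / 2 by near: i; exact: hy.
apply: le_trans (normc_le_ReIm _) _; rewrite !raddfB/=; lra.
Unshelve. all: by end_near. Qed.

End limits.

Section locally_bounded_families.
Variables (R : realType) (n : nat).
Local Notation Cn := 'rV[R[i]]_n.
Implicit Types (f g : Cn -> R[i]) (z w h v : Cn).

Lemma dder_coord f z h :
  dder f z h = \sum_k h 0 k * dder f z (delta_mx 0 k).
Proof.
rewrite [in LHS](row_sum_delta h) dderE linear_sum/=; apply: eq_bigr => k _.
by rewrite linearZ/= dderE.
Qed.

Lemma cball_le z w (r s : R) : r <= s -> cball z r w -> cball z s w.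
Proof. by rewrite /cball/= => rs /lt_le_trans; apply. Qed.

(** The linear map with prescribed values on the standard basis: the candidate for
    the differential of a limit, built from limits of partial derivatives. *)
Definition lincomb (l : 'I_n -> R[i]) (h : Cn) : R[i] := \sum_k h 0 k * l k.

Lemma lincomb_is_linear l : linear (lincomb l).
Proof.
move=> a u v; rewrite /lincomb scaler_sumr -big_split/=; apply: eq_bigr => k _.
by rewrite !mxE -[_ *: (_ * _)]/(_ * (_ * _)) mulrDl mulrA.
Qed.
HB.instance Definition _ l := GRing.isLinear.Build R[i] Cn R[i] _ (lincomb l)
  (lincomb_is_linear l).

Lemma lincomb_continuous l : continuous (lincomb l).
Proof.
move=> z; apply/(@cvgrPdist_le _ _ _ (nbhs z) (nbhs_filter z)) => e e0.
have [Ee Ree] : e = (complex.Re e)%:C /\ 0 < complex.Re e.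
  by move: e0; rewrite ltcE; case: e => a b /= /andP[/eqP -> ->].
pose K := \sum_k normc (l k) + 1.
have K0 : 0 < K by rewrite ltr_wpDl// sumr_ge0// => k _; exact: normc_ge0.
apply: (near_rnormP (z : Cn) (fun t => `|lincomb l z - lincomb l t| <= e)).2.
exists (complex.Re e / K); first by rewrite divr_gt0.
move=> w; rewrite ltr_pdivlMr// => wz.
rewrite Ee normcE lecR -(linearB (lincomb l)) /lincomb.
apply: le_trans (normc_sum _ _) _; apply: le_trans (ltW wz).
rewrite rnorm_distC /K mulrDr mulr1 mulr_sumr.
apply: ler_wpDr; first exact: rnorm_ge0.
apply: ler_sum => k _; rewrite Normc.normcM ler_wpM2r ?normc_ge0//.
exact: rnorm_coord.
Qed.

(** Montel-type closure: a pointwise limit of a uniformly bounded family of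
    holomorphic functions is differentiable, because the second-order Taylor estimate
    is uniform over the family and the derivatives, being bounded, converge along
    an ultrafilter. *)
Lemma limit_differentiable (I : Type) (F : set_system I) (f : I -> Cn -> R[i]) g
    z (r M : R) : ProperFilter F -> 0 < r ->
  (\forall i \near F, holo_bounded (f i) z r M) ->
  (forall w, cball z r w -> ccvg F (fun i => f i w) (g w)) ->
  differentiable g z.
Proof.
move=> FF r0 hb hg.
have [G [GU FG]] := ultraFilterLemma FF.
have {hb FF}hb : \forall i \near G, holo_bounded (f i) z r M by exact: FG.
have {FG}hg w (hw : cball z r w) := ccvg_sub FG (hg w hw).
have /choice[l hl] : forall k, exists l, ccvg G (fun i => dder (f i) z (delta_mx 0 k)) l.
  move=> k; apply: (@ultra_bounded _ _ _ _ (16 * M * rnorm (delta_mx 0 k : Cn) / r)).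
  by apply: filterS hb => i hi; exact: cauchy_estimate.
have hL h : ccvg G (fun i => dder (f i) z h) (lincomb l h).
  have -> : (fun i => dder (f i) z h) =
      (fun i => \sum_k h 0 k * dder (f i) z (delta_mx 0 k)).
    by apply/funext => i; exact: dder_coord.
  by apply: ccvg_sum => k; exact: ccvgZ.
have M0 : 0 <= M.
  by have [i hi] := @filter_ex _ G _ _ hb; exact: holo_bounded_ge0 hi.
pose K := 2048 * M / r ^+ 2.
have K0 : 0 <= K.
  apply: divr_ge0; last by apply: exprn_ge0; exact: ltW.
  by apply: mulr_ge0; [exact: ler0n|exact: M0].
have est h : rnorm h < r / 4 -> normc (g (z + h) - g z - lincomb l h) <= K * rnorm h ^+ 2.
  move=> hr.
  have hr' : rnorm h < r by lra.
  have h1 := hg (z + h) (cballD z hr').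
  have h2 := hg z (cball_center z r0).
  have hc : ccvg G (fun i => f i (z + h) + -1 * f i z + -1 * dder (f i) z h)
      (g (z + h) + -1 * g z + -1 * lincomb l h).
    by apply: ccvgD; [apply: ccvgD => //; exact: ccvgZ|exact: ccvgZ].
  have -> : g (z + h) - g z - lincomb l h = g (z + h) + -1 * g z + -1 * lincomb l h.
    by rewrite !mulN1r.
  apply: ccvg_le hc _; apply: filterS hb => i hi.
  rewrite !mulN1r; apply: le_trans (holo_taylor2 r0 hi hr) _.
  by rewrite /K mulrAC.
have [e e0|d1 _] := @epsP_dder _ _ g z (lincomb l) (@lincomb_continuous l); last exact: d1.
exists (Num.min (r / 4) (e / (K + 1))).
  by rewrite lt_min !divr_gt0// ltr_wpDl.
move=> w; rewrite lt_min => /andP[w1 w2].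
have := est (w - z) w1; rewrite [z + (w - z)]addrC subrK => h; apply: le_trans h _.
rewrite expr2 mulrA ler_wpM2r ?rnorm_ge0//.
move: w2; rewrite ltr_pdivlMr ?ltr_wpDl// => w2.
have := rnorm_ge0 (w - z); nra.
Qed.

Lemma differentiable_holo_bounded f (U : set Cn) z : open U -> holomorphic_on U f -> U z ->
  exists r M, [/\ 0 < r, holo_bounded f z r M & cball z r `<=` U].
Proof.
move=> oU hf Uz.
have /near_rnormP[d d0 hd] : \forall w \near z, U w by exact: open_nbhs_nbhs.
have [d' d'0 hd'] := differentiable_cvg (hf z Uz) ltr01.
exists (Num.min d d'), (normc (f z) + 1); split.
- by rewrite lt_min d0.
- move=> w; rewrite /cball/= lt_min => /andP[wd wd']; split; first by apply: hf; exact: hd.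
  rewrite -(subrK (f z) (f w)) addrC; apply: le_trans (le_normcD _ _) _.
  by rewrite lerD2l hd'.
- by move=> w; rewrite /cball/= lt_min => /andP[wd _]; exact: hd.
Qed.

Lemma natSinv_cvg (e : R) : 0 < e -> \forall m \near \oo, m.+1%:R^-1 < e.
Proof. by move=> e0; exact: (near_infty_natSinv_lt (PosNum e0)). Qed.

Lemma difference_quotient_ccvg f z v : differentiable f z ->
  ccvg \oo (fun m : nat => (m.+1%:R : R[i]) * (f (z + (m.+1%:R^-1)%:C *: v) - f z))
    (dder f z v).
Proof.
move=> df e e0; pose e1 := e / (rnorm v + 1).
have e10 : 0 < e1 by rewrite divr_gt0// ltr_wpDl// rnorm_ge0.
have [d d0 hd] := dder_epsP df e10.
have d1 : 0 < d / (rnorm v + 1) by rewrite divr_gt0// ltr_wpDl// rnorm_ge0.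
near=> m.
have mE : (m.+1%:R : R[i]) = (m.+1%:R : R)%:C by rewrite rmorph_nat.
have m0 : 0 < (m.+1%:R : R) by rewrite ltr0n.
have md : m.+1%:R^-1 < d / (rnorm v + 1) by near: m; exact: natSinv_cvg.
have rE : rnorm ((m.+1%:R^-1 : R)%:C *: v) = m.+1%:R^-1 * rnorm v.
  by rewrite rnormZ normcR ger0_norm// invr_ge0 ltW.
have zE : z + (m.+1%:R^-1)%:C *: v - z = (m.+1%:R^-1)%:C *: v by rewrite addrC addKr.
have rs : rnorm ((m.+1%:R^-1 : R)%:C *: v) < d.
  rewrite rE; apply: le_lt_trans (_ : m.+1%:R^-1 * (rnorm v + 1) < d).
    by rewrite ler_wpM2l ?invr_ge0 ?(ltW m0)// lerDl.
  by rewrite -ltr_pdivlMr// ltr_wpDl// rnorm_ge0.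
have := hd (z + (m.+1%:R^-1)%:C *: v); rewrite zE => /(_ rs).
rewrite rE dderZ.
move=> h; have -> : m.+1%:R * (f (z + (m.+1%:R^-1)%:C *: v) - f z) - dder f z v =
   m.+1%:R * (f (z + (m.+1%:R^-1)%:C *: v) - f z - (m.+1%:R^-1)%:C * dder f z v).
  rewrite [RHS]mulrBr mulrA mE -rmorphM/= divff ?gt_eqF// rmorph1 mul1r//.
rewrite Normc.normcM mE normcR ger0_norm ?(ltW m0)//.
rewrite -ler_pdivlMl//; apply: le_trans h _.
rewrite mulrCA ler_wpM2l ?invr_ge0 ?(ltW m0)//.
rewrite /e1 mulrAC ler_pdivrMr ?ltr_wpDl ?rnorm_ge0// ler_wpM2l ?(ltW e0)//.
by rewrite lerDl.
Unshelve. all: by end_near. Qed.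

(** Directional derivatives are limits of difference quotients, which are bounded
    by the Lipschitz estimate. *)
Lemma holomorphic_dder f (U : set Cn) v : open U -> holomorphic_on U f ->
  holomorphic_on U (fun w => dder f w v).
Proof.
move=> oU hf z Uz.
have [r [M [r0 hb rU]]] := differentiable_holo_bounded oU hf Uz.
have M0 := holo_bounded_ge0 r0 hb.
pose q (m : nat) (w : Cn) : R[i] :=
  (m.+1%:R : R[i]) * (f (w + (m.+1%:R^-1)%:C *: v) - f w).
have r4 : 0 < r / 4 by lra.
have r4r : r / 4 <= r by lra.
have r2r : r / 2 <= r by lra.
have sub4 w : cball z (r / 4) w -> cball z (r / 2) w by rewrite /cball/=; lra.
apply: (@limit_differentiable _ \oo q _ z (r / 4) (32 * M * rnorm v / r)) => //; last first.
  move=> w wz; apply: difference_quotient_ccvg.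
  by apply: hf; apply: rU; move: wz; rewrite /cball/=; lra.
have d1 : 0 < (r / 4) / (rnorm v + 1) by rewrite divr_gt0// ltr_wpDl// rnorm_ge0.
near=> m => w wz.
have m0 : 0 < (m.+1%:R : R) by rewrite ltr0n.
have md : m.+1%:R^-1 < (r / 4) / (rnorm v + 1) by near: m; exact: natSinv_cvg.
have rE : rnorm ((m.+1%:R^-1 : R)%:C *: v) = m.+1%:R^-1 * rnorm v.
  by rewrite rnormZ normcR ger0_norm// invr_ge0 ltW.
have rs : rnorm ((m.+1%:R^-1 : R)%:C *: v) < r / 4.
  rewrite rE; apply: le_lt_trans (_ : m.+1%:R^-1 * (rnorm v + 1) < _).
    by rewrite ler_wpM2l ?invr_ge0 ?(ltW m0)// lerDl.
  by rewrite -ltr_pdivlMr// ltr_wpDl// rnorm_ge0.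
have wv : cball z (r / 2) (w + (m.+1%:R^-1 : R)%:C *: v).
  by apply: (@cball_sub _ _ z w (r / 2) (r / 4)); [move: wz; rewrite /cball/=; lra|exact: cballD].
split.
  have dw : differentiable f w by exact: (hb w (cball_le r4r wz)).1.
  have dwv : differentiable f (w + (m.+1%:R^-1 : R)%:C *: v).
    exact: (hb _ (cball_le r2r wv)).1.
  apply: (@differentiable_mul _ _ (fun=> m.+1%:R)); first exact: differentiable_cst.
  apply: differentiable_sub; last exact: dw.
  exact: (differentiable_translate dwv).1.
rewrite /q Normc.normcM.
have -> : (m.+1%:R : R[i]) = (m.+1%:R : R)%:C by rewrite rmorph_nat.
rewrite normcR ger0_norm ?(ltW m0)// -ler_pdivlMl//.
apply: le_trans (holo_lipschitz r0 hb (sub4 _ wz) wv) _.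
rewrite [X in rnorm X](_ : _ = (m.+1%:R^-1)%:C *: v); last by rewrite addrC addKr.
rewrite rE le_eqVlt; apply/orP; left; apply/eqP; ring.
Unshelve. all: by end_near. Qed.

End locally_bounded_families.

(** * Lebesgue measure as a product of planes *)

Section tuple_measure_uniqueness.
Context d (T : measurableType d) (R : realType).
Variable mu : {sigma_finite_measure set T -> \bar R}.

Definition tuple_boxes n : set (set (n.-tuple T)) :=
  [set X | exists2 A : 'I_n -> set T, (forall k, measurable (A k)) & X = tuple_box A].

Lemma measurable_tuple_boxes n :
  @measurable _ (n.-tuple T) = <<s @tuple_boxes n >>.
Proof.
apply/seteqP; split.
  apply: smallest_sub; first exact: smallest_sigma_algebra.
  elim/big_rec : _ => [//|k X _ IH] Y [|]; last exact: IH.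
  move=> [B mB <-]; apply: sub_sigma_algebra.
  exists (fun j => if j == k then B else setT).
    by move=> j; case: ifP.
  apply/seteqP; split => t; rewrite /tuple_box /=.
    by move=> [_ h] j; case: eqVneq => [->|].
  by move=> h; split => //; have := h k; rewrite eqxx.
apply: smallest_sub; first exact: sigma_algebra_measurable.
by move=> _ [A mA ->]; exact: measurable_tuple_box.
Qed.

(** Boxes form a pi-system that generates the product sigma-algebra. *)
Lemma tuple_measure_unique n (m : {measure set (n.-tuple T) -> \bar R}) :
  (forall A : 'I_n -> set T, (forall k, measurable (A k)) ->
     m (tuple_box A) = (\prod_(k < n) mu (A k))%E) ->
  forall X, measurable X -> m X = tuple_measure mu n X.
Proof.
move=> mE; have /sigma_finiteP[F [TF ndF Foo]] := sigma_finiteT mu.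
apply: (measure_unique (@tuple_boxes n) (fun i => tuple_box (fun _ : 'I_n => F i))).
- exact: measurable_tuple_boxes.
- move=> _ _ [A mA ->] [B mB ->]; exists (fun k => A k `&` B k).
    by move=> k; exact: measurableI.
  by apply/seteqP; split => t /= => [[h1 h2] k|h]; [split|split => k; case: (h k)].
- by move=> i; exists (fun=> F i) => // _; case: (Foo i).
- apply/seteqP; split => // t _.
  have /choice[i hi] : forall k : 'I_n, exists i, F i (tnth t k).
    move=> k; have [i _ Fi] : (\bigcup_i F i) (tnth t k) by rewrite -TF.
    by exists i.
  exists (\max_k i k)%N => // k; move: (tnth t k) (hi k).
  by apply/subsetPset/ndF; exact: leq_bigmax.
- move=> _ [A mA ->]; rewrite (mE A mA); exact/esym/tuple_measure_box.
- move=> k; rewrite mE; last by case: (Foo k).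
  suff : (0 <= \prod_(j < n) mu (F k) < +oo)%E by case/andP.
  elim/big_ind : _ => [|x y /andP[x0 xoo] /andP[y0 yoo]|i _].
  - by rewrite lee_fin ler01 ltry.
  - by rewrite mule_ge0//= lte_mul_pinfty// ge0_fin_numE.
  - by rewrite measure_ge0/=; case: (Foo k).
Qed.

End tuple_measure_uniqueness.

Section sigma_finite_product.
Context d1 d2 (T1 : measurableType d1) (T2 : measurableType d2) (R : realType).
Variable m1 : {sigma_finite_measure set T1 -> \bar R}.
Variable m2 : {sigma_finite_measure set T2 -> \bar R}.

(** A new name for the product measure, to which the structure of sigma-finite
    measure can be attached; iterating the product requires that structure. *)
Definition sf_product : set (T1 * T2) -> \bar R := (m1 \x m2)%E.

HB.instance Definition _ := Measure.on sf_product.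

Let sf_product_sigma_finite : sigma_finite setT sf_product.
Proof.
have /sigma_finiteP[F [TF ndF Foo]] := sigma_finiteT m1.
have /sigma_finiteP[G [TG ndG Goo]] := sigma_finiteT m2.
exists (fun k => F k `*` G k).
  apply/seteqP; split => // -[x y] _.
  have [i _ Fix] : (\bigcup_i F i) x by rewrite -TF.
  have [j _ Gjy] : (\bigcup_i G i) y by rewrite -TG.
  exists (maxn i j) => //; split => /=.
  - by move: x Fix; exact/subsetPset/ndF/leq_maxl.
  - by move: y Gjy; exact/subsetPset/ndG/leq_maxr.
move=> k; have [mF Fk] := Foo k; have [mG Gk] := Goo k; split.
  exact: measurableX.
by rewrite /sf_product product_measure1E// lte_mul_pinfty// ge0_fin_numE.
Qed.

HB.instance Definition _ := Measure_isSigmaFinite.Build _ _ _ sf_product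
  sf_product_sigma_finite.

End sigma_finite_product.

Section plane.
Variable R : realType.
Local Notation mu := (@lebesgue_measure R).
Local Notation T1 := (measurableTypeR R).
Local Notation T2 := (T1 * T1)%type.

Definition plane_measure : {sigma_finite_measure set T2 -> \bar R} := sf_product mu mu.

Definition Cn_of_pairs n (s : n.-tuple T2) : borel_Cn R n :=
  (\row_k ((tnth s k).1 +i* (tnth s k).2) : 'rV[R[i]]_n).

Definition unpair n (s : n.-tuple T2) : (n + n).-tuple T1 :=
  [tuple match fintype.split k with inl l => (tnth s l).1 | inr l => (tnth s l).2 end
  | k < n + n].

Lemma measurable_unpair n : measurable_fun setT (@unpair n).
Proof.
apply/measurable_fun_tnthP => k.
rewrite (_ : _ \o _ = (fun s : n.-tuple T2 =>
    match fintype.split k with inl l => (tnth s l).1 | inr l => (tnth s l).2 end)); last first.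
  by apply/funext => s; rewrite /= tnth_mktuple.
by case: (fintype.split k) => l; [apply: measurableT_comp (@measurable_fst _ _ T1 T1) _
  |apply: measurableT_comp (@measurable_snd _ _ T1 T1) _]; exact: measurable_tnth.
Qed.

Lemma Cn_of_pairsE n : @Cn_of_pairs n = @Cn_of_tuple R n \o @unpair n.
Proof.
apply/funext => s; apply/rowP => k; rewrite !mxE !tnth_mktuple.
by rewrite (unsplitK (inl _)) (unsplitK (inr _)).
Qed.

Lemma measurable_Cn_of_pairs n : measurable_fun setT (@Cn_of_pairs n).
Proof.
rewrite Cn_of_pairsE; apply: measurableT_comp; first exact: measurable_Cn_of_tuple.
exact: measurable_unpair.
Qed.

(** Listing real parts before imaginary parts or pairing them coordinatewise gives the
    same measure on boxes. The pairs are what makes induction on the number of complex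
    coordinates possible. *)
Lemma lebesgue_Cn_pairs n (X : set (borel_Cn R n)) : measurable X ->
  lebesgue_Cn X = pushforward (tuple_measure plane_measure n) (@Cn_of_pairs n) X.
Proof.
move=> mX; rewrite /lebesgue_Cn /pushforward Cn_of_pairsE comp_preimage.
have mY : measurable (@Cn_of_tuple R n @^-1` X).
  by rewrite -[Y in measurable Y]setTI; exact: measurable_Cn_of_tuple.
pose m := measure_function_pushforward__canonical__measure_function_Measure
  (tuple_measure plane_measure n) (@measurable_unpair n).
rewrite -[RHS]/(m (@Cn_of_tuple R n @^-1` X)).
apply/esym; apply: (tuple_measure_unique (m := m)) => // A mA.
rewrite /m /= /pushforward.
rewrite (_ : _ @^-1` _ = tuple_box (fun k => A (lshift n k) `*` A (rshift n k))); last first.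
  apply/seteqP; split => s /=.
    move=> h k; split; have := h (lshift n k); have := h (rshift n k); rewrite !tnth_mktuple.
      by rewrite (unsplitK (inl _)).
    by rewrite (unsplitK (inr _)).
  move=> h k; rewrite tnth_mktuple; case: splitP => l kl.
    by have [+ _] := h l; rewrite (_ : lshift n l = k)//; apply: val_inj.
  by have [_ +] := h l; rewrite (_ : rshift n l = k)//; apply: val_inj.
rewrite tuple_measure_box; last by move=> k; exact: measurableX.
rewrite big_split_ord/= -big_split/=; apply: eq_bigr => k _.
by rewrite [LHS]product_measure1E.
Qed.

Lemma integral_lebesgue_Cn n (f : borel_Cn R n -> \bar R) :
  measurable_fun setT f -> (forall z, (0 <= f z)%E) ->
  (\int[@lebesgue_Cn R n]_z f z =
   \int[tuple_measure plane_measure n]_s f (Cn_of_pairs s))%E.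
Proof.
move=> mf f0.
pose m := measure_function_pushforward__canonical__measure_function_Measure
  (tuple_measure plane_measure n) (@measurable_Cn_of_pairs n).
rewrite (@eq_measure_integral _ _ _ _ m); last first.
  by move=> A mA _; exact: lebesgue_Cn_pairs.
rewrite /m ge0_integral_pushforward//; last exact: measurable_Cn_of_pairs.
Qed.

Lemma integral_lebesgue_Cn_tuple n (f : borel_Cn R n -> \bar R) :
  measurable_fun setT f -> (forall z, (0 <= f z)%E) ->
  (\int[@lebesgue_Cn R n]_z f z =
   \int[tuple_measure mu (n + n)]_s f (Cn_of_tuple s))%E.
Proof.
move=> mf f0; rewrite /lebesgue_Cn ge0_integral_pushforward//.
exact: measurable_Cn_of_tuple.
Qed.

End plane.

(** * Affine changes of variable and the sub-mean value property *)

Section affine_change.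
Variable R : realType.
Local Notation mu := (@lebesgue_measure R).
Local Notation T1 := (measurableTypeR R).

Lemma integral_cst_segment (a b : R) (r : \bar R) : a <= b ->
  (\int[mu]_(x in `[a, b]) cst r x = r * (b - a)%:E)%E.
Proof.
move=> ab; rewrite integral_cst//; congr (_ * _)%E.
have E : mu `[a, b] = (b - a)%:E.
  rewrite lebesgue_measure_itv/= lte_fin; case: ltP => // ba.
  by rewrite (@le_anti _ _ a b) ?subrr// ab ba.
exact: E.
Qed.

Lemma measurable_affine (c s : R) : measurable_fun setT (fun x : T1 => c + s * x : T1).
Proof. by apply: measurable_funD => //; exact: measurable_funM. Qed.

Lemma lebesgue_measure_affine (c s : R) (A : set T1) : s != 0 -> measurable A ->
  mu ((fun x => c + s * x) @^-1` A) = ((`|s|^-1)%:E * mu A)%E.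
Proof.
move=> s0 mA; have s0' : 0 < `|s| by rewrite normr_gt0.
pose m := measure_function_pushforward__canonical__measure_function_Measure
  mu (@measurable_affine c s).
pose ms := mscale (NngNum (ltW s0')) m.
have H : mu A = ms A.
  apply: (@lebesgue_measure_unique R ms) => // X /ocitvP[->|[[a b] /= ab ->]].
    by rewrite !measure0.
  rewrite lebesgue_measure_itv/= lte_fin ab -EFinD /ms /mscale /= /m /pushforward /=.
  have [sp|sn|se] := ltgtP s 0.
  - rewrite (_ : _ @^-1` _ = `[(b - c) / s, (a - c) / s[%classic); last first.
      apply/seteqP; split => x /=; rewrite !in_itv/= => /andP[h1 h2]; apply/andP; split.
      + by rewrite ler_ndivrMr// mulrC; lra.
      + by rewrite ltr_ndivlMr// mulrC; lra.
      + by move: h2; rewrite ltr_ndivlMr// mulrC; lra.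
      + by move: h1; rewrite ler_ndivrMr// mulrC; lra.
    rewrite lebesgue_measure_itv/= lte_fin ltr_nM2r ?invr_lt0// ltrD2r ab -EFinD -EFinM.
    by congr EFin; rewrite ltr0_norm//; field.
  - rewrite (_ : _ @^-1` _ = `](a - c) / s, (b - c) / s]%classic); last first.
      apply/seteqP; split => x /=; rewrite !in_itv/= => /andP[h1 h2]; apply/andP; split.
      + by rewrite ltr_pdivrMr// mulrC; lra.
      + by rewrite ler_pdivlMr// mulrC; lra.
      + by move: h1; rewrite ltr_pdivrMr// mulrC; lra.
      + by move: h2; rewrite ler_pdivlMr// mulrC; lra.
    rewrite lebesgue_measure_itv/= lte_fin ltr_pM2r ?invr_gt0// ltrD2r ab -EFinD -EFinM.
    by congr EFin; rewrite gtr0_norm//; field; rewrite gt_eqF.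
  - by rewrite se eqxx in s0.
by rewrite [mu A in RHS]H /ms /mscale /= muleA -EFinM mulVf ?gt_eqF// mul1e.
Qed.

Lemma integral_affine (c s : R) (h : T1 -> \bar R) : s != 0 ->
  measurable_fun setT h -> (forall x, (0 <= h x)%E) ->
  (\int[mu]_x h (c + s * x)%R = (`|s|^-1)%:E * \int[mu]_x h x)%E.
Proof.
move=> s0 mh h0; have s0' : 0 <= `|s|^-1 by rewrite invr_ge0.
pose m := measure_function_pushforward__canonical__measure_function_Measure
  mu (@measurable_affine c s).
have -> : (\int[mu]_x h (c + s * x)%R = \int[m]_x h x)%E.
  rewrite /m ge0_integral_pushforward//; exact: measurable_affine.
pose k := NngNum s0'.
rewrite -[(`|s|^-1)%R]/(k%:num) -ge0_integral_mscale//.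
apply: eq_measure_integral => A mA _; rewrite /mscale /=.
exact: lebesgue_measure_affine.
Qed.

Lemma integral_translate (c : R) (h : T1 -> \bar R) :
  measurable_fun setT h -> (forall x, (0 <= h x)%E) ->
  (\int[mu]_x h (c + x)%R = \int[mu]_x h x)%E.
Proof.
move=> mh h0; rewrite -[RHS]mul1e.
have := @integral_affine c 1 h (oner_neq0 _) mh h0; rewrite normr1 invr1 => <-.
by apply: eq_integral => x _; rewrite mul1r.
Qed.

Lemma integral_reflect (c : R) (h : T1 -> \bar R) :
  measurable_fun setT h -> (forall x, (0 <= h x)%E) ->
  (\int[mu]_x h (c - x)%R = \int[mu]_x h x)%E.
Proof.
move=> mh h0; rewrite -[RHS]mul1e.
have n1 : (-1 : R) != 0 by rewrite oppr_eq0 oner_eq0.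
have := @integral_affine c (-1) h n1 mh h0; rewrite normrN1 invr1 => <-.
by apply: eq_integral => x _; rewrite mulN1r.
Qed.

End affine_change.

Section submean.
Variable R : realType.
Local Notation mu := (@lebesgue_measure R).
Local Notation T1 := (measurableTypeR R).
Local Notation T2 := (T1 * T1)%type.

Definition square (c : T2) (rho : R) : set T2 :=
  `[c.1 - rho, c.1 + rho]%classic `*` `[c.2 - rho, c.2 + rho]%classic.

Lemma measurable_square c rho : measurable (square c rho).
Proof. by apply: measurableX; exact: measurable_itv. Qed.

(** Averaging Cauchy's formula over the half-side of the square turns the
    integrals over the sides into an area integral. *)
Lemma submean_square (f : R[i] -> R[i]) (u : T2 -> \bar R) (c : T2) (rho : R) :
  0 < rho -> measurable_fun setT u -> (forall z, (0 <= u z)%E) ->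
  (forall z, in_square rho z -> differentiable f z /\
     u (c.1 + complex.Re z, c.2 + complex.Im z) = (normc (f z))%:E) ->
  ((rho ^+ 2 * normc (f 0))%:E <= 4%:E * \int[@plane_measure R]_(z in square c rho) u z)%E.
Proof.
move=> rho0 mu_ u0 hf.
pose U := u \_ (square c rho).
have mU : measurable_fun setT U.
  have h := @measurable_restrictT _ _ _ _ (square c rho) u (measurable_square c rho).
  by apply/h; exact: measurable_funTS.
have U0 z : (0 <= U z)%E by rewrite /U patchE; case: ifP.
have UE x y : - rho <= x <= rho -> - rho <= y <= rho ->
    U (c.1 + x, c.2 + y) = (normc (f (x +i* y)))%:E.
  move=> hx hy; rewrite /U patchE mem_set.
    by have [_ <-] := hf (x +i* y) ltac:(by apply/andP).
  by split; rewrite /= in_itv/=; lra.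
rewrite integral_mkcond -/U.
pose V := fubini_F mu U; pose H := fubini_G mu U.
have V0 x : (0 <= V x)%E by exact: integral_ge0.
have H0 y : (0 <= H y)%E by exact: integral_ge0.
have mV : measurable_fun setT V by exact: measurable_fun_fubini_tonelli_F.
have mH : measurable_fun setT H by exact: measurable_fun_fubini_tonelli_G.
have IV : (\int[@plane_measure R]_z U z = \int[mu]_x V x)%E by exact: fubini_tonelli1.
have IH : (\int[@plane_measure R]_z U z = \int[mu]_y H y)%E by exact: fubini_tonelli2.
have mUx x : measurable_fun setT (fun y => U (x, y)).
  by apply: measurableT_comp => //; exact: pair1_measurable.
have mUy y : measurable_fun setT (fun x => U (x, y)).
  by apply: measurableT_comp => //; exact: pair2_measurable.
have side (p : R -> R[i]) (h : T1 -> \bar R) (a S : R) : 0 < S <= rho ->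
    (forall t, - S <= t <= S -> h (a + t) = (normc (f (p t)))%:E) ->
    (forall t, (0 <= h t)%E) -> measurable_fun setT h ->
    cintegrable (- S) S (fun t => f (p t)) ->
    ((\int[mu]_(t in `[(- S)%R, S]) normc (f (p t)))%R%:E <= \int[mu]_t h t)%E.
  move=> S0 hE h0 mh ip; have /integrable_fin_num := cintegrable_normc ip.
  rewrite /Rintegral => /(_ (measurable_itv _)) /fineK ->.
  rewrite -(integral_translate a mh h0).
  have mh' : measurable_fun setT (fun x => h (a + x)).
    by apply: measurableT_comp => //; exact: measurable_funD.
  apply: (@le_trans _ _ (\int[mu]_(t in `[(- S)%R, S]) h (a + t)%R)%E).
    rewrite le_eqVlt; apply/orP; left; apply/eqP; apply: eq_integral => t.
    by rewrite inE/= in_itv/= => /hE ->.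
  by apply: ge0_subset_integral => //=.
have key S : 0 < S <= rho ->
    ((4 * S * normc (f 0))%:E <=
     H (c.2 - S)%R + H (c.2 + S)%R + V (c.1 - S)%R + V (c.1 + S)%R)%E.
  move=> Sr; have [S0 Srho] := andP Sr.
  have bS t : - S <= t <= S -> - rho <= t <= rho.
    by move=> /andP[h1 h2]; rewrite (le_trans _ h1) ?lerN2// (le_trans h2).
  have bl : - rho <= - S <= rho by apply: bS; rewrite lexx ge0_cp// ltW.
  have br : - rho <= S <= rho by apply: bS; rewrite lexx andbT ge0_cp// ltW.
  have dS z : in_square S z -> differentiable f z.
    by move=> zS; have [] := hf z (in_square_le Srho zS).
  have sf : sides (- S) S (- S) S f.
    have SS : - S <= S by rewrite ge0_cp// ltW.
    by apply: (sides_differentiable SS SS) => t tt;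
      have [[? ? ? ?] _] := side_square S0 tt; split; exact: dS.
  have [f1 f2 f3 f4] := sf.
  have := cauchy_center S0 dS; rewrite -lee_fin !EFinD => h; apply: le_trans h _.
  apply: leeD; [apply: leeD; [apply: leeD|]|].
  - apply: (side (fun t => t +i* - S) (fun x => U (x, c.2 - S)) c.1) => //.
    by move=> t /bS tt; apply: UE.
  - apply: (side (fun t => t +i* S) (fun x => U (x, c.2 + S)) c.1) => //.
    by move=> t /bS tt; apply: UE.
  - apply: (side (fun t => - S +i* t) (fun y => U (c.1 - S, y)) c.2) => //.
    by move=> t /bS tt; apply: UE.
  - apply: (side (fun t => S +i* t) (fun y => U (c.1 + S, y)) c.2) => //.
    by move=> t /bS tt; apply: UE.
pose W S := (H (c.2 - S)%R + H (c.2 + S)%R + V (c.1 - S)%R + V (c.1 + S)%R)%E.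
have mr (h : T1 -> \bar R) (a : R) : measurable_fun setT h -> measurable_fun setT (fun x : T1 => h (a - x)).
  by move=> mh; apply: measurableT_comp => //; exact: measurable_funB.
have mt (h : T1 -> \bar R) (a : R) : measurable_fun setT h -> measurable_fun setT (fun x : T1 => h (a + x)).
  by move=> mh; apply: measurableT_comp => //; exact: measurable_funD.
have W0 S : (0 <= W S)%E by rewrite /W; do !apply: adde_ge0 => //.
have mW : measurable_fun setT W.
  apply: emeasurable_funD; last exact: mt.
  apply: emeasurable_funD; last exact: mr.
  by apply: emeasurable_funD; [exact: mr|exact: mt].
have IW : (\int[mu]_S W S = 4%:E * \int[@plane_measure R]_z U z)%E.
  have D (A B : T1 -> \bar R) : (forall x, 0 <= A x)%E -> (forall x, 0 <= B x)%E ->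
      measurable_fun setT A -> measurable_fun setT B ->
      (\int[mu]_x (A x + B x) = \int[mu]_x A x + \int[mu]_x B x)%E.
    by move=> A0 B0 mA mB; exact: ge0_integralD.
  have m1 := mr _ c.2 mH; have m2 := mt _ c.2 mH.
  have m3 := mr _ c.1 mV; have m4 := mt _ c.1 mV.
  have m12 := emeasurable_funD m1 m2; have m123 := emeasurable_funD m12 m3.
  have p12 x : (0 <= H (c.2 - x)%R + H (c.2 + x)%R)%E by exact: adde_ge0.
  have p123 x : (0 <= H (c.2 - x)%R + H (c.2 + x)%R + V (c.1 - x)%R)%E by exact: adde_ge0.
  rewrite /W (D _ _ p123 (fun x => V0 _) m123 m4) (D _ _ p12 (fun x => V0 _) m12 m3).
  rewrite (D _ _ (fun x => H0 _) (fun x => H0 _) m1 m2).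
  rewrite !integral_reflect// !integral_translate// -IH -IV.
  set I := (\int[_]_z _)%E.
  have -> : (4%:E = 1 + 1 + 1 + 1 :> \bar R)%E by rewrite -!EFinD; congr EFin; ring.
  rewrite !ge0_muleDl ?mul1e//; do !apply: adde_ge0 => //.
rewrite -IW.
apply: (@le_trans _ _ (\int[mu]_(S in `[(rho / 2)%R, rho]) (cst (2 * rho * normc (f 0))%:E) S)%E).
  rewrite integral_cst_segment; last by lra.
  rewrite -EFinM lee_fin; have := normc_ge0 (f 0); nra.
apply: (@le_trans _ _ (\int[mu]_(S in `[(rho / 2)%R, rho]) W S)%E).
  apply: ge0_le_integral => //=.
  - by move=> S _; rewrite lee_fin !mulr_ge0 ?normc_ge0// ltW.
  - exact: measurable_funTS.
  - move=> S; rewrite in_itv/= => /andP[S1 S2]; apply: le_trans (key S _); last by lra.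
    rewrite lee_fin ler_wpM2r ?normc_ge0//; lra.
by apply: ge0_subset_integral => //=.
Qed.

End submean.

(** * Bounds of values by integrals, and dilations *)

Section iterated_submean.
Context d (T : measurableType d) (R : realType).
Variable mu : {sigma_finite_measure set T -> \bar R}.

Definition tuple_set n (x : n.-tuple T) (k : 'I_n) (y : T) : n.-tuple T :=
  [tuple if j == k then y else tnth x j | j < n].

Lemma tuple_set_cons0 n (a0 : T) (a : n.-tuple T) y :
  tuple_set (tuple_cons (a0, a)) ord0 y = tuple_cons (y, a).
Proof.
apply: eq_from_tnth => j; rewrite tnth_mktuple.
by have [->|i] := eqVneq j ord0; last case: (unliftP ord0 j) i => [l ->|->//] _; rewrite /tuple_cons/= ?tnthS.
Qed.

Lemma tuple_set_consS n (a0 : T) (a : n.-tuple T) k y :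
  tuple_set (tuple_cons (a0, a)) (lift ord0 k) y = tuple_cons (a0, tuple_set a k y).
Proof.
apply: eq_from_tnth => j; rewrite tnth_mktuple.
case: (unliftP ord0 j) => [l ->|->].
  by rewrite (inj_eq (@lift_inj _ _)) /tuple_cons /= !tnthS tnth_mktuple.
by [].
Qed.

Lemma measurable_tuple_cons1 n (a : n.-tuple T) :
  measurable_fun setT (fun y => tuple_cons (y, a)).
Proof. by apply: (measurableT_comp (@measurable_tuple_cons _ T n)); exact: pair2_measurable. Qed.

Lemma measurable_tuple_cons2 n (y : T) :
  measurable_fun setT (fun a : n.-tuple T => tuple_cons (y, a)).
Proof. by apply: (measurableT_comp (@measurable_tuple_cons _ T n)); exact: pair1_measurable. Qed.

Lemma integral_tuple_measureS n (u : n.+1.-tuple T -> \bar R) :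
  measurable_fun setT u -> (forall t, (0 <= u t)%E) ->
  (\int[tuple_measure mu n.+1]_t u t =
   \int[mu]_y \int[tuple_measure mu n]_t u (tuple_cons (y, t)))%E.
Proof.
move=> mu_ u0; rewrite /= /tuple_measureS.
rewrite ge0_integral_pushforward//; last exact: measurable_tuple_cons.
have mF : measurable_fun setT (u \o @tuple_cons _ T n).
  by apply: measurableT_comp => //; exact: measurable_tuple_cons.
by rewrite [LHS](@fubini_tonelli1 _ _ _ _ R mu (tuple_measure mu n) _ mF)// => x; exact: u0.
Qed.

(** By induction: the bound in the first coordinate is applied to u, and the bounds in
    the other coordinates under the integral in the first one. *)
Lemma iterated_submean n (u : n.-tuple T -> \bar R) (c : R) (a : n.-tuple T)
    (Q : 'I_n -> set T) :
  0 <= c -> measurable_fun setT u -> (forall t, (0 <= u t)%E) ->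
  (forall k, measurable (Q k)) -> (forall k, Q k (tnth a k)) ->
  (forall k x, (forall j, Q j (tnth x j)) -> tnth x k = tnth a k ->
    (u x <= c%:E * \int[mu]_(y in Q k) u (tuple_set x k y))%E) ->
  (u a <= (c ^+ n)%:E * \int[tuple_measure mu n]_t u t)%E.
Proof.
move=> c0; elim: n u a Q => [|n IH] u a Q mu_ u0 mQ aQ H.
  rewrite expr0 mul1e /= integral_dirac// diracE mem_set// mul1e.
  by rewrite (tuple0 a).
pose a0 := thead a; pose a' : n.-tuple T := [tuple of behead a].
have aE : a = tuple_cons (a0, a') by rewrite -(tuple_unconsK a).
have mS y : measurable_fun setT (fun t : n.-tuple T => u (tuple_cons (y, t))).
  by apply: measurableT_comp => //; exact: measurable_tuple_cons2.
have mF : measurable_fun setT (u \o @tuple_cons _ T n).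
  by apply: measurableT_comp => //; exact: measurable_tuple_cons.
pose I y := (\int[tuple_measure mu n]_t u (tuple_cons (y, t)))%E.
have mI : measurable_fun setT I.
  exact: (@measurable_fun_fubini_tonelli_F _ _ _ _ R (tuple_measure mu n) (u \o @tuple_cons _ T n) mF (fun x => u0 _)).
have I0 y : (0 <= I y)%E by exact: integral_ge0.
have cn0 : 0 <= c ^+ n by exact: exprn_ge0.
have step y : Q ord0 y -> (u (tuple_cons (y, a')) <= (c ^+ n)%:E * I y)%E.
  move=> Qy; apply: (IH _ _ (fun k => Q (lift ord0 k))) => //.
    by move=> k; have := aQ (lift ord0 k); rewrite {1}aE /tuple_cons /= tnthS.
  move=> k x xQ xa; have := H (lift ord0 k) (tuple_cons (y, x)).
  under eq_integral do rewrite tuple_set_consS.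
  apply.
    move=> j; case: (unliftP ord0 j) => [l ->|->]; last by [].
    by rewrite /tuple_cons /= tnthS.
  by rewrite [in RHS]aE /tuple_cons /= !tnthS.
rewrite integral_tuple_measureS//.
have := H ord0 a aQ erefl => h; apply: le_trans h _.
rewrite exprS EFinM -muleA; apply: lee_wpmul2l; first by rewrite lee_fin.
have mset : measurable_fun setT (fun y => u (tuple_set a ord0 y)).
  under eq_fun do rewrite {1}aE tuple_set_cons0.
  by apply: measurableT_comp => //; exact: measurable_tuple_cons1.
have mcI : measurable_fun setT (fun y => (c ^+ n)%:E * I y)%E.
  exact: measurable_funeM.
have cI0 y : (0 <= (c ^+ n)%:E * I y)%E by rewrite mule_ge0// lee_fin.
rewrite -ge0_integralZl_EFin//; last by move=> y _; exact: I0.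
apply: (@le_trans _ _ (\int[mu]_(y in Q ord0) ((c ^+ n)%:E * I y))%E); last first.
  by apply: ge0_subset_integral => //.
apply: ge0_le_integral => //.
- exact: measurable_funTS.
- exact: measurable_funTS.
- by move=> y Qy; rewrite {1}aE tuple_set_cons0; exact: step.
Qed.

End iterated_submean.

Section point_bound.
Variables (R : realType) (n : nat).
Local Notation Cn := 'rV[R[i]]_n.
Local Notation T1 := (measurableTypeR R).

Definition near_box (z : Cn) (rho : R) : set Cn := [set w | forall k,
  `|complex.Re (w 0 k) - complex.Re (z 0 k)| <= rho /\
  `|complex.Im (w 0 k) - complex.Im (z 0 k)| <= rho].

(** The sub-mean value property over a square, iterated over the coordinates. *)
Lemma point_bound (f : Cn -> R[i]) (z : Cn) (rho : R) : 0 < rho ->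
  measurable_fun setT (fun w : borel_Cn R n => normc (f w)) ->
  (forall w, near_box z rho w -> differentiable f w) ->
  ((normc (f z))%:E <= ((4 / rho ^+ 2) ^+ n)%:E *
     \int[@lebesgue_Cn R n]_w (normc (f w))%:E)%E.
Proof.
move=> rho0 mf df.
have mf' : measurable_fun setT (fun w : borel_Cn R n => (normc (f w))%:E).
  exact/measurable_EFinP.
have f0 w : (0 <= (normc (f w))%:E)%E by rewrite lee_fin normc_ge0.
rewrite integral_lebesgue_Cn//.
pose u (s : n.-tuple (T1 * T1)) := (normc (f (Cn_of_pairs s)))%:E.
pose a : n.-tuple (T1 * T1) := [tuple (complex.Re (z 0 k), complex.Im (z 0 k)) | k < n].
have za : z = Cn_of_pairs a.
  by apply/rowP => k; rewrite mxE tnth_mktuple/=; case: (z 0 k).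
have r2 : 0 < rho ^+ 2 by rewrite exprn_gt0.
rewrite {1}za -[X in (X <= _)%E]/(u a).
apply: (iterated_submean (Q := fun k => square (tnth a k) rho)).
- by rewrite divr_ge0// ltW.
- exact: (measurableT_comp mf' (@measurable_Cn_of_pairs R n)).
- by move=> t; exact: f0.
- by move=> k; exact: measurable_square.
- by move=> k; split; rewrite /= in_itv/=; lra.
move=> k x xQ xa.
pose z0 : Cn := Cn_of_pairs x.
pose g (w : R[i]) : R[i] := slice f z0 (delta_mx 0 k) w.
have mux : measurable_fun setT (fun y => u (tuple_set x k y)).
  apply: (@measurableT_comp _ _ _ _ _ _ u).
    exact: (measurableT_comp mf' (@measurable_Cn_of_pairs R n)).
  apply/measurable_fun_tnthP => j /=.
  rewrite (_ : _ \o _ = (fun y => if j == k then y else tnth x j)).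
    by case: (j == k); [exact: measurable_id|exact: measurable_cst].
  by apply/funext => y; rewrite /= tnth_mktuple.
have gE (w : R[i]) : Cn_of_pairs (tuple_set x k ((tnth a k).1 + complex.Re w,
    (tnth a k).2 + complex.Im w)) = z0 + w *: delta_mx 0 k.
  apply/rowP => j; rewrite !mxE !tnth_mktuple; have [->|jk] := eqVneq j k.
    have -> : tnth x k = (complex.Re (z 0 k), complex.Im (z 0 k)) by rewrite xa tnth_mktuple.
    by rewrite mulr1; case: w => w1 w2 /=; simpc.
  by rewrite mulr0 addr0; case: (tnth x j).
have := @submean_square R g (fun y => u (tuple_set x k y)) (tnth a k) rho rho0 mux
  (fun y => f0 _).
have -> : g 0 = f z0 by rewrite /g /slice scale0r addr0.
have hg w : in_square rho w -> differentiable g w /\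
     u (tuple_set x k ((tnth a k).1 + complex.Re w, (tnth a k).2 + complex.Im w)) = (normc (g w))%:E.
  move=> wS; split; last by rewrite /u gE.
  apply: (slice_differentiable _).1; apply: df; rewrite -gE => j.
  rewrite !mxE tnth_mktuple /=; have [->|jk] := eqVneq j k.
    move: wS; rewrite tnth_mktuple /= => /andP[h1 h2].
    by rewrite 2![_ + _ - _]addrAC !subrr !add0r; split; rewrite ler_norml; lra.
  have := xQ j; rewrite /square tnth_mktuple/= !in_itv/= => -[/andP[h1 h2] /andP[h3 h4]].
  by split; rewrite ler_norml; lra.
move=> /(_ hg) h.
rewrite -[X in (X <= _)%E]/((normc (f z0))%:E).
have c0 : 0 <= (rho ^+ 2)^-1 by rewrite invr_ge0 ltW.
have -> : (normc (f z0))%:E = ((rho ^+ 2)^-1%:E * (rho ^+ 2 * normc (f z0))%:E)%E.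
  by rewrite -EFinM mulKf// gt_eqF.
rewrite [X in (_ <= X%:E * _)%E]mulrC [X in (_ <= X * _)%E]EFinM -[leRHS]muleA.
apply: lee_wpmul2l; first by rewrite lee_fin.
exact: h.
Qed.

End point_bound.

Section dilation.
Variables (R : realType) (n : nat).
Local Notation Cn := 'rV[R[i]]_n.
Local Notation mu := (@lebesgue_measure R).
Local Notation T1 := (measurableTypeR R).
Local Notation Tn := ((n + n).-tuple T1).

Definition tuple_scale (r : R) (s : Tn) : Tn := [tuple (r * tnth s k : T1) | k < n + n].

Lemma measurable_tuple_scale r : measurable_fun setT (tuple_scale r).
Proof.
apply/measurable_fun_tnthP => k.
rewrite (_ : _ \o _ = (fun s : Tn => r * tnth s k : T1)); last first.
  by apply/funext => s; rewrite /= tnth_mktuple.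
by apply: measurable_funM => //; exact: measurable_tnth.
Qed.

Lemma Cn_of_tuple_scale r s :
  Cn_of_tuple (tuple_scale r s) = (r%:C *: Cn_of_tuple s : Cn).
Proof.
by apply/rowP => k; rewrite !mxE !tnth_mktuple; simpc.
Qed.

(** Both sides agree on boxes. *)
Lemma tuple_measure_scale r (X : set Tn) : 0 < r -> measurable X ->
  tuple_measure mu (n + n) X =
  ((r ^+ (n + n))%:E * tuple_measure mu (n + n) (tuple_scale r @^-1` X))%E.
Proof.
move=> r0 mX; pose m := measure_function_pushforward__canonical__measure_function_Measure
  (tuple_measure mu (n + n)) (@measurable_tuple_scale r).
have rn0 : 0 <= r ^+ (n + n) by rewrite exprn_ge0// ltW.
pose k := NngNum rn0.
have H : forall X, measurable X -> mscale k m X = tuple_measure mu (n + n) X.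
  apply: tuple_measure_unique => A mA.
  rewrite -[LHS]/((r ^+ (n+n))%:E * tuple_measure mu (n+n) (tuple_scale r @^-1` tuple_box A))%E.
  rewrite (_ : _ @^-1` _ = tuple_box (fun k => (fun x => 0 + r * x) @^-1` A k)); last first.
    by apply/seteqP; split => s h j; have := h j; rewrite /= tnth_mktuple/= add0r.
  rewrite tuple_measure_box; last first.
    by move=> j; rewrite -[Y in measurable Y]setTI; exact: measurable_affine.
  rewrite (eq_bigr (fun j => ((`|r|^-1)%:E * mu (A j))%E)); last first.
    by move=> j _; apply: lebesgue_measure_affine => //; rewrite gt_eqF.
  rewrite big_split/= muleA prodEFin prodr_const card_ord -EFinM.
  by rewrite gtr0_norm// exprVn mulfV ?mul1e// expf_neq0// gt_eqF.
by rewrite -H.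
Qed.

Lemma measurable_scale_Cn (r : R) :
  measurable_fun setT (fun z : borel_Cn R n => (r%:C *: (z : Cn)) : borel_Cn R n).
Proof.
apply: (@measurability _ _ _ (borel_Cn R n) _ _ (@open Cn)) => [//|_ [U oU <-]].
rewrite setTI; apply: sub_sigma_algebra.
apply: (@open_comp _ _ (fun z : Cn => r%:C *: z)) => // z _.
exact: (@scaler_continuous _ _ r%:C z).
Qed.

Lemma integral_scale r (h : borel_Cn R n -> \bar R) : 0 < r ->
  measurable_fun setT h -> (forall z, (0 <= h z)%E) ->
  (\int[@lebesgue_Cn R n]_z h z =
   (r ^+ (n + n))%:E * \int[@lebesgue_Cn R n]_z h (r%:C *: (z : Cn)))%E.
Proof.
move=> r0 mh h0.
have mc : measurable_fun setT (fun s : Tn => h (Cn_of_tuple s)).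
  by apply: measurableT_comp => //; exact: measurable_Cn_of_tuple.
have mk : measurable_fun setT (fun s : Tn => h (r%:C *: (Cn_of_tuple s : Cn))).
  under eq_fun do rewrite -Cn_of_tuple_scale.
  exact: (measurableT_comp mc (measurable_tuple_scale r)).
pose m := measure_function_pushforward__canonical__measure_function_Measure
  (tuple_measure mu (n + n)) (@measurable_tuple_scale r).
have rn0 : 0 <= r ^+ (n + n) by rewrite exprn_ge0// ltW.
pose k := NngNum rn0.
rewrite integral_lebesgue_Cn_tuple// (@eq_measure_integral _ _ _ _ (mscale k m)); last first.
  by move=> A mA _; exact: tuple_measure_scale.
rewrite ge0_integral_mscale//; congr (_ * _)%E.
rewrite /m ge0_integral_pushforward//; last exact: measurable_tuple_scale.
rewrite /lebesgue_Cn ge0_integral_pushforward//; [|exact: measurable_Cn_of_tuple|].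
  by rewrite !preimage_setT; apply: eq_integral => s _; rewrite /= Cn_of_tuple_scale.
exact: (measurableT_comp mh (measurable_scale_Cn r)).
Qed.
End dilation.

(** * The gauge of a convex domain *)

Section gauge.
Variables (R : realType) (n : nat) (Omega : set 'rV[R[i]]_n).
Local Notation Cn := 'rV[R[i]]_n.
Implicit Types (z w h : Cn) (s t : R).

Definition gauge_set z : set R := [set s | 0 < s /\ Omega (s^-1%:C *: z)].

(** The Minkowski functional of the domain. *)
Definition gauge z : R := inf (gauge_set z).

Hypothesis oO : open Omega.
Hypothesis cO : forall z w t, 0 <= t <= 1 -> Omega z -> Omega w ->
  Omega ((1 - t)%:C *: z + t%:C *: w).
Variables rho D : R.
Hypothesis rho0 : 0 < rho.
Hypothesis ballO : forall z, rnorm z < rho -> Omega z.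
Hypothesis bO : forall z, Omega z -> rnorm z <= D.

Lemma domain_bound_ge0 : 0 <= D.
Proof.
apply: le_trans (rnorm_ge0 (0 : Cn)) _; apply: bO; apply: ballO.
by rewrite rnorm0.
Qed.

Let gauge_set_big z s : rnorm z / rho < s -> gauge_set z s.
Proof.
move=> h; have s0 : 0 < s by apply: le_lt_trans h; rewrite divr_ge0 ?rnorm_ge0// ltW.
split=> //; apply: ballO; rewrite rnormZ normcR gtr0_norm ?invr_gt0//.
by rewrite mulrC ltr_pdivrMr// mulrC -ltr_pdivrMr.
Qed.

Let gauge_set_inf z : has_inf (gauge_set z).
Proof.
split; first by exists (rnorm z / rho + 1); apply: gauge_set_big; rewrite ltrDl.
by exists 0 => s [/ltW].
Qed.

Lemma gauge_ge0 z : 0 <= gauge z.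
Proof. by apply: lb_le_inf (gauge_set_inf z).1 _ => s [/ltW]. Qed.

Lemma gauge_le z s : 0 < s -> Omega (s^-1%:C *: z) -> gauge z <= s.
Proof. by move=> s0 Os; apply: ge_inf; [exact: (gauge_set_inf z).2|split]. Qed.

Lemma gauge_lt z s : gauge z < s -> Omega (s^-1%:C *: z).
Proof.
move=> zs; have s0 : 0 < s := le_lt_trans (gauge_ge0 z) zs.
have [s' [s'0 Os'] s's] := inf_lt (gauge_set_inf z).1 zs.
have O0 : Omega 0 by apply: ballO; rewrite rnorm0.
have -> : s^-1%:C *: z = (1 - s' / s)%:C *: 0 + (s' / s)%:C *: (s'^-1%:C *: z).
  rewrite scaler0 add0r scalerA -rmorphM/=; congr (_%:C *: _).
  by rewrite mulrAC divff ?mul1r// gt_eqF.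
apply: cO => //; rewrite divr_ge0 ?(ltW s0) ?(ltW s'0)//=.
by rewrite ler_pdivrMr// mul1r ltW.
Qed.

Lemma gaugeZ z t : 0 <= t -> gauge (t%:C *: z) = t * gauge z.
Proof.
have le t' z' : 0 < t' -> gauge (t'%:C *: z') <= t' * gauge z'.
  move=> t0; rewrite -ler_pdivrMl//; apply/ler_addgt0Pr => e e0.
  rewrite ler_pdivrMl//; apply: gauge_le.
    by rewrite mulr_gt0// ltr_wpDl ?gauge_ge0.
  rewrite scalerA -rmorphM/= invfM mulrAC mulVf ?gt_eqF// mul1r.
  by apply: gauge_lt; rewrite ltrDl.
rewrite le_eqVlt => /predU1P[<-|t0]; last first.
  apply/eqP; rewrite eq_le le//= -ler_pdivlMl//.
  have := le t^-1 (t%:C *: z); rewrite invr_gt0 => /(_ t0).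
  by rewrite scalerA -rmorphM/= mulVf ?gt_eqF// scale1r.
rewrite scale0r mul0r; apply/eqP; rewrite eq_le gauge_ge0 andbT.
apply/ler_addgt0Pr => e e0; rewrite add0r; apply: gauge_le => //.
by rewrite scaler0; apply: ballO; rewrite rnorm0.
Qed.

Lemma gaugeD z w : gauge (z + w) <= gauge z + gauge w.
Proof.
apply/ler_addgt0Pr => e e0.
pose a := gauge z + e / 2; pose b := gauge w + e / 2.
have a0 : 0 < a by rewrite ltr_wpDl ?gauge_ge0// divr_gt0.
have b0 : 0 < b by rewrite ltr_wpDl ?gauge_ge0// divr_gt0.
have ab0 : 0 < a + b by rewrite addr_gt0.
have -> : gauge z + gauge w + e = a + b by rewrite /a /b; lra.
apply: gauge_le => //.
have -> : (a + b)^-1%:C *: (z + w) =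
    (1 - b / (a + b))%:C *: (a^-1%:C *: z) + (b / (a + b))%:C *: (b^-1%:C *: w).
  have E1 : (a + b)^-1 = (1 - b / (a + b)) * a^-1 by field; rewrite !gt_eqF.
  have E2 : (a + b)^-1 = b / (a + b) * b^-1 by field; rewrite !gt_eqF.
  by rewrite scalerDr !scalerA -!rmorphM/= -E1 -E2.
apply: cO; last 2 first.
- by apply: gauge_lt; rewrite ltrDl divr_gt0.
- by apply: gauge_lt; rewrite ltrDl divr_gt0.
rewrite divr_ge0 ?(ltW ab0) ?(ltW b0)//=.
by rewrite ler_pdivrMr// mul1r lerDr ltW.
Qed.

Lemma gauge_le_rnorm z : gauge z <= rnorm z / rho.
Proof.
apply/ler_addgt0Pr => e e0.
have [s0 Os] : gauge_set z (rnorm z / rho + e) by apply: gauge_set_big; rewrite ltrDl.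
exact: gauge_le.
Qed.

Lemma domain_gauge z : Omega z <-> gauge z < 1.
Proof.
split; last by move=> /gauge_lt; rewrite invr1 scale1r.
move=> Oz; have /near_rnormP[d d0 hd] : \forall w \near z, Omega w by exact: open_nbhs_nbhs.
pose e := d / (rnorm z + 1) / 2.
have z1 : 0 < rnorm z + 1 by rewrite ltr_wpDl ?rnorm_ge0.
have e0 : 0 < e by rewrite !divr_gt0.
have Oe : Omega ((1 + e)%:C *: z).
  apply: hd; rewrite rmorphD/= rmorph1 scalerDl scale1r addrC addKr.
  rewrite rnormZ normcR gtr0_norm//.
  have : e * (rnorm z + 1) = d / 2 by rewrite /e; field; rewrite gt_eqF.
  have := rnorm_ge0 z; nra.
apply: (@le_lt_trans _ _ (1 + e)^-1).
  by apply: gauge_le; [rewrite invr_gt0; lra|rewrite invrK].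
by rewrite invf_lt1//; lra.
Qed.

(** A point of gauge s is at distance at least (1 - s) rho from the boundary. This is
    the radius on which Cauchy's estimate is used along a ray. *)
Lemma domain_ball z h : rnorm h < (1 - gauge z) * rho -> Omega (z + h).
Proof.
move=> hz; apply/domain_gauge; apply: le_lt_trans (gaugeD _ _) _.
have := gauge_le_rnorm h; have : rnorm h / rho < 1 - gauge z by rewrite ltr_pdivrMr.
lra.
Qed.

Lemma domain_scale z t : 0 <= t <= 1 -> Omega z -> Omega (t%:C *: z).
Proof.
move=> /andP[t0 t1] /domain_gauge z1; apply/domain_gauge; rewrite gaugeZ//.
have := gauge_ge0 z; nra.
Qed.

Lemma gauge_lipschitz z w : `|gauge z - gauge w| <= rnorm (z - w) / rho.
Proof.
have h1 := gaugeD (z - w) w; have h2 := gaugeD (w - z) z.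
have h3 := gauge_le_rnorm (z - w); have h4 := gauge_le_rnorm (w - z).
rewrite subrK in h1; rewrite subrK in h2; rewrite rnorm_distC in h4.
rewrite ler_norml lerNl opprB !lerBlDr; apply/andP; split.
  exact: le_trans h2 (lerD h4 (lexx _)).
exact: le_trans h1 (lerD h3 (lexx _)).
Qed.

Lemma open_gauge_gt s : open [set z | s < gauge z].
Proof.
rewrite openE => z /= zs; rewrite /interior.
apply/(near_rnormP (z : Cn) _).2; exists ((gauge z - s) * rho).
  by rewrite mulr_gt0// subr_gt0.
move=> w; rewrite -ltr_pdivrMr// => h; have := gauge_lipschitz w z.
by rewrite ler_norml => /andP[h' _] /=; lra.
Qed.

Lemma measurable_gauge : measurable_fun setT (gauge : borel_Cn R n -> measurableTypeR R).
Proof.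
apply: (measurability _ (RGenOInfty.measurableE R)).
move=> _ [_ [a ->] <-]; rewrite setTI.
apply: sub_sigma_algebra.
rewrite (_ : _ @^-1` _ = [set z | a < gauge z]); first exact: open_gauge_gt.
by apply/seteqP; split=> z /=; rewrite in_itv/= andbT.
Qed.

(** Hence dilations by factors less than 1 map the closure into the domain. *)
Lemma closure_domain_gauge z : closure Omega z -> gauge z <= 1.
Proof.
move=> cz; rewrite leNgt; apply/negP => z1.
have /cz[w [/domain_gauge w1 /=]] : nbhs z [set w | 1 < gauge w].
  by apply: open_nbhs_nbhs; split=> //; exact: open_gauge_gt.
by rewrite ltNge => /negP; apply; exact: ltW.
Qed.

End gauge.

(** * Weights on a segment *)

Lemma LnormE d (T : measurableType d) (R : realType) (mu : {measure set T -> \bar R})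
    (p : R) (f : T -> \bar R) :
  ('N[mu]_p%:E[f] = (\int[mu]_x (`|f x| `^ p)) `^ p^-1)%E.
Proof. by rewrite Lnorm.unlock. Qed.

Section one_variable_weights.
Variable R : realType.
Local Notation mu := (@lebesgue_measure R).
Local Notation T1 := (measurableTypeR R).

Lemma ftc_segment (f F : R -> R) (a b : R) : a <= b ->
  (forall x, a <= x <= b -> is_derive x 1 F (f x)) ->
  (forall x, a <= x <= b -> {for x, continuous f}) ->
  (\int[mu]_(x in `[a, b]) (f x)%:E = (F b - F a)%:E)%E.
Proof.
rewrite le_eqVlt => /predU1P[<- _ _|ab dF cf].
  by rewrite set_itv1 integral_set1 subrr.
have cF x : a <= x <= b -> {for x, continuous F}.
  move=> /dF dx; apply: differentiable_continuous; apply/derivable1_diffP.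
  exact: ex_derive.
rewrite EFinB; apply: continuous_FTC2 => //.
- apply: continuous_in_subspaceT => x; rewrite inE/= in_itv/=; exact: cf.
- split.
  + move=> x; rewrite in_itv/= => /andP[h1 h2]; have := dF x.
    by rewrite !ltW// => /(_ isT) ?; exact: ex_derive.
  + by apply: cvg_at_right_filter; apply: cF; rewrite lexx ltW.
  + by apply: cvg_at_left_filter; apply: cF; rewrite lexx ltW.
- move=> x; rewrite in_itv/= => /andP[h1 h2].
  by have := dF x; rewrite !ltW// => /(_ isT) ?; rewrite derive1E derive_val.
Qed.

Definition invsqrt (x : R) : R := (Num.sqrt x)^-1.

Lemma invsqrt_ge0 x : 0 <= invsqrt x.
Proof. by rewrite invr_ge0 sqrtr_ge0. Qed.

Lemma measurable_invsqrt : measurable_fun setT (invsqrt : T1 -> T1).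
Proof.
have -> : invsqrt = (fun x => Num.sqrt x `^ (-1)).
  by apply/funext => x; rewrite powR_inv1 ?sqrtr_ge0.
apply: (@measurableT_comp _ _ _ _ _ _ (@powR R ^~ (-1))); first exact: measurable_powR.
by apply: continuous_measurable_fun => x; exact: sqrt_continuous.
Qed.

Lemma invsqrt_npos x : x <= 0 -> invsqrt x = 0.
Proof. by move=> x0; rewrite /invsqrt ler0_sqrtr// invr0. Qed.

Lemma invsqrt_le x y : 0 < x -> x <= y -> invsqrt y <= invsqrt x.
Proof.
move=> x0 xy; have y0 := lt_le_trans x0 xy.
by rewrite lef_pV2 ?posrE ?sqrtr_gt0// ler_wsqrtr.
Qed.

Lemma invsqrt_sqrt x : 0 < x -> invsqrt x * Num.sqrt x = 1.
Proof. by move=> x0; rewrite mulVf// gt_eqF// sqrtr_gt0. Qed.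

Lemma invsqrt_powR x : 0 < x -> invsqrt x = x `^ (- 2^-1).
Proof. by move=> x0; rewrite powRN powR12_sqrt// ltW. Qed.

Let sqrt_primitive (D b : R) : 0 <= b -> b < D ->
  (\int[mu]_(s in `[0%R, b]) (invsqrt (D - s))%:E <= (2 * Num.sqrt D)%:E)%E.
Proof.
move=> b0 bD.
have d1 s : 0 <= s <= b ->
    is_derive s 1 (fun s : R => - 2 * Num.sqrt (D - s)) (invsqrt (D - s)).
  move=> /andP[s0 sb]; have Ds : 0 < D - s by lra.
  have h := is_derive1_sqrt Ds.
  have h2 : is_derive s 1 (fun s : R => D - s) (- 1).
    by apply: is_derive_eq (is_deriveB (is_derive_cst D s 1) (is_derive_id s 1)) _; rewrite sub0r.
  apply: is_derive_eq.
  rewrite /invsqrt -[_ *: _]/(_ * _); field; rewrite gt_eqF// sqrtr_gt0//.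
have c1 s : 0 <= s <= b -> {for s, continuous (fun s => invsqrt (D - s))}.
  move=> /andP[s0 sb]; have Ds : 0 < D - s by lra.
  apply: (@continuousV _ _ (fun s => Num.sqrt (D - s))).
    by rewrite gt_eqF// sqrtr_gt0.
  apply: (@continuous_comp _ _ _ (fun s => D - s) Num.sqrt); last exact: sqrt_continuous.
  by apply: continuousB; [exact: cst_continuous|exact: cvg_id].
rewrite (ftc_segment b0 d1 c1) lee_fin subr0; have := sqrtr_ge0 (D - b); lra.
Qed.

(** For D <= s the weight is zero, because [Num.sqrt] vanishes on nonpositive numbers
    and the inverse of 0 is 0; so D may lie inside the segment of integration, and
    the singularity at s = D is one-sided and integrable. *)
Lemma integral_invsqrt (D : R) :
  (\int[mu]_(s in `[0%R, (2^-1)%R]) (invsqrt (D - s))%:E <= (2 * Num.sqrt D)%:E)%E.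
Proof.
have mk : measurable_fun setT (fun s : T1 => (invsqrt (D - s))%:E).
  apply/measurable_EFinP; apply: measurableT_comp; first exact: measurable_invsqrt.
  exact: measurable_funB.
have k0 s : (0 <= (invsqrt (D - s))%:E)%E by rewrite lee_fin invsqrt_ge0.
have [D0|D0] := leP D 0.
  rewrite integral0_eq; first by rewrite lee_fin mulr_ge0// sqrtr_ge0.
  move=> s; rewrite /= in_itv/= => /andP[s0 _]; rewrite invsqrt_npos//; lra.
pose F (i : nat) : set T1 := `[0, D - D / i.+2%:R]%classic.
have Flt i : D - D / i.+2%:R < D by rewrite gtrBl divr_gt0.
have Fge i : 0 <= D - D / i.+2%:R.
  by rewrite subr_ge0 ler_pdivrMr// ler_peMr ?(ltW D0)// ler1n.
have ndF : nondecreasing_seq F.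
  move=> i j ij; apply/subsetPset => s; rewrite /F/= !in_itv/= => /andP[-> h]/=.
  apply: le_trans h _; rewrite lerD2l lerN2 ler_wpM2l ?(ltW D0)//.
  by rewrite lef_pV2 ?posrE ?ltr0n// ler_nat ltnS ltnS.
have UF : \bigcup_i F i = `[0, D[%classic.
  apply/seteqP; split => s.
    move=> [i _]; rewrite /F/= !in_itv/= => /andP[-> h]/=; exact: le_lt_trans h (Flt i).
  rewrite /= in_itv/= => /andP[s0 sD].
  have [i hi] : exists i : nat, D / i.+2%:R <= D - s.
    have Ds : 0 < D - s by lra.
    exists (Num.bound (D / (D - s))); rewrite ler_pdivrMr// mulrC -ler_pdivrMr//.
    have /archi_boundP : 0 <= D / (D - s) by rewrite divr_ge0 ?(ltW D0) ?(ltW Ds).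
    by move=> /ltW/le_trans; apply; rewrite ler_nat; lia.
  by exists i => //; rewrite /F/= in_itv/= s0/= lerBrDr addrC -lerBrDr.
have h1 : (\int[mu]_(s in `[0%R, D[) (invsqrt (D - s))%:E <= (2 * Num.sqrt D)%:E)%E.
  rewrite -UF.
  have cv := @ge0_nondecreasing_set_cvg_integral _ _ R F
     (fun s : T1 => (invsqrt (D - s))%:E) mu ndF (fun i => measurable_itv _)
     (fun i => measurable_funTS mk) (fun i x _ => k0 x).
  apply: (cvge_le _ cv).
  by apply: nearW => i; exact: sqrt_primitive.
apply: le_trans h1; rewrite [leLHS]integral_mkcond [leRHS]integral_mkcond.
apply: ge0_le_integral => //.
- by move=> s _; exact: erestrict_ge0.
- by apply/(measurable_restrictT _ (measurable_itv _)); exact: measurable_funTS.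
- by apply/(measurable_restrictT _ (measurable_itv _)); exact: measurable_funTS.
move=> s _; rewrite !patchE; case: ifPn => [|_]; last by case: ifP.
rewrite inE/= in_itv/= => /andP[s0 _]; case: ifPn => //.
rewrite notin_setE/= in_itv/= s0/= => /negP; rewrite -leNgt => Ds.
by rewrite invsqrt_npos// subr_le0.
Qed.

Lemma integral_weight (e D : R) : 0 < e -> 0 < D ->
  (\int[mu]_(s in `[0%R, (2^-1)%R]) ((s + D) `^ (- 1 - e))%:E <= (D `^ (- e) / e)%:E)%E.
Proof.
move=> e0 D0; have h0 : (0 : R) <= 2^-1 by lra.
have d1 (s : R) : 0 <= s <= 2^-1 ->
    is_derive s 1 (fun s : R => - e^-1 * (s + D) `^ (- e)) ((s + D) `^ (- 1 - e)).
  move=> /andP[s0 sb]; have Ds : 0 < s + D by lra.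
  have h := is_derive1_powR (- e) Ds.
  have h2 : is_derive s 1 (fun s : R => s + D) 1.
    by apply: is_derive_eq (is_deriveD (is_derive_id s 1) (is_derive_cst D s 1)) _; rewrite addr0.
  have h3 := is_deriveZ (- e^-1) 
    (@is_derive1_comp _ (fun x : R => x `^ (- e)) (fun s => s + D) _ _ _ h h2).
  apply: (@is_derive_eq _ _ _ (- e^-1 \*: ((fun x : R => x `^ (- e)) \o (fun s => s + D))) _ _ _ _ h3).
  rewrite [- 1 - e]addrC -[_ *: _]/(_ * _); field; rewrite gt_eqF//.
have c1 (s : R) : 0 <= s <= 2^-1 -> {for s, continuous (fun s => (s + D) `^ (- 1 - e))}.
  move=> /andP[s0 sb]; have Ds : 0 < s + D by lra.
  apply: (@continuous_comp _ _ _ (fun s => s + D) (fun x : R => x `^ (- 1 - e))).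
    by apply: continuousD; [exact: cvg_id|exact: cst_continuous].
  apply: differentiable_continuous; apply/derivable1_diffP.
  by have := is_derive1_powR (- 1 - e) Ds => ?; exact: ex_derive.
rewrite (ftc_segment h0 d1 c1) lee_fin add0r; have := powR_ge0 (2^-1 + D) (- e).
have e1 : 0 < e^-1 by rewrite invr_gt0.
nra.
Qed.

End one_variable_weights.

(** * Hardy inequality *)

Lemma le_integral_cstM d (X : measurableType d) (R : realType)
    (nu : {measure set X -> \bar R}) (U : set X) (c : R) (h J : X -> \bar R) :
  measurable U -> 0 <= c -> measurable_fun setT h -> measurable_fun setT J ->
  (forall x, (0 <= h x)%E) -> (forall x, (0 <= J x)%E) ->
  (forall x, U x -> (h x <= c%:E * J x)%E) ->
  (\int[nu]_(x in U) h x <= c%:E * \int[nu]_x J x)%E.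
Proof.
move=> mU c0 mh mJ h0 J0 hJ.
apply: (@le_trans _ _ (\int[nu]_(x in U) (c%:E * J x))%E).
  apply: ge0_le_integral => //; first exact: measurable_funTS.
  by apply: measurable_funTS; exact: measurable_funeM.
rewrite ge0_integralZl_EFin//; last exact: measurable_funTS.
by apply: lee_wpmul2l; [rewrite lee_fin|exact: ge0_subset_integral].
Qed.

Section hoelder_weight.
Variable R : realType.
Local Notation mu := (@lebesgue_measure R).
Local Notation T1 := (measurableTypeR R).
Local Notation A := (`[0%R, (2^-1)%R]%classic : set T1).

Lemma integral_if_segment (W V : T1 -> R) : (forall s, V s = if s \in A then W s else 0) ->
  (\int[mu]_s (V s)%:E = \int[mu]_(s in A) (W s)%:E)%E.
Proof.
move=> VW; rewrite [RHS]integral_mkcond; apply: eq_integral => s _.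
by rewrite patchE VW; case: ifP.
Qed.

(** Hoelder's inequality, the kernel being split so that one factor integrates to a
    power of D; the powers are chosen to leave inverse square roots. *)
Lemma hoelder_weight (p D : R) (u : T1 -> R) : 1 < p -> 0 < D ->
  measurable_fun setT u -> (forall s, 0 <= u s) ->
  ((\int[mu]_(s in A) (u s / (s + D))%:E) `^ p <=
   ((2 * (p - 1)) `^ (p - 1) * invsqrt D)%:E *
   \int[mu]_(s in A) (u s `^ p * invsqrt (s + D))%:E)%E.
Proof.
move=> p1 D0 mu_ u0; have p0 : 0 < p by lra.
have p10 : 0 < p - 1 by lra.
pose q := p / (p - 1); have q0 : 0 < q by rewrite divr_gt0.
have pq : p^-1 + q^-1 = 1 by rewrite /q; field; rewrite !gt_eqF.
pose a := (2 * p)^-1; pose e := (2 * (p - 1))^-1.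
have e0 : 0 < e by rewrite invr_gt0 mulr_gt0.
have mA : measurable A by exact: measurable_itv.
have mw (b : R) : measurable_fun setT (fun s : T1 => (s + D) `^ b : T1).
  apply: (@measurableT_comp _ _ _ _ _ _ (@powR R ^~ b)); first exact: measurable_powR.
  exact: measurable_funD.
pose F (s : T1) : R := if s \in A then u s * (s + D) `^ (- a) else 0.
pose G (s : T1) : R := if s \in A then (s + D) `^ (a - 1) else 0.
have mif (h : T1 -> R) : measurable_fun setT h ->
    measurable_fun setT (fun s : T1 => if s \in A then h s else 0 : T1).
  by move=> mh; apply: (measurable_restrictT h mA).1; exact: measurable_funTS.
have mF : measurable_fun setT F by exact: (mif _ (measurable_funM mu_ (mw (- a)))).
have mG : measurable_fun setT G by exact: (mif _ (mw (a - 1))).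
have sD (s : T1) : s \in A -> 0 < s + D.
  by rewrite inE/= in_itv/= => /andP[s0 _]; exact: ltr_wpDl.
have F0 s : 0 <= F s by rewrite /F; case: ifP => // _; rewrite mulr_ge0// powR_ge0.
have G0 s : 0 <= G s by rewrite /G; case: ifP => // _; rewrite powR_ge0.
have := hoelder mu mF mG p0 q0 pq.
have -> : 'N[mu]_1[EFin \o (F \* G)%R]%E = (\int[mu]_(s in A) (u s / (s + D))%:E)%E.
  rewrite Lnorm1 -(@integral_if_segment _ (fun s => F s * G s)).
    by apply: eq_integral => s _; rewrite /= ger0_norm// mulr_ge0.
  move=> s; rewrite /F /G; case: ifPn => [sA|_]; last by rewrite mul0r.
  rewrite -mulrA -powRD; last by rewrite (gt_eqF (sD _ sA)) implybT.
  by rewrite addKr powR_inv1// ltW// sD.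
have -> : 'N[mu]_p%:E[EFin \o F]%E =
    ((\int[mu]_(s in A) (u s `^ p * invsqrt (s + D))%:E) `^ p^-1)%E.
  rewrite LnormE; apply: (congr1 (fun x => x `^ p^-1)%E).
  rewrite -(@integral_if_segment _ (fun s => F s `^ p)).
    by apply: eq_integral => s _; rewrite /= ger0_norm.
  move=> s; rewrite /F; case: ifPn => [sA|_]; last by rewrite powR0// gt_eqF.
  rewrite powRM ?powR_ge0// -powRrM invsqrt_powR ?sD//; congr (_ * _ `^ _).
  by rewrite /a; field; rewrite gt_eqF.
have -> : 'N[mu]_q%:E[EFin \o G]%E =
    ((\int[mu]_(s in A) ((s + D) `^ (- 1 - e))%:E) `^ q^-1)%E.
  rewrite LnormE; apply: (congr1 (fun x => x `^ q^-1)%E).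
  rewrite -(@integral_if_segment _ (fun s => G s `^ q)).
    by apply: eq_integral => s _; rewrite /= ger0_norm.
  move=> s; rewrite /G; case: ifPn => [sA|_]; last by rewrite powR0// gt_eqF.
  rewrite -powRrM; congr (_ `^ _).
  by rewrite /a /q /e; field; rewrite !gt_eqF.
set I1 := (\int[mu]_(s in A) (u s / (s + D))%:E)%E.
set I2 := (\int[mu]_(s in A) (u s `^ p * invsqrt (s + D))%:E)%E.
set I3 := (\int[mu]_(s in A) _)%E => h.
have I10 : (0 <= I1)%E.
  apply: integral_ge0 => s sA; rewrite lee_fin divr_ge0// ltW// sD//; exact: mem_set.
have I20 : (0 <= I2)%E.
  by apply: integral_ge0 => s _; rewrite lee_fin mulr_ge0 ?powR_ge0 ?invsqrt_ge0.
have I30 : (0 <= I3)%E by apply: integral_ge0 => s _; rewrite lee_fin powR_ge0.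
have I3le : (I3 <= (D `^ (- e) / e)%:E)%E by exact: integral_weight.
have h' : (I1 `^ p <= (I2 `^ p^-1 * I3 `^ q^-1) `^ p)%E.
  by apply: gt0_ler_poweR; rewrite ?in_itv/= ?I10 ?mule_ge0 ?poweR_ge0 ?leey// ltW.
apply: le_trans h' _; rewrite poweRM ?poweR_ge0// -!poweRrM mulVf ?gt_eqF// poweRe1//.
rewrite muleC; apply: lee_wpmul2r => //.
have -> : q^-1 * p = p - 1 by rewrite /q; field; rewrite !gt_eqF.
apply: (@le_trans _ _ ((D `^ (- e) / e)%:E `^ (p - 1))%E).
  by apply: gt0_ler_poweR; rewrite ?in_itv/= ?I30 ?leey ?(ltW p10)// lee_fin
     divr_ge0 ?powR_ge0// ltW.
rewrite poweR_EFin lee_fin mulrC [leLHS]powRM ?powR_ge0 ?invr_ge0 ?(ltW e0)//; last by lra.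
rewrite -powRrM invsqrt_powR// /e invrK.
by rewrite (_ : - (2 * (p - 1))^-1 * (p - 1) = - 2^-1)//; field; rewrite gt_eqF.
Qed.

End hoelder_weight.

(** Hardy's inequality, for a family of contractions that multiply a gauge by 1 - s
    and whose inverses distort the measure by a bounded factor. It is stated on an
    abstract space because it is applied to tuples of real coordinates, whose
    Lebesgue measure is available as a sigma-finite product. *)
Section hardy.
Context d (X : measurableType d) (R : realType).
Variable nu : {sigma_finite_measure set X -> \bar R}.
Local Notation mu := (@lebesgue_measure R).
Local Notation T1 := (measurableTypeR R).
Local Notation A := (`[0%R, (2^-1)%R]%classic : set T1).
Variables (sc : R -> X -> X) (N : X -> T1) (C : R).
Hypothesis msc : measurable_fun setT (fun y : T1 * X => sc y.1 y.2).
Hypothesis mN : measurable_fun setT N.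
Hypothesis N0 : forall x, 0 <= N x.
Hypothesis Nsc : forall s x, 0 <= s <= 2^-1 -> N (sc s x) = (1 - s) * N x.
Hypothesis C0 : 0 <= C.
Hypothesis scC : forall s (h : X -> \bar R), 0 <= s <= 2^-1 ->
  measurable_fun setT h -> (forall x, (0 <= h x)%E) ->
  (\int[nu]_x h (sc s x) <= C%:E * \int[nu]_x h x)%E.

Definition hardy (phi : X -> R) (x : X) : \bar R :=
  (\int[mu]_(s in A) (phi (sc s x) / `|s + (1 - N x)|)%:E)%E.

Variables (p : R) (phi : X -> T1).
Hypothesis p1 : 1 < p.
Hypothesis mphi : measurable_fun setT phi.
Hypothesis phi0 : forall x, 0 <= phi x.

(** The integrand left by Hoelder's inequality, bounded in terms of the contracted
    point y.1 = sc s x and of y.2 = s: here s + (1 - N x) >= 1 - N y.1 and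
    1 - N x >= 1 - N y.1 - s. *)
Let W (y : X * T1) : R :=
  phi y.1 `^ p * invsqrt (1 - N y.1) * invsqrt (1 - N y.1 - y.2).

Let W0 y : 0 <= W y.
Proof. by rewrite !mulr_ge0 ?powR_ge0 ?invsqrt_ge0. Qed.

Let mW : measurable_fun setT W.
Proof.
have m1 : measurable_fun setT (fun y : X * T1 => phi y.1).
  by apply: measurableT_comp => //; exact: measurable_fst.
have m2 : measurable_fun setT (fun y : X * T1 => 1 - N y.1).
  by apply: measurable_funB => //; apply: measurableT_comp => //; exact: measurable_fst.
apply: measurable_funM; first apply: measurable_funM.
- apply: (@measurableT_comp _ _ _ _ _ _ (@powR R ^~ p)) => //; exact: measurable_powR.
- apply: (@measurableT_comp _ _ _ _ _ _ (@invsqrt R)) => //; exact: measurable_invsqrt.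
- apply: (@measurableT_comp _ _ _ _ _ _ (@invsqrt R)); first exact: measurable_invsqrt.
  by apply: measurable_funB => //; exact: measurable_snd.
Qed.

Let hardy_pointwise x : N x < 1 ->
  (hardy phi x `^ p <= ((2 * (p - 1)) `^ (p - 1))%:E *
     \int[mu]_(s in A) (W (sc s x, s))%:E)%E.
Proof.
move=> x1; have D0 : 0 < 1 - N x by lra.
have ms : measurable_fun setT (fun s : T1 => sc s x).
  exact: (@measurableT_comp _ _ _ _ _ _ (fun y : T1 * X => sc y.1 y.2) _
    (fun s => (s, x)) msc (pair2_measurable x)).
have mx : measurable_fun setT (fun s : T1 => phi (sc s x)).
  exact: (measurableT_comp mphi ms).
have mWx : measurable_fun setT (fun s : T1 => W (sc s x, s)).
  by apply: (measurableT_comp mW); exact: measurable_fun_pair.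
have mwx : measurable_fun setT (fun s : T1 => invsqrt (s + (1 - N x)) : T1).
  apply: (@measurableT_comp _ _ _ _ _ _ (@invsqrt R)); first exact: measurable_invsqrt.
  exact: measurable_funD.
have mpx : measurable_fun setT (fun s : T1 => phi (sc s x) `^ p * invsqrt (s + (1 - N x)) : T1).
  apply: measurable_funM => //.
  by apply: (@measurableT_comp _ _ _ _ _ _ (@powR R ^~ p)) => //; exact: measurable_powR.
have -> : hardy phi x = (\int[mu]_(s in A) (phi (sc s x) / (s + (1 - N x)))%:E)%E.
  apply: eq_integral => s; rewrite inE/= in_itv/= => /andP[s0 _].
  by rewrite gtr0_norm// ltr_wpDl.
apply: le_trans (hoelder_weight p1 D0 mx (fun s => phi0 _)) _.
rewrite EFinM -muleA; apply: lee_wpmul2l; first by rewrite lee_fin powR_ge0.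
rewrite -ge0_integralZl_EFin ?invsqrt_ge0//; last 2 first.
- by move=> s _; rewrite lee_fin mulr_ge0 ?powR_ge0 ?invsqrt_ge0.
- by apply: measurable_funTS; exact/measurable_EFinP.
apply: ge0_le_integral => //.
- by move=> s _; rewrite -EFinM lee_fin !mulr_ge0 ?powR_ge0 ?invsqrt_ge0.
- by apply: measurable_funTS; apply: measurable_funeM; exact/measurable_EFinP.
- by apply: measurable_funTS; exact/measurable_EFinP.
move=> s; rewrite /= in_itv/= => sA; have [s0 s1] := andP sA.
rewrite -EFinM lee_fin /W /= Nsc// mulrCA -mulrA ler_wpM2l ?powR_ge0// mulrC.
have Nx0 := N0 x.
have g1 : 0 < 1 - (1 - s) * N x by nra.
have g2 : 0 < 1 - (1 - s) * N x - s by nra.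
by apply: ler_pM; rewrite ?invsqrt_ge0//; apply: invsqrt_le => //; nra.
Qed.

Let if_segment (w : X * T1 -> R) (y : X * T1) : R := if y.2 \in A then w y else 0.

Let measurable_if_segment w : measurable_fun setT w -> measurable_fun setT (if_segment w).
Proof.
move=> mw; have mA : measurable (setT `*` A : set (X * T1)).
  by apply: measurableX => //; exact: measurable_itv.
have -> : if_segment w = w \_ (setT `*` A).
  apply/funext => y; rewrite /if_segment patchE; congr (if _ then _ else _).
  by apply/idP/idP; rewrite !inE => // -[].
by apply: (measurable_restrictT w mA).1; exact: measurable_funTS.
Qed.

Let K (y : X * T1) : R := phi (sc y.2 y.1) / `|y.2 + (1 - N y.1)|.

Let measurable_sc : measurable_fun setT (fun y : X * T1 => sc y.2 y.1).
Proof.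
apply: (@measurableT_comp _ _ _ _ _ _ (fun y : T1 * X => sc y.1 y.2) _
  (fun y => (y.2, y.1)) msc).
by apply: measurable_fun_pair; [exact: measurable_snd|exact: measurable_fst].
Qed.

Let mK : measurable_fun setT K.
Proof.
apply: measurable_funM; first exact: (measurableT_comp mphi measurable_sc).
rewrite (_ : (fun x => _) = (fun y : X * T1 => `|y.2 + (1 - N y.1)| `^ (-1) : T1)); last first.
  by apply/funext => y; rewrite powR_inv1.
apply: (@measurableT_comp _ _ _ _ _ _ (@powR R ^~ (-1))); first exact: measurable_powR.
apply: measurableT_comp => //.
apply: measurable_funD; first exact: measurable_snd.
by apply: measurable_funB => //; exact: (measurableT_comp mN measurable_fst).
Qed.

Lemma hardy_ge0 x : (0 <= hardy phi x)%E.
Proof. by apply: integral_ge0 => s _; rewrite lee_fin divr_ge0. Qed.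

Lemma measurable_hardy : measurable_fun setT (hardy phi).
Proof.
have mf : measurable_fun setT (fun y : X * T1 => (if_segment K y)%:E).
  by apply/measurable_EFinP; exact: measurable_if_segment.
have f0 y : (0 <= (if_segment K y)%:E)%E.
  by rewrite lee_fin /if_segment; case: ifP => // _; rewrite divr_ge0.
have := @measurable_fun_fubini_tonelli_F _ _ _ _ R mu _ mf f0.
apply: eq_measurable_fun => x _; rewrite /fubini_F.
by apply: integral_if_segment.
Qed.

(** After [hardy_pointwise], Tonelli's theorem puts the integral in s outside; for
    each s the contraction is removed at the cost of the factor C; then the integral
    in s is done first again, and by [integral_invsqrt] it cancels the other weight. *)
Lemma hardy_inequality :
  (\int[nu]_(x in [set x | N x < 1]%R) (hardy phi x `^ p) <=
   ((2 * (p - 1)) `^ (p - 1) * (C * 2))%:E *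
   \int[nu]_(x in [set x | N x < 1]%R) (phi x `^ p)%:E)%E.
Proof.
set c := (2 * (p - 1)) `^ (p - 1); have c0 : 0 <= c by exact: powR_ge0.
have mU : measurable [set x | N x < 1]%R.
  rewrite (_ : [set x | _] = N @^-1` [set` `]-oo, 1[%R]); last first.
    by apply/seteqP; split => x /=; rewrite in_itv.
  by rewrite -[Y in measurable Y]setTI; exact: mN.
pose V (y : X * T1) : R := W (sc y.2 y.1, y.2).
have mV : measurable_fun setT V.
  apply: (measurableT_comp mW); apply: measurable_fun_pair; first exact: measurable_sc.
  exact: measurable_snd.
have mVs : measurable_fun setT (fun y : X * T1 => (if_segment V y)%:E).
  by apply/measurable_EFinP; exact: measurable_if_segment.
have mWs : measurable_fun setT (fun y : X * T1 => (if_segment W y)%:E).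
  by apply/measurable_EFinP; exact: measurable_if_segment.
have Vs0 y : (0 <= (if_segment V y)%:E)%E.
  by rewrite lee_fin /if_segment; case: ifP => // _; exact: W0.
have Ws0 y : (0 <= (if_segment W y)%:E)%E.
  by rewrite lee_fin /if_segment; case: ifP => // _; exact: W0.
have mFV := @measurable_fun_fubini_tonelli_F _ _ _ _ R mu _ mVs Vs0.
have mFW := @measurable_fun_fubini_tonelli_F _ _ _ _ R mu _ mWs Ws0.
have mGV := @measurable_fun_fubini_tonelli_G _ _ _ _ R nu _ mVs Vs0.
have mGW := @measurable_fun_fubini_tonelli_G _ _ _ _ R nu _ mWs Ws0.
pose I (w : X * T1 -> R) x := (\int[mu]_s (if_segment w (x, s))%:E)%E.
pose J (w : X * T1 -> R) s := (\int[nu]_x (if_segment w (x, s))%:E)%E.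
have J0 x : (0 <= I V x)%E by exact: integral_ge0.
have mp : measurable_fun setT (fun x => (hardy phi x `^ p)%E).
  exact: (measurableT_comp (measurable_poweR p) measurable_hardy).
apply: (@le_trans _ _ (c%:E * \int[nu]_x I V x)%E).
  have hp0 x : (0 <= hardy phi x `^ p)%E by exact: poweR_ge0.
  apply: (@le_integral_cstM _ _ _ nu _ c _ (I V) mU c0 mp mFV hp0 J0) => x x1.
  apply: le_trans (hardy_pointwise x1) _.
  by rewrite /I (@integral_if_segment _ (fun s => V (x, s))).
rewrite EFinM -muleA; apply: lee_wpmul2l; first by rewrite lee_fin.
rewrite /I (@fubini_tonelli _ _ _ _ R nu mu _ mVs Vs0).
apply: (@le_trans _ _ (C%:E * \int[mu]_s \int[nu]_x (if_segment W (x, s))%:E)%E).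
  apply: (@le_integral_cstM _ _ _ mu _ C (J V) (J W) measurableT C0 mGV mGW) =>
    [s|s|s _]; [exact: integral_ge0|exact: integral_ge0|].
  have [sA|sA] := boolP (s \in A); last first.
    rewrite /J integral0_eq; last by move=> x _; rewrite /if_segment /= (negbTE sA).
    by rewrite mule_ge0 ?lee_fin// integral_ge0.
  rewrite /J /if_segment /= sA /V /=; apply: (scC (h := fun x => (W (x, s))%:E)) => //.
  - by move: sA; rewrite inE/= in_itv.
  - apply/measurable_EFinP; apply: (measurableT_comp mW); exact: pair2_measurable.
  - by move=> x; rewrite lee_fin; exact: W0.
rewrite EFinM -muleA; apply: lee_wpmul2l; first by rewrite lee_fin.
rewrite -(@fubini_tonelli _ _ _ _ R nu mu _ mWs Ws0).
have mpp : measurable_fun setT (fun x => (phi x `^ p)%:E).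
  apply/measurable_EFinP.
  by apply: (@measurableT_comp _ _ _ _ _ _ (@powR R ^~ p)) => //; exact: measurable_powR.
rewrite -ge0_integralZl_EFin//; last 2 first.
- by move=> x _; rewrite lee_fin powR_ge0.
- exact: measurable_funTS.
rewrite [leRHS]integral_mkcond; apply: ge0_le_integral => //.
- by move=> x _; exact: integral_ge0.
- apply/(measurable_restrictT _ mU); apply: measurable_funTS; exact: measurable_funeM.
move=> x _; rewrite (@integral_if_segment _ (fun s => W (x, s)))// patchE /W /=.
have mi : measurable_fun setT (fun s : T1 => (invsqrt (1 - N x - s))%:E).
  apply/measurable_EFinP; apply: (@measurableT_comp _ _ _ _ _ _ (@invsqrt R)).
    exact: measurable_invsqrt.
  exact: measurable_funB.
under eq_integral do rewrite EFinM.
rewrite ge0_integralZl_EFin//; last 3 first.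
- by move=> s _; rewrite lee_fin invsqrt_ge0.
- exact: measurable_funTS.
- by rewrite mulr_ge0 ?powR_ge0 ?invsqrt_ge0.
case: ifPn => [|]; rewrite ?notin_setE ?inE/= => x1; last first.
  by rewrite invsqrt_npos ?mulr0 ?mul0e//; move/negP : x1; rewrite -leNgt; lra.
have D0 : 0 < 1 - N x by lra.
apply: (@le_trans _ _ ((phi x `^ p * invsqrt (1 - N x))%:E * (2 * Num.sqrt (1 - N x))%:E)%E).
  apply: lee_wpmul2l; last exact: integral_invsqrt.
  by rewrite lee_fin mulr_ge0 ?powR_ge0 ?invsqrt_ge0.
rewrite -!EFinM lee_fin; have := invsqrt_sqrt D0; set i := invsqrt _; set r := Num.sqrt _ => ir.
by rewrite -mulrA (mulrCA i) ir mulr1 mulrC.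
Qed.

End hardy.

(** * Integrals of powers on a bounded convex domain *)

(** The geometry of the domain with real constants: rho is the radius of a ball
    around the origin inside it and D bounds the norms of its points. *)
Record bounded_convex_domain (R : realType) (n : nat) (Omega : set 'rV[R[i]]_n)
    (rho D : R) : Prop := BoundedConvexDomain {
  domain_open : open Omega;
  domain_convex : forall z w (t : R), 0 <= t <= 1 -> Omega z -> Omega w ->
    Omega ((1 - t)%:C *: z + t%:C *: w);
  domain_rho : 0 < rho;
  domain_cball : forall z, rnorm z < rho -> Omega z;
  domain_bound : forall z, Omega z -> rnorm z <= D }.

Section power_integrals.
Variables (R : realType) (n : nat).
Local Notation Cn := 'rV[R[i]]_n.
Local Notation lam := (@lebesgue_Cn R n).
Implicit Types (f g : Cn -> R[i]) (p : R).

Definition Ip p f : \bar R := (\int[lam]_z (normc (f z) `^ p)%:E)%E.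

Lemma Ip_ge0 p f : (0 <= Ip p f)%E.
Proof. by apply: integral_ge0 => z _; rewrite lee_fin powR_ge0. Qed.

Lemma Lp_normE p f : Lp_norm p f = (Ip p f `^ p^-1)%E.
Proof.
rewrite /Lp_norm LnormE.
apply: (congr1 (fun x => x `^ p^-1)%E); apply: eq_integral => z _.
by rewrite /= ger0_norm ?normc_ge0.
Qed.

Lemma Ip_Lp_norm p f : 0 < p -> Ip p f = (Lp_norm p f `^ p)%E.
Proof. by move=> p0; rewrite Lp_normE -poweRrM mulVf ?gt_eqF// poweRe1// Ip_ge0. Qed.

Lemma Lp_norm_ge0 p f : (0 <= Lp_norm p f)%E.
Proof. by rewrite Lp_normE poweR_ge0. Qed.

Lemma Lp_norm_le p f (M : R) : 0 < p -> 0 <= M ->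
  (Lp_norm p f <= M%:E)%E <-> (Ip p f <= (M `^ p)%:E)%E.
Proof.
move=> p0 M0; split => h.
  rewrite Ip_Lp_norm// -poweR_EFin; apply: gt0_ler_poweR => //; first exact: ltW.
  - by rewrite in_itv/= Lp_norm_ge0 leey.
  - by rewrite in_itv/= lee_fin M0 leey.
have -> : M%:E = ((M `^ p)%:E `^ p^-1)%E.
  by rewrite poweR_EFin -powRrM mulfV ?gt_eqF// powRr1.
rewrite Lp_normE; apply: gt0_ler_poweR => //; first by rewrite invr_ge0 ltW.
- by rewrite in_itv/= Ip_ge0 leey.
- by rewrite in_itv/= lee_fin powR_ge0 leey.
Qed.

Lemma Lp_norm_lty p f : 0 < p -> (Lp_norm p f < +oo)%E <-> (Ip p f < +oo)%E.
Proof.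
move=> p0; split => h; first by rewrite Ip_Lp_norm// poweR_lty.
by rewrite Lp_normE poweR_lty.
Qed.

Definition mnormc f := measurable_fun setT (fun z : borel_Cn R n => normc (f z)).

Lemma measurable_Ip p f : mnormc f ->
  measurable_fun setT (fun z : borel_Cn R n => (normc (f z) `^ p)%:E).
Proof.
move=> mf; apply/measurable_EFinP.
by apply: (@measurableT_comp _ _ _ _ _ _ (@powR R ^~ p)) => //; exact: measurable_powR.
Qed.

Lemma Ip_le p f g : 0 <= p -> mnormc f -> mnormc g ->
  (forall z, normc (f z) <= normc (g z)) -> (Ip p f <= Ip p g)%E.
Proof.
move=> p0 mf mg fg; apply: ge0_le_integral => //.
- by move=> z _; rewrite lee_fin powR_ge0.
- exact: measurable_Ip.
- exact: measurable_Ip.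
by move=> z _; rewrite lee_fin ge0_ler_powR// nnegrE normc_ge0.
Qed.

Lemma IpZ p (c : R[i]) f : mnormc f ->
  Ip p (fun z => c * f z) = ((normc c `^ p)%:E * Ip p f)%E.
Proof.
move=> mf; rewrite /Ip -ge0_integralZl_EFin ?powR_ge0//; last 2 first.
- by move=> z _; rewrite lee_fin powR_ge0.
- exact: measurable_Ip.
by apply: eq_integral => z _; rewrite Normc.normcM powRM ?normc_ge0.
Qed.

Lemma powR_add_le (a b p : R) : 0 <= a -> 0 <= b -> 0 <= p ->
  (a + b) `^ p <= 2 `^ p * (a `^ p + b `^ p).
Proof.
move=> a0 b0 p0; apply: (@le_trans _ _ ((2 * Num.max a b) `^ p)).
  apply: ge0_ler_powR; rewrite ?nnegrE ?addr_ge0 ?mulr_ge0 ?le_max ?a0//.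
  have am : a <= Num.max a b by rewrite le_max lexx.
  have bm : b <= Num.max a b by rewrite le_max lexx orbT.
  by lra.
rewrite powRM ?le_max ?a0// ler_wpM2l ?powR_ge0//.
by rewrite maxEle; case: ifP => _; rewrite ?lerDl ?lerDr powR_ge0.
Qed.

Lemma IpD p f g : 0 <= p -> mnormc f -> mnormc g -> mnormc (fun z => f z + g z) ->
  (Ip p (fun z => f z + g z)%R <= (2 `^ p)%:E * (Ip p f + Ip p g))%E.
Proof.
move=> p0 mf mg mfg; have m1 := measurable_Ip p mf; have m2 := measurable_Ip p mg.
have i1 (h : Cn -> R[i]) (z : Cn) : (0 <= (normc (h z) `^ p)%:E)%E by rewrite lee_fin powR_ge0.
have <- : (\int[lam]_z ((normc (f z) `^ p)%:E + (normc (g z) `^ p)%:E) = Ip p f + Ip p g)%E.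
  by apply: ge0_integralD.
rewrite -ge0_integralZl_EFin ?powR_ge0//; last 2 first.
- by move=> z _; rewrite adde_ge0.
- exact: emeasurable_funD.
apply: ge0_le_integral => //.
- by move=> z _; rewrite lee_fin powR_ge0.
- exact: measurable_Ip.
- by apply: measurable_funeM; exact: emeasurable_funD.
move=> z _; rewrite -EFinD -EFinM lee_fin.
apply: le_trans (_ : (normc (f z) + normc (g z)) `^ p <= _); last first.
  by apply: powR_add_le; rewrite ?normc_ge0.
by rewrite ge0_ler_powR ?nnegrE ?normc_ge0 ?addr_ge0 ?normc_ge0// le_normcD.
Qed.

(** The value zero outside the domain turns integrals over the domain into integrals
    over the whole space; the elements of the Bergman spaces have this form. *)
Definition holo0 (Omega : set Cn) f :=
  holomorphic_on Omega f /\ forall z, ~ Omega z -> f z = 0.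

Lemma holo0_measurable (Omega : set Cn) f : holo0 Omega f -> mnormc f.
Proof. by move=> [hf f0]; exact: (measurable_normc_holomorphic hf f0). Qed.

End power_integrals.

Section bergman_bounds.
Variables (R : realType) (n : nat) (Omega : set 'rV[R[i]]_n) (rho D : R).
Local Notation Cn := 'rV[R[i]]_n.
Local Notation lam := (@lebesgue_Cn R n).
Hypothesis dom : bounded_convex_domain Omega rho D.
Implicit Types (f g : Cn -> R[i]) (z w h : Cn) (p : R).

Let oO := domain_open dom.

Lemma holo0D f g : holo0 Omega f -> holo0 Omega g -> holo0 Omega (fun z => f z + g z).
Proof.
move=> [hf f0] [hg g0]; split => [z Oz|z Oz]; last by rewrite f0// g0// addr0.
by apply: differentiable_add; [exact: hf|exact: hg].
Qed.

Lemma holo0Z (c : R[i]) f : holo0 Omega f -> holo0 Omega (fun z => c * f z).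
Proof.
move=> [hf f0]; split => [z Oz|z Oz]; last by rewrite f0// mulr0.
by apply: (@differentiable_mul _ _ (fun=> c)); [exact: differentiable_cst|exact: hf].
Qed.

Lemma holo0B f g : holo0 Omega f -> holo0 Omega g -> holo0 Omega (fun z => f z - g z).
Proof.
move=> hf hg; have := holo0D hf (holo0Z (-1) hg).
by congr holo0; apply/funext => z; rewrite mulN1r.
Qed.

Lemma measurable_domain : measurable (Omega : set (borel_Cn R n)).
Proof. exact: sub_sigma_algebra. Qed.

Lemma domain_volume : (lam Omega < +oo)%E.
Proof.
pose A (k : 'I_(n + n)) : set (measurableTypeR R) := `[- D, D]%classic.
have mA k : measurable (A k) by exact: measurable_itv.
apply: (@le_lt_trans _ _ (tuple_measure lebesgue_measure (n + n) (tuple_box A))).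
  rewrite /lebesgue_Cn /pushforward; apply: le_measure; rewrite ?inE.
  - rewrite -[X in measurable X]setTI; apply: measurable_Cn_of_tuple => //.
    exact: measurable_domain.
  - exact: measurable_tuple_box.
  move=> t /(domain_bound dom) tD k; rewrite /A/= in_itv/= -ler_norml.
  case: (splitP k) => l kl.
    have -> : k = lshift n l by apply: val_inj.
    apply: le_trans (le_trans (rnorm_coord _ l) tD).
    by have := Re_le_normc ((Cn_of_tuple t : Cn) 0 l); rewrite mxE.
  have -> : k = rshift n l by apply: val_inj.
  apply: le_trans (le_trans (rnorm_coord _ l) tD).
  by have := Im_le_normc ((Cn_of_tuple t : Cn) 0 l); rewrite mxE.
have D0 : 0 <= D by exact: domain_bound_ge0 (domain_rho dom) (domain_cball dom) (domain_bound dom).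
have E : lebesgue_measure (`[- D, D]%classic : set (measurableTypeR R)) = (D - - D)%:E.
  rewrite lebesgue_measure_itv/= lte_fin; case: ltP => // DD.
  by rewrite (@le_anti _ _ (- D) D) ?subrr// DD andbT; lra.
rewrite tuple_measure_box// (eq_bigr (fun _ => (D - - D)%:E)); last by move=> k _; exact: E.
by rewrite prodEFin ltry.
Qed.

Definition volume : R := fine (lam Omega).

Lemma volumeE : lam Omega = volume%:E.
Proof. by rewrite fineK// ge0_fin_numE// domain_volume. Qed.

Lemma volume_ge0 : 0 <= volume.
Proof. exact: fine_ge0. Qed.

Lemma powR_le_add1 (a s t : R) : 0 <= a -> 0 < t -> t <= s -> a `^ t <= 1 + a `^ s.
Proof.
move=> a0 t0 ts; have [a1|a1] := leP a 1.
  apply: (@le_trans _ _ 1); last by rewrite lerDl powR_ge0.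
  rewrite [leRHS](_ : 1 = 1 `^ t); last by rewrite powR1.
  by apply: ge0_ler_powR; rewrite ?nnegrE// ltW.
by apply: (@le_trans _ _ (a `^ s)); [exact: ler_powR (ltW a1) _ _ ts|rewrite lerDr].
Qed.

(** The domain has finite volume, and a^t <= 1 + a^s. *)
Lemma Ip_mono (s t : R) f : 0 < t -> t <= s -> holo0 Omega f ->
  (Ip t f <= volume%:E + Ip s f)%E.
Proof.
move=> t0 ts hf; have mf := holo0_measurable hf.
have mi : measurable_fun setT (fun z : borel_Cn R n => (\1_Omega z : R)%:E).
  by apply/measurable_EFinP; apply: measurable_indic; exact: measurable_domain.
have i1 z : (0 <= (normc (f z) `^ s)%:E)%E by rewrite lee_fin powR_ge0.
have -> : volume%:E = (\int[lam]_z (\1_Omega z : R)%:E)%E.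
  rewrite integral_indic; [by rewrite setIT -volumeE|exact: measurableT|].
  exact: measurable_domain.
rewrite /Ip -ge0_integralD//; last exact: measurable_Ip.
apply: ge0_le_integral => //.
- by move=> z _; rewrite lee_fin powR_ge0.
- exact: measurable_Ip.
- by apply: emeasurable_funD => //; exact: measurable_Ip.
move=> z _; rewrite -EFinD lee_fin indicE; have [Oz|Oz] := pselect (Omega z).
  by rewrite mem_set//; exact: powR_le_add1 (normc_ge0 _) t0 ts.
by rewrite memNset// hf.2// Normc.normc0 !powR0 ?addr0// gt_eqF// (lt_le_trans t0).
Qed.

(** The modulus at z is bounded by a mean over a box inside the ball, hence by the
    L^1 norm, which the L^p norm controls. *)
Lemma ball_bound p (r M : R) : 1 < p -> 0 < r -> exists C : R, forall f z,
  holo0 Omega f -> (Ip p f <= M%:E)%E -> cball z r `<=` Omega -> normc (f z) <= C.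
Proof.
move=> p1 r0; pose e := r / 4; have e0 : 0 < e by rewrite divr_gt0.
exists ((4 / e ^+ 2) ^+ n * (volume + M)) => f z hf f1 zO.
have mf := holo0_measurable hf.
have := @point_bound R n f z e e0 mf; rewrite -lee_fin EFinM => H.
apply: le_trans (H _) _ => {H}.
  move=> w wz; apply: hf.1; apply: zO; rewrite /cball/=.
  apply: le_lt_trans (_ : 2 * e < r); last by rewrite /e; lra.
  apply: rnorm_le => [|k]; first by rewrite mulr_ge0// ltW.
  have [h1 h2] := wz k; apply: le_trans (normc_le_ReIm _) _.
  rewrite !mxE !raddfB/=; lra.
apply: lee_wpmul2l.
  by rewrite lee_fin exprn_ge0// divr_ge0// exprn_ge0// ltW.
have := @Ip_mono p 1 f ltr01 (ltW p1) hf; rewrite EFinD.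
have -> : Ip 1 f = (\int[lam]_w (normc (f w))%:E)%E.
  by apply: eq_integral => w _; rewrite powRr1 ?normc_ge0.
by move=> h; apply: le_trans h _; exact: leeD.
Qed.

Lemma Ip_dilate p f (r : R) : 0 < p -> 0 < r <= 1 -> holo0 Omega f ->
  (Ip p (fun z => f (r%:C *: z)) <= (r ^- (n + n))%:E * Ip p f)%E.
Proof.
move=> p0 /andP[r0 r1] hf; have mf := holo0_measurable hf.
rewrite [in leRHS]/Ip (integral_scale r0); last 2 first.
- exact: measurable_Ip.
- by move=> z; rewrite lee_fin powR_ge0.
by rewrite muleA -EFinM mulVf ?mul1e// expf_neq0// gt_eqF.
Qed.

End bergman_bounds.

(** * Hardy inequality along the rays of the domain *)

Lemma poweR_add_le (R : realType) (x y : \bar R) (p : R) : 0 < p ->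
  (0 <= x)%E -> (0 <= y)%E ->
  ((x + y) `^ p <= (2 `^ p)%:E * (x `^ p + y `^ p))%E.
Proof.
move=> p0; have p0' : p != 0 by rewrite gt_eqF.
have c0 : (0 < (2 `^ p)%:E :> \bar R)%E by rewrite lte_fin powR_gt0.
case: x => [x| |] //; case: y => [y| |] //; rewrite ?lee_fin => x0 y0.
- by rewrite powR_add_le// ltW.
- by rewrite addey// !poweRyr// poweR_EFin addey// gt0_muley.
- by rewrite addye// !poweRyr// poweR_EFin addye// gt0_muley.
- by rewrite addye// !poweRyr// addye// gt0_muley.
Qed.

Section hardy_on_domain.
Variables (R : realType) (n : nat) (Omega : set 'rV[R[i]]_n) (rho D : R).
Local Notation Cn := 'rV[R[i]]_n.
Local Notation lam := (@lebesgue_Cn R n).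
Local Notation mu := (@lebesgue_measure R).
Local Notation T1 := (measurableTypeR R).
Local Notation Tn := ((n + n).-tuple T1).
Hypothesis dom : bounded_convex_domain Omega rho D.
Implicit Types (f : Cn -> R[i]) (z : Cn).

Let gZ := gaugeZ (domain_convex dom) (domain_rho dom) (domain_cball dom).
Let g0 := gauge_ge0 (domain_rho dom) (domain_cball dom).
Let gO := domain_gauge (domain_open dom) (domain_convex dom) (domain_rho dom) (domain_cball dom).

(** Averages over the outer half of the segment from 0 to z, with t = 1 - s. *)
Definition radial_hardy f z : \bar R :=
  (\int[mu]_(s in `[0%R, (2^-1)%R])
     (normc (f ((1 - s)%:C *: z)) / `|s + (1 - gauge Omega z)|)%:E)%E.

Let sc (s : R) (x : Tn) : Tn := tuple_scale (1 - s) x.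
Let N (x : Tn) : T1 := gauge Omega (Cn_of_tuple x).
Let U : set Tn := [set x | N x < 1].

Let msc : measurable_fun setT (fun y : T1 * Tn => sc y.1 y.2).
Proof.
apply/measurable_fun_tnthP => k.
rewrite (_ : _ \o _ = (fun y : T1 * Tn => (1 - y.1) * tnth y.2 k : T1)); last first.
  by apply/funext => y; rewrite /= tnth_mktuple.
apply: measurable_funM.
  by apply: measurable_funB => //; exact: measurable_fst.
exact: (measurableT_comp (measurable_tnth k) measurable_snd).
Qed.

Let mN : measurable_fun setT N.
Proof.
apply: (@measurableT_comp _ _ _ _ _ _ (gauge Omega : borel_Cn R n -> T1)).
  exact: (@measurable_gauge R n Omega (domain_convex dom) rho (domain_rho dom) (domain_cball dom)).
exact: measurable_Cn_of_tuple.
Qed.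

Let mU : measurable U.
Proof.
rewrite (_ : U = N @^-1` [set` `]-oo, 1[%R]); last first.
  by apply/seteqP; split => x /=; rewrite in_itv.
by rewrite -[Y in measurable Y]setTI; exact: mN.
Qed.

Let scC s (h : Tn -> \bar R) : 0 <= s <= 2^-1 -> measurable_fun setT h ->
  (forall x, (0 <= h x)%E) ->
  (\int[tuple_measure mu (n + n)]_x h (sc s x) <=
   (2 ^+ (n + n))%:E * \int[tuple_measure mu (n + n)]_x h x)%E.
Proof.
move=> /andP[s0 s1] mh h0; pose r := 1 - s; have r0 : 0 < r by rewrite /r; lra.
pose m := measure_function_pushforward__canonical__measure_function_Measure
  (tuple_measure mu (n + n)) (@measurable_tuple_scale R n r).
have rn0 : 0 <= r ^+ (n + n) by rewrite exprn_ge0// ltW.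
have -> : (\int[tuple_measure mu (n + n)]_x h x =
    (r ^+ (n + n))%:E * \int[tuple_measure mu (n + n)]_x h (tuple_scale r x))%E.
  rewrite (@eq_measure_integral _ _ _ _ (mscale (NngNum rn0) m)); last first.
    by move=> A mA _; exact: tuple_measure_scale.
  rewrite ge0_integral_mscale//; apply: (congr1 (fun x => (r ^+ (n + n))%:E * x)%E).
  by rewrite /m ge0_integral_pushforward//; exact: measurable_tuple_scale.
rewrite muleA -EFinM; apply: lee_pemull; first by exact: integral_ge0.
rewrite lee_fin -exprMn exprn_ege1// /r; lra.
Qed.

(** The operator is compared with this majorant; the contraction is z -> (1 - s) z, for
    which the Jacobian is at least 2^-(2 n). *)
Lemma hardy_Ip (p a b c : R) : 1 < p -> 0 <= a -> 0 <= b -> 0 <= c ->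
  exists C : R, forall f (F : Cn -> R[i]), holo0 Omega f -> (Ip p f <= 1)%E ->
    mnormc F -> (forall z, ~ Omega z -> F z = 0) ->
    (forall z, Omega z ->
       ((normc (F z))%:E <= (a * normc (f z) + b)%:E + c%:E * radial_hardy f z)%E) ->
    (Ip p F <= C%:E)%E.
Proof.
move=> p1 a0 b0 c0; have p0 : 0 < p by lra.
have p0' : p != 0 by rewrite gt_eqF.
pose K := (2 * (p - 1)) `^ (p - 1) * (2 ^+ (n + n) * 2).
have K0 : 0 <= K by rewrite mulr_ge0 ?powR_ge0// mulr_ge0// exprn_ge0.
pose A := 2 `^ p * (2 `^ p * a `^ p); pose B := 2 `^ p * (2 `^ p * b `^ p).
pose E := 2 `^ p * c `^ p.
have A0 : 0 <= A by rewrite !mulr_ge0 ?powR_ge0.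
have B0 : 0 <= B by rewrite !mulr_ge0 ?powR_ge0.
have E0 : 0 <= E by rewrite !mulr_ge0 ?powR_ge0.
exists (A + B * volume Omega + E * K) => f F hf f1 mF F0 HF.
have mf := holo0_measurable hf.
pose phi (x : Tn) : T1 := normc (f (Cn_of_tuple x)).
have mphi : measurable_fun setT phi.
  exact: (measurableT_comp mf (@measurable_Cn_of_tuple R n)).
have phi0 x : 0 <= phi x by exact: normc_ge0.
pose H := hardy sc N phi.
have HE x : H x = radial_hardy f (Cn_of_tuple x).
  by apply: eq_integral => s _; rewrite /phi Cn_of_tuple_scale.
have N0 x : 0 <= N x by exact: g0.
have Nsc s x : 0 <= s <= 2^-1 -> N (sc s x) = (1 - s) * N x.
  by move=> /andP[s0 s1]; rewrite /N Cn_of_tuple_scale gZ//; lra.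
have hardyle := hardy_inequality msc mN N0 Nsc (exprn_ge0 _ (ler0n _ _)) scC p1 mphi phi0.
have mH : measurable_fun setT H by exact: (measurable_hardy msc mN mphi phi0).
have H0 x : (0 <= H x)%E by exact: hardy_ge0.
have mphip : measurable_fun setT (fun x => (phi x `^ p)%:E).
  exact: (measurableT_comp (measurable_Ip p mf) (@measurable_Cn_of_tuple R n)).
rewrite -/H in hardyle; clearbody H.
have mHp : measurable_fun setT (fun x => (H x `^ p)%E).
  exact: (measurableT_comp (measurable_poweR p) mH).
have mFp : measurable_fun setT (fun x : Tn => (normc (F (Cn_of_tuple x)) `^ p)%:E).
  exact: (measurableT_comp (measurable_Ip p mF) (@measurable_Cn_of_tuple R n)).
rewrite /Ip integral_lebesgue_Cn_tuple//; last 2 first.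
- exact: measurable_Ip.
- by move=> z; rewrite lee_fin powR_ge0.
have -> : (\int[tuple_measure mu (n + n)]_x (normc (F (Cn_of_tuple x)) `^ p)%:E =
   \int[tuple_measure mu (n + n)]_(x in U) (normc (F (Cn_of_tuple x)) `^ p)%:E)%E.
  rewrite [RHS]integral_mkcond; apply: eq_integral => x _; rewrite patchE.
  case: ifPn => //; rewrite notin_setE /U /N /= => x1.
  by rewrite F0 ?Normc.normc0 ?powR0// => /gO.
have mAphi : measurable_fun setT (fun x => (A%:E * (phi x `^ p)%:E)%E) by exact: measurable_funeM.
have mEH : measurable_fun setT (fun x => (E%:E * H x `^ p)%E) by exact: measurable_funeM.
have Ap0 x : (0 <= A%:E * (phi x `^ p)%:E)%E by rewrite -EFinM lee_fin mulr_ge0// powR_ge0.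
have Ep0 x : (0 <= E%:E * H x `^ p)%E by rewrite mule_ge0// ?lee_fin// poweR_ge0.
apply: (@le_trans _ _ (\int[tuple_measure mu (n + n)]_(x in U)
    ((A%:E * (phi x `^ p)%:E + cst B%:E x) + E%:E * H x `^ p))%E).
  apply: ge0_le_integral => //.
  - by move=> x _; rewrite lee_fin powR_ge0.
  - exact: measurable_funTS.
  - apply: measurable_funTS; apply: emeasurable_funD => //.
    exact: emeasurable_funD.
  move=> x /gO Ox; rewrite -poweR_EFin.
  apply: (@le_trans _ _ (((a * phi x + b)%:E + c%:E * H x) `^ p)%E).
    apply: gt0_ler_poweR; first exact: ltW.
    - by rewrite in_itv/= lee_fin normc_ge0 leey.
    - by rewrite in_itv/= leey andbT adde_ge0 ?mule_ge0// lee_fin// addr_ge0// mulr_ge0.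
    - by rewrite HE; exact: HF.
  apply: le_trans (poweR_add_le p0 _ _) _.
  - by rewrite lee_fin addr_ge0// mulr_ge0.
  - by rewrite mule_ge0// lee_fin.
  rewrite poweR_EFin poweRM// ?lee_fin//=.
  rewrite ge0_muleDr ?lee_fin ?powR_ge0//; last first.
    by rewrite mule_ge0// ?poweR_ge0// lee_fin powR_ge0.
  rewrite muleA -EFinM; apply: leeD => //.
  rewrite -EFinM -EFinD lee_fin /A /B -mulrA -mulrDr ler_wpM2l ?powR_ge0//.
  rewrite -mulrA -mulrDr -powRM//.
  by apply: powR_add_le => //; [exact: mulr_ge0|exact: ltW].
rewrite ge0_integralD//; last 3 first.
- by move=> x _; rewrite adde_ge0// lee_fin.
- by apply: measurable_funTS; exact: emeasurable_funD.
- exact: measurable_funTS.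
rewrite ge0_integralD//; last exact: measurable_funTS.
rewrite integral_cst// ge0_integralZl_EFin//; last 2 first.
- by move=> x _; rewrite lee_fin powR_ge0.
- exact: measurable_funTS.
rewrite ge0_integralZl_EFin//; last 2 first.
- by move=> x _; rewrite poweR_ge0.
- exact: measurable_funTS.
have phile : (\int[tuple_measure mu (n + n)]_(x in U) (phi x `^ p)%:E <= 1)%E.
  apply: le_trans f1; rewrite /Ip integral_lebesgue_Cn_tuple//; last 2 first.
  - exact: measurable_Ip.
  - by move=> z; rewrite lee_fin powR_ge0.
  by apply: ge0_subset_integral => // x _; rewrite lee_fin powR_ge0.
have UE : (tuple_measure mu (n + n) U = (volume Omega)%:E)%E.
  rewrite -(volumeE dom) /lebesgue_Cn /pushforward; congr (tuple_measure mu (n + n) _).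
  by apply/seteqP; split => x /=; rewrite /U/= => /gO.
rewrite !EFinD; apply: leeD; first apply: leeD.
- by rewrite -[leRHS]mule1; apply: lee_wpmul2l; rewrite ?lee_fin.
- by rewrite [leRHS]EFinM -UE.
rewrite [leRHS]EFinM; apply: lee_wpmul2l; first by rewrite lee_fin.
apply: le_trans hardyle _; rewrite -[leRHS]mule1; apply: lee_wpmul2l => //.
Qed.

End hardy_on_domain.

(** * Calculus along rays *)

Section rays.
Variables (R : realType) (n : nat).
Local Notation Cn := 'rV[R[i]]_n.
Local Notation mu := (@lebesgue_measure R).
Implicit Types (f g : Cn -> R[i]) (z w h : Cn).

Definition ccontinuous_at (k : R -> R[i]) (t : R) := forall e : R, 0 < e ->
  exists2 d : R, 0 < d & forall s, `|s - t| < d -> normc (k s - k t) <= e.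

Lemma ccontinuous_at_on (k : R -> R[i]) (a b : R) :
  (forall t, a <= t <= b -> ccontinuous_at k t) -> ccontinuous_on a b k.
Proof.
move=> H t tab e e0; have [d d0 hd] := H t tab e e0.
by exists d => // s _; exact: hd.
Qed.

Lemma ccontinuous_at_part (k : R -> R[i]) (t : R) : ccontinuous_at k t ->
  {for t, continuous (fun s => complex.Re (k s))} /\
  {for t, continuous (fun s => complex.Im (k s))}.
Proof.
move=> H; split; apply/cvgrPdist_le => e e0; have [d d0 hd] := H e e0;
  near=> s; rewrite -raddfB/=;
  (apply: le_trans (_ : normc (k t - k s) <= e); first by rewrite ?Re_le_normc ?Im_le_normc);
  rewrite normc_distC; apply: hd; rewrite distrC;
  near: s; apply/nbhs_ballP; exists d.
Unshelve. all: by end_near. Qed.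

Lemma cint_ftc (phi k : R -> R[i]) (a b : R) : a <= b ->
  (forall t, a <= t <= b ->
    is_derive t 1 (fun s => complex.Re (phi s)) (complex.Re (k t)) /\
    is_derive t 1 (fun s => complex.Im (phi s)) (complex.Im (k t))) ->
  (forall t, a <= t <= b -> ccontinuous_at k t) ->
  cint a b k = phi b - phi a.
Proof.
move=> ab dphi ck.
have d1 t : a <= t <= b -> is_derive t 1 (fun s => complex.Re (phi s)) (complex.Re (k t)).
  by move=> /dphi[].
have d2 t : a <= t <= b -> is_derive t 1 (fun s => complex.Im (phi s)) (complex.Im (k t)).
  by move=> /dphi[].
have c1 t : a <= t <= b -> {for t, continuous (fun s => complex.Re (k s))}.
  by move=> /ck/ccontinuous_at_part[].
have c2 t : a <= t <= b -> {for t, continuous (fun s => complex.Im (k s))}.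
  by move=> /ck/ccontinuous_at_part[].
have E1 := ftc_segment ab d1 c1; have E2 := ftc_segment ab d2 c2.
rewrite /cint /Rintegral E1 E2 /=.
by case: (phi b) => x y; case: (phi a) => x' y'; simpc.
Qed.

Lemma eq_cint_oc (h k : R -> R[i]) (a b : R) : cintegrable a b k ->
  (forall t, a < t <= b -> h t = k t) -> cint a b h = cint a b k.
Proof.
move=> [k1 k2] hk; rewrite /cint.
have sub : `]a, b]%classic `<=` `[a, b]%classic.
  by move=> t /=; rewrite !in_itv/= => /andP[/ltW -> ->].
have part (F : R[i] -> R) : mu.-integrable `[a, b] (EFin \o (fun t => F (k t))) ->
    \int[mu]_(t in `[a, b]) F (h t) = \int[mu]_(t in `[a, b]) F (k t).
  move=> ik; have ik' : mu.-integrable `]a, b] (EFin \o (fun t => F (k t))).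
    by apply: integrableS ik.
  have ih : mu.-integrable `]a, b] (EFin \o (fun t => F (h t))).
    apply: eq_integrable ik' => // t; rewrite inE/= in_itv/= => tab.
    by rewrite /= hk.
  rewrite -(Rintegral_itv_obnd_cbnd ih) -(Rintegral_itv_obnd_cbnd ik').
  by apply: eq_Rintegral => t; rewrite inE/= in_itv/= => /hk ->.
by rewrite (part (@complex.Re R) k1) (part (@complex.Im R) k2).
Qed.

Lemma ray_continuous f z (t : R) : differentiable f (t%:C *: z) ->
  ccontinuous_at (fun s => f (s%:C *: z)) t.
Proof.
move=> df e e0; have [d d0 hd] := differentiable_cvg df e0.
have z1 : 0 < rnorm z + 1 by rewrite ltr_wpDl ?rnorm_ge0.
exists (d / (rnorm z + 1)) => [|s]; first by rewrite divr_gt0.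
rewrite ltr_pdivlMr// => st; apply: hd.
rewrite -scalerBl -rmorphB/= rnormZ normcR; apply: le_lt_trans st.
by rewrite ler_wpM2l// lerDl.
Qed.

Lemma ccontinuous_atM (h k : R -> R[i]) t : ccontinuous_at h t -> ccontinuous_at k t ->
  ccontinuous_at (fun s => h s * k s) t.
Proof.
move=> H K e e0; pose a := normc (h t) + normc (k t) + 1.
have a0 : 0 < a by rewrite /a; have := normc_ge0 (h t); have := normc_ge0 (k t); lra.
pose e1 := Num.min 1 (e / (2 * a)).
have e10 : 0 < e1 by rewrite lt_min ltr01 divr_gt0// mulr_gt0.
have e11 : e1 <= 1 by rewrite ge_min lexx.
have e12 : e1 * (2 * a) <= e.
  by rewrite -ler_pdivlMr ?mulr_gt0// ge_min lexx orbT.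
have [d d0 hd] := H e1 e10; have [d' d'0 hd'] := K e1 e10.
exists (Num.min d d') => [|s]; first by rewrite lt_min d0.
rewrite lt_min => /andP[/hd h1 /hd' h2].
have -> : h s * k s - h t * k t =
    (h s - h t) * (k s - k t) + (h s - h t) * k t + h t * (k s - k t) by ring.
apply: le_trans (le_normcD _ _) _; apply: le_trans (lerD (le_normcD _ _) (lexx _)) _.
rewrite !Normc.normcM.
have := normc_ge0 (h t); have := normc_ge0 (k t).
have := normc_ge0 (h s - h t); have := normc_ge0 (k s - k t).
move: h1 h2 e10 e11 e12; rewrite /a.
move: (normc (h s - h t)) (normc (k s - k t)) (normc (h t)) (normc (k t)) => x y u v.
clear; move: e1 => c hx hy c0 c1 ce y0 x0 v0 u0.
have : x * y <= c by nra.
have : x * v <= c * v by nra.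
have : u * y <= u * c by nra.
nra.
Qed.

Lemma is_derive_ray f z (t : R) : differentiable f (t%:C *: z) ->
  is_derive t 1 (fun s : R => complex.Re (f (s%:C *: z))) (complex.Re (dder f (t%:C *: z) z)) /\
  is_derive t 1 (fun s : R => complex.Im (f (s%:C *: z))) (complex.Im (dder f (t%:C *: z) z)).
Proof.
move=> df; have E (l : R[i]) : 0 + l *: z = l *: z by rewrite add0r.
have df' : differentiable f (0 + t%:C *: z) by rewrite E.
have [ds sE] := slice_differentiable df'.
have [d1 d2] := is_derive_slice ds.
rewrite sE E in d1 d2.
have Es : (fun s : R => slice f 0 z s%:C) = (fun s : R => f (s%:C *: z)).
  by apply/funext => s; rewrite /slice E.
split.
- by move: d1; rewrite (_ : (fun s : R => _) = (fun s : R => complex.Re (f (s%:C *: z))))//;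
    apply/funext => s; rewrite /slice E.
- by move: d2; rewrite (_ : (fun s : R => _) = (fun s : R => complex.Im (f (s%:C *: z))))//;
    apply/funext => s; rewrite /slice E.
Qed.

Lemma radial_derivativeE f z : differentiable f z -> radial_derivative f z = dder f z z.
Proof.
move=> df; rewrite dder_coord /radial_derivative; apply: eq_bigr => k _.
by rewrite dderE deriveE.
Qed.

Lemma differentiable_scale f z (c : R[i]) : differentiable f (c *: z) ->
  differentiable (fun u : Cn => f (c *: u)) z /\
  forall h, dder (fun u : Cn => f (c *: u)) z h = dder f (c *: z) (c *: h).
Proof.
move=> df; pose L : {linear Cn -> Cn} := *:%R c.
have cL : continuous L by move=> x; exact: (@scaler_continuous _ _ c x).
have ds : differentiable L z := linear_differentiable z cL.
have dE : 'd L z = L :> (Cn -> Cn) := diff_lin z cL.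
split; first exact: (differentiable_comp ds df).
move=> h; rewrite !dderE.
have E := congr1 (fun F => F h) (diff_comp ds df).
have E' := congr1 (fun F : Cn -> Cn => F h) dE.
exact: (etrans E (congr1 ('d f (L z)) E')).
Qed.

End rays.

(** * Holomorphy of the integral operator *)

Section riemann_sums.
Variable R : realType.
Local Notation mu := (@lebesgue_measure R).

Lemma cint_cst (a b : R) (c : R[i]) : a <= b -> cint a b (fun=> c) = (b - a)%:C * c.
Proof.
move=> ab; have H (r : R) : \int[mu]_(t in `[a, b]) r = (b - a) * r.
  by have := integral_cst_segment r%:E ab; rewrite /Rintegral => ->; rewrite mulrC.
by rewrite /cint !H; case: c => x y; simpc.
Qed.

Lemma cintegrable_cst (a b : R) (c : R[i]) : cintegrable a b (fun=> c).
Proof.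
apply: ccontinuous_integrable => t _ e e0; exists 1; first exact: ltr01.
by move=> s _ _; rewrite subrr Normc.normc0; exact: ltW.
Qed.

(** Each of the m + 1 pieces contributes an error of at most L / (m + 1)^2. *)
Lemma riemann_sum (h : R -> R[i]) (L : R) : 0 <= L ->
  (forall s t, 0 <= s <= 1 -> 0 <= t <= 1 -> normc (h s - h t) <= L * `|s - t|) ->
  ccvg \oo (fun m : nat => (m.+1%:R^-1 : R)%:C * \sum_(j < m.+1) h (j%:R / m.+1%:R))
    (cint 0 1 h).
Proof.
move=> L0 hL.
have ih : cintegrable 0 1 h.
  apply: ccontinuous_integrable => t t01 e e0; exists (e / (L + 1)).
    by rewrite divr_gt0// ltr_wpDl.
  move=> s s01; rewrite ltr_pdivlMr ?ltr_wpDl// => st.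
  apply: le_trans (hL _ _ s01 t01) _; apply: le_trans (ltW st).
  by rewrite mulrC ler_wpM2l// lerDl.
have piece a b : 0 <= a -> a <= b -> b <= 1 ->
    normc (cint a b h - (b - a)%:C * h a) <= L * (b - a) * (b - a).
  move=> a0 ab b1; have ihab : cintegrable a b h by exact: cintegrableS ih.
  rewrite -cint_cst// -cintB//; last exact: cintegrable_cst.
  apply: normc_cint_le => //.
    rewrite (_ : (fun t => _) = (fun t => h t + -1 * h a)); last first.
      by apply/funext => t; rewrite mulN1r.
    by apply: cintegrableD => //; exact: cintegrable_cst.
  move=> t /andP[at_ tb]; apply: le_trans (hL _ _ _ _) _.
  - by rewrite (le_trans a0 at_) (le_trans tb b1).
  - by rewrite a0 (le_trans ab b1).
  by rewrite ger0_norm ?subr_ge0// ler_wpM2l// lerD2r.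
move=> e e0; have e1 : 0 < e / (L + 1) by rewrite divr_gt0// ltr_wpDl.
near=> m; have mN : m.+1%:R^-1 < e / (L + 1) by near: m; exact: natSinv_cvg.
set N : R := m.+1%:R in mN *.
have N0 : 0 < N by rewrite ltr0n.
have step (j : nat) : (j <= m.+1)%N ->
    normc (N^-1%:C * (\sum_(i < j) h (i%:R / N)) - cint 0 (j%:R / N) h) <=
    j%:R * (L * N^-1 * N^-1).
  elim: j => [_|j IH jm].
    by rewrite big_ord0 mulr0 !mul0r cint_point subrr Normc.normc0.
  have j1 : j.+1%:R / N <= 1 by rewrite ler_pdivrMr// mul1r ler_nat.
  have j0 : 0 <= j%:R / N by rewrite divr_ge0// ltW.
  have jj : j%:R / N <= j.+1%:R / N.
    by apply: ler_wpM2r; [rewrite invr_ge0 ltW|rewrite ler_nat].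
  rewrite big_ord_recr/= (@cint_cat _ 0 (j%:R / N))//; last first.
    by apply: cintegrableS ih.
  have P := piece _ _ j0 jj j1.
  have dE : j.+1%:R / N - j%:R / N = N^-1.
    by rewrite -mulrBl -natrB ?leqnSn// subSnn mul1r.
  rewrite dE in P; rewrite mulrDr opprD addrACA.
  apply: le_trans (le_normcD _ _) _.
  have -> : j.+1%:R * (L * N^-1 * N^-1) = j%:R * (L * N^-1 * N^-1) + L * N^-1 * N^-1.
    by rewrite -[j.+1]addn1 natrD mulrDl mul1r.
  by apply: lerD; [exact: IH (ltnW jm)|rewrite normc_distC].
have := step m.+1 (leqnn _); rewrite -/N divff ?gt_eqF// => h1; apply: le_trans h1 _.
have -> : N * (L * N^-1 * N^-1) = L * N^-1 by field; rewrite gt_eqF.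
have : L * N^-1 <= L * (e / (L + 1)) by rewrite ler_wpM2l// ltW.
move=> h2; apply: le_trans h2 _; rewrite mulrA ler_pdivrMr ?ltr_wpDl//; nra.
Unshelve. all: by end_near. Qed.

End riemann_sums.

Section Cg_holomorphic.
Variables (R : realType) (n : nat) (Omega : set 'rV[R[i]]_n) (rho D : R).
Local Notation Cn := 'rV[R[i]]_n.
Hypothesis dom : bounded_convex_domain Omega rho D.
Implicit Types (f g : Cn -> R[i]) (z w v h : Cn).

Let oO := domain_open dom.
Let rho0 := domain_rho dom.
Let gZ := gaugeZ (domain_convex dom) (domain_rho dom) (domain_cball dom).
Let g0 := gauge_ge0 (domain_rho dom) (domain_cball dom).
Let gO := domain_gauge (domain_open dom) (domain_convex dom) (domain_rho dom) (domain_cball dom).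
Let gB := domain_ball (domain_open dom) (domain_convex dom) (domain_rho dom) (domain_cball dom).
Let gL := gauge_lipschitz (domain_convex dom) (domain_rho dom) (domain_cball dom).
Let sO := domain_scale (domain_open dom) (domain_convex dom) (domain_rho dom) (domain_cball dom).

(** For v = z and w = t z this is the integrand of the operator; v and w are kept apart
    so that w can range over a ball while v is fixed. *)
Definition kern f g v w : R[i] := dder f w v * g w.

Lemma kern_holomorphic f g v : holomorphic_on Omega f -> holomorphic_on Omega g ->
  holomorphic_on Omega (kern f g v).
Proof.
move=> hf hg z Oz; apply: differentiable_mul; last exact: hg.
exact: (holomorphic_dder v oO hf Oz).
Qed.

Lemma kern_ray f g z : holomorphic_on Omega f -> holomorphic_on Omega g -> Omega z ->
  forall t, 0 <= t <= 1 -> ccontinuous_at (fun t => kern f g z (t%:C *: z)) t.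
Proof.
move=> hf hg Oz t t01; apply: (@ray_continuous _ _ (kern f g z)).
by apply: kern_holomorphic => //; exact: sO.
Qed.

(** The factor t of the radial derivative cancels the weight of the integral. *)
Lemma CgE f g z : holomorphic_on Omega f -> holomorphic_on Omega g -> Omega z ->
  Cg g f z = cint 0 1 (fun t => kern f g z (t%:C *: z)).
Proof.
move=> hf hg Oz; apply: eq_cint_oc.
  by apply: ccontinuous_integrable; apply: ccontinuous_at_on; exact: kern_ray.
move=> t /andP[t0 t1]; have tO : Omega (t%:C *: z) by apply: sO => //; rewrite ltW.
rewrite radial_derivativeE; last exact: hf.
have tn0 : t%:C != 0 :> R[i] by rewrite eq_complex/= gt_eqF.
by rewrite dderZ /kern -mulrA [_ * t%:C^-1]mulrC mulrACA divff// mul1r.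
Qed.

Definition interior_bounded f := forall r : R, 0 < r -> exists C : R, forall z,
  cball z r `<=` Omega -> normc (f z) <= C.

(** Segments from 0 to points near z stay away from the boundary by a fixed margin. *)
Lemma tube_radius z w h (t : R) : Omega z -> 0 <= t <= 1 ->
  cball z ((1 - gauge Omega z) * rho / 4) w ->
  rnorm h < (1 - gauge Omega z) * rho / 4 * 2 -> Omega (t%:C *: w + h).
Proof.
move=> Oz /andP[t0 t1] wz hh; apply: gB; rewrite gZ//.
have gz : gauge Omega z < 1 by apply/gO.
have := gL w z; rewrite ler_norml => /andP[_ h1].
have h2 : rnorm (w - z) / rho < (1 - gauge Omega z) / 4.
  by rewrite ltr_pdivrMr//; move: wz; rewrite /cball/=; lra.
have tg : t * gauge Omega w <= gauge Omega w by have := g0 w; nra.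
have h3 : (1 - gauge Omega z) / 2 <= 1 - t * gauge Omega w by lra.
apply: lt_le_trans hh _; apply: le_trans (ler_wpM2r (ltW rho0) h3); lra.
Qed.

Lemma differentiable_bigsum (J : Type) (s : seq J) (F : J -> Cn -> R[i]) z :
  (forall j, differentiable (F j) z) -> differentiable (fun w => \sum_(j <- s) F j w) z.
Proof.
move=> H; elim: s => [|j s IH].
  rewrite (_ : (fun w => _) = cst 0); first exact: differentiable_cst.
  by apply/funext => w; rewrite big_nil.
rewrite (_ : (fun w => _) = (fun w => F j w + \sum_(i <- s) F i w)).
  exact: differentiable_add.
by apply/funext => w; rewrite big_cons.
Qed.

Lemma differentiable_kern_scale f g z (t : R) : holomorphic_on Omega f ->
  holomorphic_on Omega g -> Omega (t%:C *: z) ->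
  differentiable (fun w => kern f g w (t%:C *: w)) z.
Proof.
move=> hf hg Oz.
rewrite (_ : (fun w => _) = (fun w => (\sum_k w 0 k * dder f (t%:C *: w) (delta_mx 0 k))
     * g (t%:C *: w))); last first.
  by apply/funext => w; rewrite /kern dder_coord.
apply: differentiable_mul; last exact: (differentiable_scale (hg _ Oz)).1.
apply: differentiable_bigsum => k; apply: differentiable_mul.
  exact: differentiable_coord.
exact: (differentiable_scale (holomorphic_dder (delta_mx 0 k) oO hf Oz)).1.
Qed.

(** The integral defining the operator is a limit of Riemann sums, which are
    holomorphic and locally bounded. *)
Lemma Cg_holomorphic f g : holomorphic_on Omega f -> holomorphic_on Omega g ->
  interior_bounded f -> interior_bounded g -> holomorphic_on Omega (Cg g f).
Proof.
move=> hf hg bf bg z Oz; pose s := (1 - gauge Omega z) * rho / 4.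
have s0 : 0 < s.
  by rewrite /s divr_gt0// mulr_gt0// subr_gt0; apply/gO.
have [C hC] := bf s s0; have [C' hC'] := bg s s0.
have tube w (t : R) u : cball z s w -> 0 <= t <= 1 -> cball (t%:C *: w) s u ->
    cball u s `<=` Omega.
  rewrite /cball/= => wz t01 us u' us'.
  rewrite -(subrK (t%:C *: w) u') addrC; apply: tube_radius Oz t01 wz _.
  have -> : u' - t%:C *: w = (u' - u) + (u - t%:C *: w) by rewrite addrA subrK.
  apply: le_lt_trans (le_rnormD _ _) _; rewrite -/s.
  by rewrite mulr_natr mulr2n; exact: ltrD us' us.
have fb w (t : R) : cball z s w -> 0 <= t <= 1 -> holo_bounded f (t%:C *: w) s C.
  move=> wz t01 u us; have sub := tube w t u wz t01 us.
  by split; [apply: hf; apply: sub; exact: cball_center|exact: hC].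
have gb w (t : R) : cball z s w -> 0 <= t <= 1 -> holo_bounded g (t%:C *: w) s C'.
  move=> wz t01 u us; have sub := tube w t u wz t01 us.
  by split; [apply: hg; apply: sub; exact: cball_center|exact: hC'].
have tO w (t : R) : cball z s w -> 0 <= t <= 1 -> Omega (t%:C *: w).
  by move=> wz t01; apply: (tube w t (t%:C *: w)) => //; exact: cball_center.
have wO w : cball z s w -> Omega w.
  by move=> wz; have := tO w 1 wz; rewrite rmorph1 scale1r lexx ler01; exact.
have h01 : 0 <= (1 : R) <= 1.
  by rewrite ler01 lexx.
have C0 := holo_bounded_ge0 s0 (fb z 1 (cball_center z s0) h01).
have C'0 := holo_bounded_ge0 s0 (gb z 1 (cball_center z s0) h01).
have D0 : 0 <= D := le_trans (rnorm_ge0 z) (domain_bound dom Oz).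
have s20 : 0 < s / 2 by rewrite divr_gt0.
pose B := 16 * C * D / (s / 2) * C'.
have B0 : 0 <= B by rewrite mulr_ge0// divr_ge0 ?(ltW s20)// !mulr_ge0.
have kb w (t : R) v : cball z s w -> 0 <= t <= 1 -> rnorm v <= D ->
    holo_bounded (kern f g v) (t%:C *: w) (s / 2) B.
  move=> wz t01 vD u us; have us1 : cball (t%:C *: w) s u by apply: cball_le us; lra.
  have sub := tube w t u wz t01 us1.
  split; first by apply: kern_holomorphic => //; apply: sub; exact: cball_center.
  rewrite Normc.normcM; apply: ler_pM; rewrite ?normc_ge0//; last exact: hC'.
  have hb : holo_bounded f u (s / 2) C.
    apply: holo_bounded_sub (fb w t wz t01); move: us; rewrite /cball/=; lra.
  apply: le_trans (cauchy_estimate v s20 hb) _.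
  by rewrite ler_wpM2r ?invr_ge0 ?(ltW s20)// ler_wpM2l// mulr_ge0.
pose S (m : nat) w : R[i] := (m.+1%:R^-1 : R)%:C *
   \sum_(j < m.+1) kern f g w ((j%:R / m.+1%:R : R)%:C *: w).
have tj m (j : 'I_m.+1) : 0 <= (j%:R / m.+1%:R : R) <= 1.
  by rewrite divr_ge0//= ler_pdivrMr// mul1r ler_nat ltnW.
apply: (@limit_differentiable R n nat \oo S (Cg g f) z s B) => //.
  apply: nearW => m w wz; split.
    apply: (@differentiable_mul _ _ (fun=> (m.+1%:R^-1 : R)%:C)).
      exact: differentiable_cst.
    apply: differentiable_bigsum => j; apply: differentiable_kern_scale => //.
    exact: tO.
  rewrite /S Normc.normcM normcR ger0_norm ?invr_ge0//.
  rewrite mulrC ler_pdivrMr//; apply: le_trans (normc_sum _ _) _.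
  apply: le_trans (_ : \sum_(j < m.+1) B <= _).
    apply: ler_sum => j _.
    apply: (kb w _ w wz (tj m j) (domain_bound dom (wO _ wz)) _ _).2.
    exact: cball_center.
  by rewrite sumr_const card_ord mulr_natr.
move=> w wz; have Ow := wO w wz; have wD := domain_bound dom Ow.
rewrite CgE//; apply: (@riemann_sum _ (fun t => kern f g w (t%:C *: w)) (16 * B * D / (s / 2))).
  apply: divr_ge0; last exact: ltW.
  by apply: mulr_ge0 => //; exact: mulr_ge0.
move=> a b a01 b01.
apply: (@mean_value_segment _ _ (kern f g w) (b%:C *: w) (a%:C *: w)) => t t01;
  have ab01 : 0 <= b + t * (a - b) <= 1 by (move: a01 b01 t01 => /andP[? ?] /andP[? ?] /andP[? ?]; nra).
- have -> : b%:C *: w + t%:C *: (a%:C *: w - b%:C *: w) = (b + t * (a - b))%:C *: w.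
    by rewrite -scalerBl scalerA -scalerDl -rmorphB -rmorphM -rmorphD.
  by apply: kern_holomorphic => //; exact: tO.
have -> : b%:C *: w + t%:C *: (a%:C *: w - b%:C *: w) = (b + t * (a - b))%:C *: w.
  by rewrite -scalerBl scalerA -scalerDl -rmorphB -rmorphM -rmorphD.
apply: le_trans (cauchy_estimate _ s20 (kb w _ w wz ab01 wD)) _.
rewrite -scalerBl -rmorphB/= rnormZ normcR.
rewrite [leRHS]mulrAC ler_wpM2r ?invr_ge0 ?(ltW s20)//.
rewrite [leRHS](_ : _ = 16 * B * (`|a - b| * D)); last by ring.
by apply: ler_wpM2l; [rewrite mulr_ge0|rewrite ler_wpM2l].
Qed.

End Cg_holomorphic.

(** * Integration by parts *)

Section Cg_estimate.
Variables (R : realType) (n : nat) (Omega : set 'rV[R[i]]_n) (rho D : R).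
Local Notation Cn := 'rV[R[i]]_n.
Local Notation mu := (@lebesgue_measure R).
Local Notation T1 := (measurableTypeR R).
Local Notation A := (`[0%R, (2^-1)%R]%classic : set T1).
Hypothesis dom : bounded_convex_domain Omega rho D.
Implicit Types (f g : Cn -> R[i]) (z w v h : Cn).

Let oO := domain_open dom.
Let rho0 := domain_rho dom.
Let gZ := gaugeZ (domain_convex dom) (domain_rho dom) (domain_cball dom).
Let g0 := gauge_ge0 (domain_rho dom) (domain_cball dom).
Let gO := domain_gauge (domain_open dom) (domain_convex dom) (domain_rho dom) (domain_cball dom).
Let gB := domain_ball (domain_open dom) (domain_convex dom) (domain_rho dom) (domain_cball dom).
Let sO := domain_scale (domain_open dom) (domain_convex dom) (domain_rho dom) (domain_cball dom).

Lemma measurable_ray z : measurable_fun setT (fun t : T1 => t%:C *: z : borel_Cn R n).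
Proof.
pose x : (n + n).-tuple T1 := [tuple match fintype.split k with
  | inl l => complex.Re (z 0 l) | inr l => complex.Im (z 0 l) end | k < n + n].
have zE : z = Cn_of_tuple x.
  apply/rowP => k; rewrite mxE !tnth_mktuple (unsplitK (inl _)) (unsplitK (inr _)).
  by case: (z 0 k).
have -> : (fun t : T1 => t%:C *: z : borel_Cn R n) = @Cn_of_tuple R n \o (fun t => tuple_scale t x).
  by apply/funext => t; rewrite zE /= Cn_of_tuple_scale.
apply: measurableT_comp; first exact: measurable_Cn_of_tuple.
apply/measurable_fun_tnthP => k.
rewrite (_ : _ \o _ = (fun t : T1 => t * tnth x k : T1)); last first.
  by apply/funext => t; rewrite /= tnth_mktuple.
exact: measurable_funM.
Qed.

(** Cauchy's estimate for g on the ball given by [domain_ball]. *)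
Lemma kern_le f g (M : R) z (t : R) : 0 <= M -> holomorphic_on Omega g ->
  (forall w, Omega w -> normc (g w) <= M) -> Omega z -> 0 <= t <= 1 ->
  normc (kern g f z (t%:C *: z)) <=
  16 * M * D / rho * (normc (f (t%:C *: z)) / (1 - t * gauge Omega z)).
Proof.
move=> M0 hg gM Oz t01; have [t0 t1] := andP t01.
have gz : gauge Omega z < 1 by apply/gO.
have d0 : 0 < 1 - t * gauge Omega z by have := g0 z; nra.
have r0 : 0 < (1 - t * gauge Omega z) * rho by rewrite mulr_gt0.
have hb : holo_bounded g (t%:C *: z) ((1 - t * gauge Omega z) * rho) M.
  move=> u uz; have Ou : Omega u.
    rewrite -(subrK (t%:C *: z) u) addrC; apply: gB; rewrite gZ//.
  by split; [exact: hg|exact: gM].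
have est := cauchy_estimate z r0 hb.
have D0 : rnorm z <= D := domain_bound dom Oz.
have e2 : normc (dder g (t%:C *: z) z) <= 16 * M * D / rho / (1 - t * gauge Omega z).
  apply: le_trans est _; rewrite [(1 - _) * rho]mulrC invfM mulrA.
  rewrite ler_wpM2r ?invr_ge0 ?(ltW d0)// ler_wpM2r ?invr_ge0 ?(ltW rho0)//.
  by rewrite ler_wpM2l// mulr_ge0.
by rewrite Normc.normcM mulrA mulrAC ler_wpM2r ?normc_ge0.
Qed.

(** Integration by parts: the derivative of f g along the ray of z is the sum of the
    two kernels. *)
Lemma fg_primitive f g z : holomorphic_on Omega f -> holomorphic_on Omega g -> Omega z ->
  Cg g f z = f z * g z - f 0 * g 0 - cint 0 1 (fun t => kern g f z (t%:C *: z)).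
Proof.
move=> hf hg Oz; rewrite (CgE dom hf hg Oz).
have c1 := kern_ray dom hf hg Oz; have c2 := kern_ray dom hg hf Oz.
have i1 := ccontinuous_integrable (ccontinuous_at_on c1).
have i2 := ccontinuous_integrable (ccontinuous_at_on c2).
suff S : cint 0 1 (fun t => kern f g z (t%:C *: z)) + cint 0 1 (fun t => kern g f z (t%:C *: z)) =
    f z * g z - f 0 * g 0 by rewrite -S addrK.
rewrite -cintD//.
pose H w := f w * g w.
have hH : holomorphic_on Omega H.
  by move=> w Ow; apply: differentiable_mul; [exact: hf|exact: hg].
have E t : 0 <= t <= 1 -> kern f g z (t%:C *: z) + kern g f z (t%:C *: z) =
    dder H (t%:C *: z) z.
  move=> t01; have Ot := sO t01 Oz.
  rewrite /H dder_mul; [|exact: hf|exact: hg].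
  by rewrite /kern; ring.
rewrite (eq_cint E) (@cint_ftc _ (fun t => H (t%:C *: z))) //.
- by rewrite /H !rmorph1 !rmorph0 scale1r !scale0r.
- by move=> t t01; apply: is_derive_ray; apply: hH; exact: sO.
move=> t t01; apply: (@ray_continuous _ _ (fun w => dder H w z)).
by apply: (holomorphic_dder z oO hH); exact: sO.
Qed.

(** After integration by parts the derivative falls on g, where it costs a factor
    1 / (1 - t N z) with N the gauge. For t <= 1/2 the values of f are taken in the
    compact part of the domain, where they are bounded by B; for t >= 1/2,
    1 - t N z is at least half of s + (1 - N z) with s = 1 - t. *)
Lemma Cg_estimate f g (M B : R) z : 0 <= M -> holo0 Omega f -> holomorphic_on Omega g ->
  (forall w, Omega w -> normc (g w) <= M) ->
  (forall w, gauge Omega w <= 2^-1 -> normc (f w) <= B) -> Omega z ->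
  ((normc (Cg g f z))%:E <=
   (M * normc (f z) + (M * B + 16 * M * D / rho * B))%:E +
   (2 * (16 * M * D / rho))%:E * radial_hardy Omega f z)%E.
Proof.
have inv_le2 (x : R) : x <= 2^-1 -> (1 - x)^-1 <= 2.
  by move=> hx; rewrite -[leRHS]invrK lef_pV2 ?posrE; lra.
have weight_le (x t : R) : 0 <= x < 1 -> 2^-1 <= t <= 1 ->
    (1 - t * x)^-1 <= 2 * (1 - t + (1 - x))^-1.
  move=> /andP[x0 x1] /andP[t0 t1].
  by rewrite -[X in _ <= X * _]invrK -invfM lef_pV2 ?posrE; nra.
have reflect_half (t : R) : (0 <= 1 - t <= 2^-1) = (2^-1 <= t <= 1).
  by apply/idP/idP => /andP[? ?]; apply/andP; split; lra.
move=> M0 [hf f0] hg gM fB Oz; set c := 16 * M * D / rho.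
have D0 : 0 <= D := le_trans (rnorm_ge0 z) (domain_bound dom Oz).
have c0 : 0 <= c by rewrite divr_ge0 ?(ltW rho0)// !mulr_ge0.
have gz : gauge Omega z < 1 by apply/gO.
have O0 : Omega 0 by apply: (domain_cball dom); rewrite rnorm0.
have gauge0 : gauge Omega 0 = 0 by rewrite -(scale0r z) -[0 in LHS](rmorph0 (real_complex R)) gZ// mul0r.
have fB0 : normc (f 0) <= B by apply: fB; rewrite gauge0; lra.
have B0 : 0 <= B := le_trans (normc_ge0 _) fB0.
have c2 := kern_ray dom hg hf Oz.
set k := fun t : R => kern g f z (t%:C *: z).
have ik : cintegrable 0 1 k := ccontinuous_integrable (ccontinuous_at_on c2).
have hl : (0 : R) <= 2^-1 by rewrite invr_ge0.
have hr : (2^-1 : R) <= 1 by lra.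
have i1 : cintegrable 0 2^-1 k by exact: cintegrableS ik.
have i2 : cintegrable 2^-1 1 k by exact: cintegrableS ik.
have kle t : 0 <= t <= 1 -> normc (k t) <= c * (normc (f (t%:C *: z)) / (1 - t * gauge Omega z)).
  by move=> t01; exact: kern_le.
clearbody c.
have part1 : normc (cint 0 2^-1 k) <= c * B.
  have -> : c * B = 2 * c * B * (2^-1 - 0) by lra.
  apply: normc_cint_le => // t /andP[t0 t1].
  have t01 : 0 <= t <= 1 by lra.
  apply: le_trans (kle t t01) _; rewrite [2 * c]mulrC -mulrA ler_wpM2l//.
  have tg : t * gauge Omega z <= 2^-1 by have := g0 z; nra.
  rewrite mulrC; apply: ler_pM; rewrite ?normc_ge0 ?invr_ge0 ?subr_ge0; [lra|by []| |].
    exact: inv_le2.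
  by apply: fB; rewrite gZ.
pose q (s : T1) : R := normc (f ((1 - s)%:C *: z)) / `|s + (1 - gauge Omega z)|.
have q0 s : 0 <= q s by rewrite divr_ge0 ?normc_ge0.
have mq : measurable_fun setT (q : T1 -> T1).
  apply: measurable_funM.
    apply: (measurableT_comp (holo0_measurable (conj hf f0))).
    apply: (measurableT_comp (measurable_ray z)); exact: measurable_funB.
  rewrite (_ : (fun x => _) = (fun s : T1 => `|s + (1 - gauge Omega z)| `^ (-1) : T1)); last first.
    by apply/funext => y; rewrite powR_inv1.
  apply: (@measurableT_comp _ _ _ _ _ _ (@powR R ^~ (-1))); first exact: measurable_powR.
  by apply: measurableT_comp => //; exact: measurable_funD.
have part2 : ((normc (cint 2^-1 1 k))%:E <= (2 * c)%:E * radial_hardy Omega f z)%E.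
  apply: (@le_trans _ _ (\int[mu]_(t in `[(2^-1)%R, 1%R]) (normc (k t))%:E)%E).
    have := normc_cint i2; rewrite -lee_fin /Rintegral fineK//.
    by have /integrable_fin_num := cintegrable_normc i2; apply; exact: measurable_itv.
  have mqr : measurable_fun setT (fun t : T1 => (q (1 - t))%:E).
    by apply/measurable_EFinP; apply: measurableT_comp => //; exact: measurable_funB.
  apply: (@le_trans _ _ (\int[mu]_(t in `[(2^-1)%R, 1%R]) ((2 * c)%:E * (q (1 - t))%:E))%E).
    apply: ge0_le_integral => //.
    - by move=> t _; rewrite lee_fin normc_ge0.
    - exact: (measurable_int mu (cintegrable_normc i2)).
    - by apply: measurable_funTS; exact: measurable_funeM.
    move=> t; rewrite /= in_itv/= => /andP[t0 t1]; rewrite -EFinM lee_fin.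
    have t01 : 0 <= t <= 1 by lra.
    apply: le_trans (kle t t01) _; rewrite [2 * c]mulrC -mulrA ler_wpM2l//.
    rewrite /q subKr mulrCA ler_wpM2l ?normc_ge0//.
    rewrite gtr0_norm; last by lra.
    by apply: weight_le; rewrite ?g0 ?t0.
  rewrite ge0_integralZl_EFin//; last 3 first.
  - by move=> t _; rewrite lee_fin.
  - exact: measurable_funTS.
  - by rewrite mulr_ge0.
  apply: lee_wpmul2l; first by rewrite lee_fin mulr_ge0.
  pose Q : T1 -> \bar R := (fun s => (q s)%:E) \_ A.
  have mQ : measurable_fun setT Q.
    apply: (measurable_restrictT _ (measurable_itv _)).1; apply: measurable_funTS.
    exact/measurable_EFinP.
  have Q0 s : (0 <= Q s)%E by rewrite /Q patchE; case: ifP => // _; rewrite lee_fin.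
  rewrite /radial_hardy [leRHS]integral_mkcond -/Q -(integral_reflect 1 mQ Q0).
  rewrite integral_mkcond le_eqVlt; apply/orP; left; apply/eqP.
  apply: eq_integral => t _; rewrite /Q !patchE; congr (if _ then _ else _).
  by apply/idP/idP; rewrite !inE/= !in_itv/= reflect_half.
rewrite (fg_primitive hf hg Oz) -/k (cint_cat hl hr ik).
apply: (@le_trans _ _ ((normc (f z * g z) + normc (f 0 * g 0) + normc (cint 0 2^-1 k))%:E
   + (normc (cint 2^-1 1 k))%:E)%E).
  rewrite -EFinD lee_fin -[leRHS]addrA.
  apply: le_trans (le_normcB _ _) _; apply: lerD; first exact: le_normcB.
  exact: le_normcD.
apply: leeD => //; rewrite lee_fin addrA; apply: lerD => //; apply: lerD.
  by rewrite Normc.normcM mulrC ler_wpM2r ?normc_ge0// gM.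
by rewrite Normc.normcM mulrC; apply: ler_pM; rewrite ?normc_ge0// gM.
Qed.

End Cg_estimate.

(** * Radial derivative of the operator *)

Section commutation.
Variables (R : realType) (n : nat) (Omega : set 'rV[R[i]]_n) (rho D : R).
Local Notation Cn := 'rV[R[i]]_n.
Local Notation mu := (@lebesgue_measure R).
Hypothesis dom : bounded_convex_domain Omega rho D.
Implicit Types (f g : Cn -> R[i]) (z w v h : Cn).

Let gZ := gaugeZ (domain_convex dom) (domain_rho dom) (domain_cball dom).
Let g0 := gauge_ge0 (domain_rho dom) (domain_cball dom).
Let gO := domain_gauge (domain_open dom) (domain_convex dom) (domain_rho dom) (domain_cball dom).

Lemma ray_margin z : Omega z -> exists2 e : R, 0 < e & forall t : R,
  - e <= t <= 1 + e -> Omega (t%:C *: z).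
Proof.
move=> Oz; have gz : gauge Omega z < 1 by apply/gO.
have gz0 := g0 z; have gN0 := g0 (- z).
pose e1 := (1 - gauge Omega z) / 2; pose e2 := (gauge Omega (- z) + 1)^-1.
have e10 : 0 < e1 by rewrite divr_gt0// subr_gt0.
have e20 : 0 < e2 by rewrite invr_gt0 ltr_wpDl.
exists (Num.min e1 e2); first by rewrite lt_min e10.
move=> t /andP[t1 t2]; apply/gO.
have [t0|t0] := leP 0 t.
  have te : t <= 1 + e1 by apply: le_trans t2 _; rewrite lerD2l ge_min lexx.
  rewrite gZ//; move: te; rewrite /e1; nra.
have te : - t <= e2 by rewrite lerNl; apply: le_trans t1; rewrite lerN2 ge_min lexx orbT.
have -> : t%:C *: z = (- t)%:C *: (- z) by rewrite rmorphN scaleNr scalerN opprK.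
rewrite gZ ?oppr_ge0 ?(ltW t0)//.
apply: le_lt_trans (ler_wpM2r gN0 te) _.
by rewrite /e2 mulrC ltr_pdivrMr ?ltr_wpDl// mul1r ltrDl.
Qed.

(** The fundamental theorem of calculus for complex-valued integrands. *)
Lemma cint_derive (k : R -> R[i]) (a u s : R) : a < s -> s < u ->
  (forall t, a <= t <= u -> ccontinuous_at k t) ->
  is_derive s 1 (fun s => complex.Re (cint a s k)) (complex.Re (k s)) /\
  is_derive s 1 (fun s => complex.Im (cint a s k)) (complex.Im (k s)).
Proof.
move=> as_ su ck; have ik := ccontinuous_integrable (ccontinuous_at_on ck).
have [c1 c2] := ccontinuous_at_part (ck s ltac:(by rewrite !ltW)).
have [d1 e1] := continuous_FTC1_closed su ik.1 as_ c1.
have [d2 e2] := continuous_FTC1_closed su ik.2 as_ c2.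
split; first by apply: (DeriveDef d1); rewrite -derive1E; exact: e1.
by apply: (DeriveDef d2); rewrite -derive1E; exact: e2.
Qed.

(** On the ray of z, F (s z) is the integral from 0 to s of k t = D f (t z)(z) g (t z), and
    its derivative at s = 1 is k 1. The primitive P of k starts at - e rather than 0
    because the change of variable uses its derivative on the closed segment. *)
Lemma Cg_radial f g F z : holomorphic_on Omega f -> holomorphic_on Omega g ->
  holomorphic_on Omega F -> (forall w, Omega w -> F w = Cg g f w) -> Omega z ->
  dder F z z = g z * dder f z z.
Proof.
move=> hf hg hF FE Oz.
have [e e0 eO] := ray_margin Oz.
pose k (t : R) := kern f g z (t%:C *: z).
have ck t : - e <= t <= 1 + e -> ccontinuous_at k t.
  move=> te; apply: (@ray_continuous _ _ (kern f g z)).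
  by apply: (kern_holomorphic dom) => //; exact: eO.
pose P (s : R) := cint (- e) s k.
have dP s : - e < s -> s < 1 + e ->
    is_derive s 1 (fun s => complex.Re (P s)) (complex.Re (k s)) /\
    is_derive s 1 (fun s => complex.Im (P s)) (complex.Im (k s)).
  by move=> h1 h2; exact: cint_derive h1 h2 ck.
have FP (s : R) : 0 < s -> s < 1 + e -> F (s%:C *: z) = P s - P 0.
  move=> s0 s1; have se t : 0 <= t <= 1 -> - e < t * s /\ t * s < 1 + e.
    by move=> /andP[t0 t1]; split; nra.
  have Os : Omega (s%:C *: z) by apply: eO; lra.
  rewrite FE// (CgE dom hf hg Os).
  have E t : 0 <= t <= 1 -> kern f g (s%:C *: z) (t%:C *: (s%:C *: z)) = s%:C * k (t * s).
    by move=> _; rewrite /k /kern dderZ scalerA -rmorphM mulrA.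
  rewrite (eq_cint E) (@cint_ftc _ (fun t => P (t * s))) ?mul1r ?mul0r//.
    move=> t /se[h1 h2]; have [d1 d2] := dP _ h1 h2.
    have dm : is_derive t 1 (fun t : R => t * s) s.
      have := is_deriveZ s (is_derive_id t (1 : R)).
      rewrite (_ : s \*: id = (fun t : R => t * s)).
        by move=> h; apply: is_derive_eq h _; rewrite -[_ *: _]/(_ * _) mulr1.
      by apply/funext => x; rewrite mulrC.
    have h3 := @is_derive1_comp _ _ (fun t : R => t * s) _ _ _ d1 dm.
    have h4 := @is_derive1_comp _ _ (fun t : R => t * s) _ _ _ d2 dm.
    by split; [apply: is_derive_eq h3 _|apply: is_derive_eq h4 _];
      case: (k (t * s)) => a b /=; ring.
  move=> t t01; apply: ccontinuous_atM.
    by move=> c c0; exists 1; [exact: ltr01|move=> ? _; rewrite subrr Normc.normc0; exact: ltW].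
  move=> c c0; have [h1 h2] := se t t01.
  have [d d0 hd] := ck (t * s) ltac:(by rewrite !ltW) c c0.
  exists (d / s) => [|r]; first by rewrite divr_gt0.
  rewrite ltr_pdivlMr// => rt; apply: hd.
  by rewrite -mulrBl normrM (gtr0_norm s0).
have [p1 p2] := dP 1 ltac:(lra) ltac:(lra).
have O1 : Omega ((1 : R)%:C *: z) by rewrite rmorph1 scale1r.
have [f1 f2] := is_derive_ray (hF _ O1).
have nE : \forall s \near (1 : R), F (s%:C *: z) = P s - P 0.
  apply/nbhs_ballP; exists (Num.min 1 e) => /= [|s]; first by rewrite lt_min ltr01.
  rewrite /ball/= lt_min !ltr_norml => /andP[/andP[h1 h2] /andP[h3 h4]].
  by apply: FP; lra.
rewrite rmorph1 scale1r in f1 f2.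
have k1 : k 1 = g z * dder f z z by rewrite /k rmorph1 scale1r /kern mulrC.
rewrite -k1.
have part (H : R[i] -> R) : (forall x y, H (x - y) = H x - H y) ->
    is_derive (1 : R) 1 (fun s : R => H (F (s%:C *: z))) (H (dder F z z)) ->
    is_derive (1 : R) 1 (fun s : R => H (P s)) (H (k 1)) ->
    H (dder F z z) = H (k 1).
  move=> HB h1 h2; have h3 := is_deriveB h1 h2.
  have h4 : is_derive (1 : R) 1 (cst (- H (P 0))) (H (dder F z z) - H (k 1)).
    apply: near_eq_is_derive h3; apply: filterS nE => s sE.
    by rewrite !fctE sE HB; ring.
  have := @derive_val _ _ _ _ _ _ _ h4.
  rewrite derive_cst => /esym/eqP; rewrite subr_eq0 => /eqP; exact.
have := part (@complex.Re R) (fun x y => raddfB _ _ _) f1 p1.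
have := part (@complex.Im R) (fun x y => raddfB _ _ _) f2 p2.
by case: (dder F z z) => a b; case: (k 1) => c d /= -> ->.
Qed.

End commutation.

(** * Bergman spaces: evaluations and dilations *)

Section fatou_sequences.
Context d (X : measurableType d) (R : realType).
Variable nu : {measure set X -> \bar R}.

Lemma fatou_bound (u : nat -> X -> R) (v : X -> R) (b : nat -> R) (beta : R) :
  (forall m, measurable_fun setT (u m)) -> (forall m x, 0 <= u m x) ->
  (forall x, u ^~ x @ \oo --> v x) ->
  (forall m, (\int[nu]_x (u m x)%:E <= (b m)%:E)%E) -> b @ \oo --> beta ->
  (\int[nu]_x (v x)%:E <= beta%:E)%E.
Proof.
move=> mu_ u0 uv ub bb.
have mE m : measurable_fun setT (fun x => (u m x)%:E) by exact/measurable_EFinP.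
have := @fatou _ _ _ nu setT measurableT (fun m x => (u m x)%:E) mE
  (fun m x _ => u0 m x).
rewrite (eq_integral (fun x => (v x)%:E)); last first.
  move=> x _; have h : (fun m => (u m x)%:E) @ \oo --> (v x)%:E by apply: cvg_EFin (uv x); exact: nearW.
  by have [-> _] := cvg_limn_einf_sup h.
move=> h; apply: le_trans h _.
have hb : (fun m => (b m)%:E) @ \oo --> beta%:E by apply: cvg_EFin bb; exact: nearW.
rewrite limn_einf_lim -(cvg_lim _ hb)//; apply: lee_lim.
- exact: is_cvg_einfs.
- by apply/cvg_ex; exists beta%:E.
apply: nearW => m; apply: le_trans (ub m).
by apply: ereal_inf_lbound; exists m => //=.
Qed.

Lemma cvg_powR_seq (u : nat -> R) (l p : R) : 1 <= p -> (forall m, 0 <= u m) -> 0 <= l ->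
  u @ \oo --> l -> (fun m => u m `^ p) @ \oo --> l `^ p.
Proof.
move=> p1 u0; rewrite le_eqVlt => /predU1P[<-|l0] ul.
  rewrite powR0; last by rewrite gt_eqF// (lt_le_trans ltr01).
  apply/cvgrPdist_le => e e0; have e1 : 0 < Num.min 1 e by rewrite lt_min ltr01.
  have /cvgrPdist_le/(_ _ e1) := ul; apply: filterS => m.
  rewrite !sub0r !normrN !ger0_norm ?powR_ge0// le_min => /andP[m1 me].
  apply: le_trans me; have := u0 m; rewrite le_eqVlt => /predU1P[<-|m0].
    by rewrite powR0// gt_eqF// (lt_le_trans ltr01).
  by apply: ge1r_powR => //; rewrite m0.
have cl : {for l, continuous (fun x : R => x `^ p)}.
  apply: differentiable_continuous; apply/derivable1_diffP.
  by have ? := is_derive1_powR p l0; exact: ex_derive.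
exact: (@cvg_comp _ _ _ u (fun x => x `^ p) _ _ _ ul cl).
Qed.

End fatou_sequences.

Lemma differentiable_eq_on (R : realType) (n : nat) (U : set 'rV[R[i]]_n)
    (f g : 'rV[R[i]]_n -> R[i]) z : open U -> U z -> (forall w, U w -> g w = f w) ->
  differentiable f z -> differentiable g z /\ forall h, dder g z h = dder f z h.
Proof.
move=> oU Uz gf df; have cL : continuous ('d f z) by exact: diff_continuous.
have /near_rnormP[d0 d00 hU] : \forall w \near z, U w by exact: open_nbhs_nbhs.
have [e e0|d1 d2] := @epsP_dder _ _ g z ('d f z) cL.
  have [d dp hd] := differentiable_epsP df e0; exists (Num.min d d0); first by rewrite lt_min dp.
  by move=> w; rewrite lt_min => /andP[/hd h /hU Uw]; rewrite !gf.
by split => [|h]; [exact: d1|rewrite d2 dderE].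
Qed.

Section bergman_space.
Variables (R : realType) (n : nat) (Omega : set 'rV[R[i]]_n) (rho D : R).
Local Notation Cn := 'rV[R[i]]_n.
Local Notation lam := (@lebesgue_Cn R n).
Hypothesis dom : bounded_convex_domain Omega rho D.
Variables (oO : open Omega) (p : R) (p1 : 1 < p).
Local Notation A := (bergman oO p1).
Implicit Types (f g : A) (z w v h : Cn).

Let p0 : 0 < p. Proof. exact: lt_trans ltr01 p1. Qed.
Let gO := domain_gauge (domain_open dom) (domain_convex dom) (domain_rho dom) (domain_cball dom).
Let gB := domain_ball (domain_open dom) (domain_convex dom) (domain_rho dom) (domain_cball dom).
Let gZ := gaugeZ (domain_convex dom) (domain_rho dom) (domain_cball dom).
Let g0 := gauge_ge0 (domain_rho dom) (domain_cball dom).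
Let sO := domain_scale (domain_open dom) (domain_convex dom) (domain_rho dom) (domain_cball dom).

Lemma bergman_holo0 f : holo0 Omega f.
Proof. by have [h1 _ h2] := bergmanP _ _ _ (bergman_funP f). Qed.

Lemma bergman_Ip_lty f : (Ip p f < +oo)%E.
Proof. by have [_ h _] := bergmanP _ _ _ (bergman_funP f); apply/Lp_norm_lty. Qed.

Lemma in_bergman (F : Cn -> R[i]) : holo0 Omega F -> (Ip p F < +oo)%E ->
  F \in bergman_pred Omega p.
Proof. by move=> [hF F0] FI; apply/bergmanP; split => //; apply/Lp_norm_lty. Qed.

Lemma bergman_rnorm f : (rnorm f)%:E = Lp_norm p f.
Proof.
have : Lp_norm p f \is a fin_num.
  by rewrite ge0_fin_numE ?Lp_norm_ge0//; apply/Lp_norm_lty => //; exact: bergman_Ip_lty.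
by move=> /fineK => h; rewrite -[RHS]h.
Qed.

Lemma bergman_rnorm_le f (M : R) : 0 <= M ->
  (rnorm f <= M) <-> (Ip p f <= (M `^ p)%:E)%E.
Proof. by move=> M0; rewrite -lee_fin bergman_rnorm; exact: Lp_norm_le. Qed.

Lemma dder_bergmanZ (c : R[i]) f z v : Omega z -> dder (c *: f : A) z v = c * dder f z v.
Proof.
move=> Oz; have df := (bergman_holo0 f).1 z Oz.
rewrite (_ : (c *: f : A) = (fun u => cst c u * f u) :> (Cn -> R[i])); last exact/funext.
rewrite dder_mul; [|exact: differentiable_cst|exact: df].
by rewrite [dder (cst c) _ _]dderE diff_cst mulr0 addr0.
Qed.

Lemma dder_bergmanB f g z v : Omega z -> dder (f - g : A) z v = dder f z v - dder g z v.
Proof.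
move=> Oz; have df := (bergman_holo0 f).1 z Oz; have dg := (bergman_holo0 g).1 z Oz.
by rewrite (_ : (f - g : A) = (fun u => f u - g u) :> (Cn -> R[i])) ?dder_sub//; exact/funext.
Qed.

Lemma homogeneous_bound (Q : A -> R) (C : R) :
  (forall (c : R[i]) f, Q (c *: f) = normc c * Q f) ->
  (forall f, rnorm f <= 1 -> Q f <= C) -> forall f, Q f <= C * rnorm f.
Proof.
move=> QZ QC f; have := rnorm_ge0 f; rewrite le_eqVlt => /predU1P[f0|f0].
  have -> : f = 0 by apply: rnorm_eq0.
  by rewrite rnorm0 mulr0 -(scale0r (0 : A)) QZ Normc.normc0 mul0r.
have h : rnorm ((rnorm f)^-1%:C *: f) <= 1.
  by rewrite rnormZ normcR ger0_norm ?invr_ge0 ?(ltW f0)// mulVf ?gt_eqF.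
have := QC _ h; rewrite QZ normcR ger0_norm ?invr_ge0 ?(ltW f0)//.
by rewrite mulrC ler_pdivrMr.
Qed.

Lemma rnorm_unit f : rnorm f <= 1 -> (Ip p f <= 1%:E)%E.
Proof. by move=> /bergman_rnorm_le-/(_ ler01); rewrite powR1. Qed.

(** Evaluations of derivatives are bounded functionals, by Cauchy's estimate and the
    bound of point evaluations. *)
Lemma dder_bound z v : Omega z -> exists2 C : R, 0 <= C & forall f,
  normc (dder f z v) <= C * rnorm f.
Proof.
move=> Oz; have gz : gauge Omega z < 1 by apply/gO.
pose r := (1 - gauge Omega z) * rho / 2.
have r0 : 0 < r by rewrite divr_gt0// mulr_gt0 ?subr_gt0//; exact: domain_rho dom.
have [C hC] := ball_bound dom 1 p1 r0.
have key f : rnorm f <= 1 -> normc (dder f z v) <= 16 * C * rnorm v / r.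
  move=> /rnorm_unit f1; apply: cauchy_estimate => // w wz.
  have sub : cball w r `<=` Omega.
    move=> u uw; rewrite -(subrK z u) addrC; apply: gB.
    have -> : u - z = (u - w) + (w - z) by rewrite addrA subrK.
    apply: le_lt_trans (le_rnormD _ _) _; move: uw wz; rewrite /cball/= /r; lra.
  split; first by apply: (bergman_holo0 f).1; apply: sub; exact: cball_center.
  exact: hC (bergman_holo0 f) f1 sub.
exists (16 * C * rnorm v / r).
  by apply: le_trans (key 0 _); rewrite ?rnorm0// normc_ge0.
apply: homogeneous_bound => [c f|f]; last exact: key.
by rewrite dder_bergmanZ// Normc.normcM.
Qed.

Definition dilate f (r : R) (z : Cn) : R[i] := if `[< Omega z >] then f (r%:C *: z) else 0.

Lemma dilateE f r z : Omega z -> dilate f r z = f (r%:C *: z).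
Proof. by move=> Oz; rewrite /dilate; case: asboolP. Qed.

Lemma dilate_holo0 f (r : R) : 0 < r <= 1 -> holo0 Omega (dilate f r).
Proof.
move=> /andP[r0 r1]; split => [z Oz|z Oz]; last by rewrite /dilate; case: asboolP.
have Or : Omega (r%:C *: z) by apply: sO => //; rewrite r1 ltW.
have dr := (differentiable_scale ((bergman_holo0 f).1 _ Or)).1.
exact: (differentiable_eq_on oO Oz (fun w => @dilateE f r w) dr).1.
Qed.

Lemma dilate_Ip f (r : R) : 0 < r <= 1 ->
  (Ip p (dilate f r) <= (r ^- (n + n))%:E * Ip p f)%E.
Proof.
move=> r01; apply: le_trans (Ip_dilate p0 r01 (bergman_holo0 f)).
apply: Ip_le; first exact: ltW.
- exact: holo0_measurable (dilate_holo0 f r01).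
- apply: (measurableT_comp (holo0_measurable (bergman_holo0 f))).
  exact: measurable_scale_Cn.
by move=> z; rewrite /dilate; case: asboolP => // _; rewrite Normc.normc0 normc_ge0.
Qed.

Lemma dilate_near_closure f (r : R) : 0 < r < 1 ->
  holomorphic_near_closure Omega (dilate f r).
Proof.
move=> /andP[r0 r1]; exists [set z | Omega (r%:C *: z)], (fun z => f (r%:C *: z)); split.
- apply: (@open_comp _ _ (fun z : Cn => r%:C *: z)) => // z _.
  exact: (@scaler_continuous _ _ r%:C z).
- move=> z cz; apply/gO; rewrite gZ ?(ltW r0)//.
  have := closure_domain_gauge (domain_open dom) (domain_convex dom) (domain_rho dom) (domain_cball dom) cz.
  have := g0 z; nra.
- move=> z Oz; exact: (differentiable_scale ((bergman_holo0 f).1 _ Oz)).1.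
- by move=> z Oz; exact: dilateE.
Qed.

(** Dilations f_r converge to f in norm as r tends to 1, by Fatou's lemma applied to
    2^p (|f_r|^p + |f|^p) - |f_r - f|^p, and they are holomorphic near the closure. *)
Lemma dilate_density f (e : R) : 0 < e -> exists f' : A,
  holomorphic_near_closure Omega f' /\ rnorm (f' - f) <= e.
Proof.
move=> e0.
pose r (m : nat) : R := 1 - m.+2%:R^-1.
have r01 m : 0 < r m < 1.
  by rewrite /r subr_gt0 invf_lt1 ?ltr0n// ltr1n/= gtrBl invr_gt0 ltr0n.
have r01' m : 0 < r m <= 1 by have /andP[-> /ltW ->] := r01 m.
have rc : r @ \oo --> (1 : R).
  apply/cvgrPdist_lt => c c0; have := natSinv_cvg c0; apply: filterS => m.
  apply: le_lt_trans; rewrite /r opprB addrC subrK ger0_norm ?invr_ge0//.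
  by rewrite lef_pV2 ?posrE ?ltr0n// ler_nat.
pose F m := dilate f (r m).
have hF m : holo0 Omega (F m) := dilate_holo0 f (r01' m).
have hf := bergman_holo0 f.
pose I := fine (Ip p f).
have IE : Ip p f = I%:E by rewrite fineK// ge0_fin_numE ?Ip_ge0// bergman_Ip_lty.
have FI m : (Ip p (F m) <= ((r m) ^- (n + n) * I)%:E)%E.
  by rewrite EFinM -IE; exact: dilate_Ip.
have mF m := holo0_measurable (hF m).
have mf := holo0_measurable hf.
have hd m := holo0B (hF m) hf.
have md m := holo0_measurable (hd m).
suff [m hm] : exists m, (Ip p (fun z => F m z - f z)%R <= (e `^ p)%:E)%E.
  have FB : F m \in bergman_pred Omega p.
    by apply: in_bergman => //; apply: le_lt_trans (FI m) _; exact: ltry.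
  exists (Bergman oO p1 FB); split; first exact: dilate_near_closure.
  by apply/bergman_rnorm_le; [exact: ltW|exact: hm].
apply: contrapT => /forallNP H.
have {}H m : ((e `^ p)%:E <= Ip p (fun z => F m z - f z)%R)%E.
  by apply: ltW; rewrite ltNge; apply/negP; exact: H.
pose u (m : nat) (z : borel_Cn R n) : R := 2 `^ p * (normc (F m z) `^ p + normc (f z) `^ p) -
    normc (F m z - f z) `^ p.
pose v (z : borel_Cn R n) : R := 2 `^ p * (normc (f z) `^ p + normc (f z) `^ p).
have mp (G : Cn -> R[i]) : mnormc G -> measurable_fun setT (fun z : borel_Cn R n => normc (G z) `^ p).
  by move=> mG; have /measurable_EFinP := measurable_Ip p mG.
have mfirst m : measurable_fun setT (fun z : borel_Cn R n => 2 `^ p * (normc (F m z) `^ p + normc (f z) `^ p)).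
  by apply: measurable_funM => //; apply: measurable_funD; exact: mp.
have mu_ m : measurable_fun setT (u m).
  by apply: measurable_funB; [exact: mfirst|exact: mp].
have first_int (G : Cn -> R[i]) : mnormc G ->
   (\int[lam]_z (2 `^ p * (normc (G z) `^ p + normc (f z) `^ p))%:E =
    (2 `^ p)%:E * (Ip p G + Ip p f))%E.
  move=> mG.
  under eq_integral do rewrite EFinM EFinD.
  rewrite ge0_integralZl_EFin ?powR_ge0//; last 2 first.
  - by move=> z _; rewrite -EFinD lee_fin addr_ge0 ?powR_ge0.
  - by apply: emeasurable_funD; exact: measurable_Ip.
  apply: (congr1 (fun x => (2 `^ p)%:E * x)%E).
  apply: ge0_integralD => //.
  - by move=> z _; rewrite lee_fin powR_ge0.
  - exact: measurable_Ip.
  - by move=> z _; rewrite lee_fin powR_ge0.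
  - exact: measurable_Ip.
have u0 m z : 0 <= u m z.
  rewrite subr_ge0; apply: le_trans (powR_add_le (normc_ge0 _) (normc_ge0 _) (ltW p0)).
  by apply: ge0_ler_powR; rewrite ?nnegrE ?addr_ge0 ?normc_ge0 ?(ltW p0)// le_normcB.
have Fz z (c : R) : 0 < c -> \forall m \near \oo, normc (F m z - f z) <= c.
  move=> c0; have [Oz|Oz] := pselect (Omega z); last first.
    by apply: nearW => m; rewrite (hF m).2// hf.2// subrr Normc.normc0 ltW.
  have df : differentiable f ((1 : R)%:C *: z) by rewrite rmorph1 scale1r; exact: hf.1.
  have [d d0 hd1] := ray_continuous df c0.
  have /cvgrPdist_lt/(_ _ d0) := rc; apply: filterS => m; rewrite distrC => /hd1.
  by rewrite rmorph1 scale1r /F dilateE.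
have uv z : u ^~ z @ \oo --> v z.
  have c1 : (fun m => normc (F m z)) @ \oo --> normc (f z).
    apply/cvgrPdist_le => c c0; apply: filterS (Fz z c c0) => m h.
    rewrite ler_norml; have h1 := le_normcD (F m z - f z) (f z).
    have h2 := le_normcD (f z - F m z) (F m z).
    rewrite subrK in h1; rewrite subrK normc_distC in h2; lra.
  have c2 : (fun m => normc (F m z - f z)) @ \oo --> (0 : R).
    apply/cvgrPdist_le => c c0; apply: filterS (Fz z c c0) => m h.
    by rewrite sub0r normrN ger0_norm ?normc_ge0.
  have d1 := cvg_powR_seq (ltW p1) (fun m => normc_ge0 _) (normc_ge0 _) c1.
  have d2 := cvg_powR_seq (ltW p1) (fun m => normc_ge0 _) (lexx _) c2.
  rewrite powR0 ?gt_eqF// in d2.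
  rewrite -[v z]subr0; apply: cvgB d2; apply: cvgMr.
  by apply: cvgD d1 _; exact: cvg_cst.
pose b (m : nat) : R := 2 `^ p * ((r m) ^- (n + n) * I + I) - e `^ p.
have ub m : (\int[lam]_z (u m z)%:E <= (b m)%:E)%E.
  have S : (\int[lam]_z (u m z)%:E + Ip p (fun z => F m z - f z)%R =
      (2 `^ p)%:E * (Ip p (F m) + Ip p f))%E.
    rewrite -first_int// -ge0_integralD//.
    - by apply: eq_integral => z _; rewrite -EFinD subrK.
    - by move=> z _; rewrite lee_fin.
    - exact/measurable_EFinP.
    - by move=> z _; rewrite lee_fin powR_ge0.
    - exact: measurable_Ip.
  rewrite /b EFinB leeBrDr//; apply: le_trans (leeD (lexx _) (H m)) _.
  rewrite S EFinM; apply: lee_wpmul2l; first by rewrite lee_fin powR_ge0.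
  by rewrite EFinD IE leeD2r.
have bc : b @ \oo --> 2 `^ p * (I + I) - e `^ p.
  have c1 : (fun m => r m ^+ (n + n)) @ \oo --> (1 : R) ^+ (n + n).
    exact: (@cvg_comp _ _ _ r (fun x => x ^+ (n + n)) _ _ _ rc (@exprn_continuous _ _ 1)).
  rewrite expr1n in c1.
  have c2 : (fun m => r m ^- (n + n)) @ \oo --> (1 : R)^-1 by apply: cvgV => //; exact: oner_neq0.
  rewrite invr1 in c2.
  apply: cvgB; last exact: cvg_cst.
  apply: cvgMr; apply: cvgD; last exact: cvg_cst.
  by rewrite -[X in _ --> X]mul1r; apply: cvgMl.
have := fatou_bound mu_ u0 uv ub bc.
rewrite first_int// IE -EFinD -EFinM lee_fin => h.
by have ep := powR_gt0 p e0; move: h ep; lra.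
Qed.

End bergman_space.

(** * Boundedness for bounded symbols *)

Section volterra_operator.
Variables (R : realType) (n : nat) (Omega : set 'rV[R[i]]_n) (rho D : R).
Local Notation Cn := 'rV[R[i]]_n.
Hypothesis dom : bounded_convex_domain Omega rho D.
Implicit Types (f g : Cn -> R[i]) (z w v h : Cn).

Let oO' := domain_open dom.
Let gB := domain_ball (domain_open dom) (domain_convex dom) (domain_rho dom) (domain_cball dom).
Let sO := domain_scale (domain_open dom) (domain_convex dom) (domain_rho dom) (domain_cball dom).

Definition volterra g f z : R[i] := if `[< Omega z >] then Cg g f z else 0.

Lemma volterraE g f z : Omega z -> volterra g f z = Cg g f z.
Proof. by move=> Oz; rewrite /volterra; case: asboolP. Qed.

Lemma volterra_out g f z : ~ Omega z -> volterra g f z = 0.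
Proof. by move=> Oz; rewrite /volterra; case: asboolP. Qed.

Lemma interior_bounded_Ip (p : R) f : 1 < p -> holo0 Omega f -> (Ip p f < +oo)%E ->
  interior_bounded Omega f.
Proof.
move=> p1 hf foo r r0; have [C hC] := ball_bound dom (fine (Ip p f)) p1 r0.
by exists C => z; apply: hC => //; rewrite fineK// ge0_fin_numE ?Ip_ge0.
Qed.

Lemma interior_bounded_Hinfty g : Hinfty Omega g -> interior_bounded Omega g.
Proof.
by move=> [_ [M hM]] r r0; exists M => z sub; apply: hM; apply: sub; exact: cball_center.
Qed.

Lemma volterra_holo0 (p : R) g f : 1 < p -> Hinfty Omega g -> holo0 Omega f ->
  (Ip p f < +oo)%E -> holo0 Omega (volterra g f).
Proof.
move=> p1 hg hf foo; split => [z Oz|z]; last exact: volterra_out.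
apply: (differentiable_eq_on oO' Oz (@volterraE g f) _).1.
apply: (Cg_holomorphic dom hf.1 hg.1 _ _ Oz); last exact: interior_bounded_Hinfty.
exact: interior_bounded_Ip foo.
Qed.

(** By [Cg_estimate] the values are dominated by the function, its radial averages
    and a constant; Hardy's inequality bounds the averages. *)
Lemma volterra_Ip (p : R) g : 1 < p -> Hinfty Omega g -> exists C : R, forall f,
  holo0 Omega f -> (Ip p f <= 1)%E -> (Ip p (volterra g f) <= C%:E)%E.
Proof.
move=> p1 hg; have [M gM] := hg.2.
have O0 : Omega 0 by apply: (domain_cball dom); rewrite rnorm0; exact: domain_rho dom.
have M0 : 0 <= M := le_trans (normc_ge0 _) (gM 0 O0).
have r0 : 0 < rho / 2 by rewrite divr_gt0//; exact: domain_rho dom.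
have [B hB] := ball_bound dom 1 p1 r0.
have D0 : 0 <= D := le_trans (rnorm_ge0 (0 : Cn)) (domain_bound dom O0).
have c0 : 0 <= 16 * M * D / rho.
  by rewrite divr_ge0 ?(ltW (domain_rho dom))// !mulr_ge0.
pose B' := Num.max B 0; have B'0 : 0 <= B' by rewrite le_max lexx orbT.
have b0 : 0 <= M * B' + 16 * M * D / rho * B' by rewrite addr_ge0// mulr_ge0.
have c20 : 0 <= 2 * (16 * M * D / rho) by rewrite mulr_ge0.
have [C hC] := hardy_Ip dom p1 M0 b0 c20.
exists C => f hf f1; apply: (hC f) => //.
- by apply: holo0_measurable (volterra_holo0 p1 hg hf _); apply: le_lt_trans f1 _; exact: ltry.
- by move=> z; exact: volterra_out.
move=> z Oz; rewrite volterraE//; apply: (Cg_estimate dom M0 hf hg.1 gM) => // w gw.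
rewrite le_max; apply/orP; left; apply: hB => // u; rewrite /cball/= => uw.
rewrite -(subrK w u) addrC; apply: gB; have := domain_rho dom; nra.
Qed.

Lemma Cg_linear g f1 f2 (a : R[i]) z : holomorphic_on Omega g -> holomorphic_on Omega f1 ->
  holomorphic_on Omega f2 -> Omega z ->
  Cg g (fun w => a * f1 w + f2 w) z = a * Cg g f1 z + Cg g f2 z.
Proof.
move=> hg h1 h2 Oz.
have ha : holomorphic_on Omega (fun w => a * f1 w).
  move=> w Ow; apply: (@differentiable_mul _ _ (fun=> a)); first exact: differentiable_cst.
  exact: h1.
have h12 : holomorphic_on Omega (fun w => a * f1 w + f2 w).
  by move=> w Ow; apply: differentiable_add; [exact: ha|exact: h2].
rewrite (CgE dom h12 hg Oz) (CgE dom h1 hg Oz) (CgE dom h2 hg Oz).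
have i1 := ccontinuous_integrable (ccontinuous_at_on (kern_ray dom h1 hg Oz)).
have i2 := ccontinuous_integrable (ccontinuous_at_on (kern_ray dom h2 hg Oz)).
rewrite -cintZ// -cintD//; last exact: cintegrableZ.
apply: eq_cint => t t01; have Ot := sO t01 Oz.
rewrite /kern (dder_add _ (ha _ Ot) (h2 _ Ot)).
rewrite (@dder_mul _ _ (cst a)); [|exact: differentiable_cst|exact: h1].
by rewrite [dder (cst a) _ _]dderE diff_cst mulr0 addr0 mulrDl mulrA.
Qed.

Section extension.
Variables (oO : open Omega) (p q : R) (p1 : 1 < p) (q1 : 1 < q) (g : Cn -> R[i]).
Hypothesis hg : Hinfty Omega g.
Hypothesis qp : q <= p.
Local Notation Ap := (bergman oO p1).
Local Notation Aq := (bergman oO q1).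

Let volterraZ (f : Ap) (c : R[i]) :
  volterra g (c *: f : Ap) = (fun z => c * volterra g f z).
Proof.
apply/funext => z; have [Oz|Oz] := pselect (Omega z); last first.
  by rewrite !volterra_out// mulr0.
have h := bergman_holo0 f.
have h0 : holomorphic_on Omega (fun _ : Cn => (0 : R[i])).
  by move=> w _; exact: differentiable_cst.
have C0 : Cg g (fun _ : Cn => (0 : R[i])) z = 0.
  have E := Cg_linear (-1) hg.1 h0 h0 Oz.
  have Eo : (fun w : Cn => -1 * (0 : R[i]) + 0) = (fun _ => 0).
    by apply/funext => w; rewrite mulr0 addr0.
  by rewrite Eo in E; rewrite [LHS]E mulN1r addNr.
rewrite !volterraE// -[RHS]addr0 -[X in _ + X]C0 -(Cg_linear _ hg.1 h.1 h0 Oz).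
by congr (Cg g _ z); apply/funext => w; rewrite addr0.
Qed.

Let volterra_lty (f : Ap) : (Ip p (volterra g f) < +oo)%E.
Proof.
have [C hC] := volterra_Ip p1 hg.
pose c := (rnorm f + 1)^-1.
have c0 : 0 < c by rewrite invr_gt0 ltr_wpDl ?rnorm_ge0.
have h1 : rnorm (c%:C *: f) <= 1.
  rewrite rnormZ normcR gtr0_norm// mulrC ler_pdivrMr ?ltr_wpDl ?rnorm_ge0//.
  by rewrite mul1r lerDl.
have := hC _ (bergman_holo0 (c%:C *: f)) (rnorm_unit h1).
rewrite volterraZ IpZ; last first.
  exact: holo0_measurable (volterra_holo0 p1 hg (bergman_holo0 f) (bergman_Ip_lty f)).
rewrite normcR gtr0_norm// -lee_pdivlMl ?powR_gt0// => h.
by apply: le_lt_trans h _; rewrite -EFinM ltry.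
Qed.

Let volterra_in (f : Ap) : volterra g f \in bergman_pred Omega q.
Proof.
have hv := volterra_holo0 p1 hg (bergman_holo0 f) (bergman_Ip_lty f).
apply: in_bergman => //.
apply: le_lt_trans (Ip_mono dom (lt_trans ltr01 q1) qp hv) _.
by rewrite lte_add_pinfty// ltry.
Qed.

Let T0 (f : Ap) : Aq := Bergman oO q1 (volterra_in f).

Let T0_linear : linear T0.
Proof.
move=> a f1 f2; apply: val_inj; apply/funext => z /=.
have [Oz|Oz] := pselect (Omega z); last first.
  by rewrite volterra_out// -[RHS]/(a * volterra g f1 z + volterra g f2 z) !volterra_out// mulr0 addr0.
rewrite -[RHS]/(a * volterra g f1 z + volterra g f2 z) !volterraE//.
exact: Cg_linear hg.1 (bergman_holo0 f1).1 (bergman_holo0 f2).1 Oz.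
Qed.

(** The extension is given by the same integral on the whole space. The bound in the
    exponent p, even when the target has the smaller exponent q, serves for
    compactness. *)
Lemma Cg_extension : exists T : {linear Ap -> Aq}, bounded_extension_Cg g T /\
  exists C : R, forall f : Ap, rnorm f <= 1 -> (Ip p (T f) <= C%:E)%E.
Proof.
pose T : {linear Ap -> Aq} := HB.pack T0 (GRing.isLinear.Build _ _ _ _ T0 T0_linear).
have [C hC] := volterra_Ip p1 hg.
have TC (f : Ap) : rnorm f <= 1 -> (Ip p (T f) <= C%:E)%E.
  by move=> f1; apply: hC; [exact: bergman_holo0|exact: rnorm_unit].
exists T; split; last by exists C.
have C0 : 0 <= C.
  by rewrite -lee_fin; apply: le_trans (TC 0 _); rewrite ?rnorm0// Ip_ge0.
pose M := (volume Omega + C) `^ q^-1.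
have MC (f : Ap) : rnorm f <= 1 -> rnorm (T f) <= M.
  move=> f1; apply/bergman_rnorm_le; first exact: powR_ge0.
  rewrite -powRrM mulVf ?gt_eqF ?(lt_trans ltr01 q1)// powRr1; last first.
    by rewrite addr_ge0//; exact: volume_ge0.
  have hv := bergman_holo0 (T f).
  apply: le_trans (Ip_mono dom (lt_trans ltr01 q1) qp hv) _.
  by rewrite EFinD leeD2l// TC.
split; last by move=> f _ z Oz; exact: volterraE.
exists M => f; rewrite !rnormE -rmorphM lecR.
apply: (@homogeneous_bound _ _ _ oO p p1 (fun f : Ap => rnorm (T f))) => // c f'.
by rewrite linearZ rnormZ.
Qed.

End extension.
End volterra_operator.

(** * Bounded extensions and extremal functions *)

Section extension_consequences.
Variables (R : realType) (n : nat) (Omega : set 'rV[R[i]]_n) (rho D : R).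
Local Notation Cn := 'rV[R[i]]_n.
Local Notation lam := (@lebesgue_Cn R n).
Hypothesis dom : bounded_convex_domain Omega rho D.
Implicit Types (z w v h : Cn).

Section symbol.
Variables (oO : open Omega) (p q : R) (p1 : 1 < p) (q1 : 1 < q) (g : Cn -> R[i]).
Hypothesis hg : holomorphic_on Omega g.
Local Notation Ap := (bergman oO p1).
Local Notation Aq := (bergman oO q1).
Variable T : {linear Ap -> Aq}.
Hypothesis TC : bounded_extension_Cg g T.

Lemma extension_rnorm : exists2 M : R, 0 <= M & forall f : Ap, rnorm (T f) <= M * rnorm f.
Proof.
have [M hM] := TC.1; exists (Num.max M 0); first by rewrite le_max lexx orbT.
move=> f; have := hM f; rewrite !rnormE -rmorphM lecR => h; apply: le_trans h _.
by rewrite ler_wpM2r ?rnorm_ge0// le_max lexx.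
Qed.

(** By density of the functions holomorphic near the closure and boundedness of the
    evaluations on both spaces. *)
Lemma extension_radial (f : Ap) z : Omega z -> dder (T f) z z = g z * dder f z z.
Proof.
move=> Oz; have [M M0 hM] := extension_rnorm.
have [Cp Cp0 hCp] := dder_bound dom oO p1 z Oz.
have [Cq Cq0 hCq] := dder_bound dom oO q1 z Oz.
apply: normc_eqP => e e0.
pose K := Cq * M + normc (g z) * Cp + 1.
have K0 : 0 < K by rewrite ltr_wpDl// addr_ge0// mulr_ge0// normc_ge0.
have [f' [nf' ff']] := dilate_density dom f (divr_gt0 e0 K0).
have h' := Cg_radial dom (bergman_holo0 f').1 hg (bergman_holo0 (T f')).1
  (TC.2 f' nf') Oz.
have -> : dder (T f) z z - g z * dder f z z =
    g z * dder (f' - f : Ap) z z - dder (T (f' - f)) z z.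
  rewrite linearB !dder_bergmanB// h'; ring.
apply: le_trans (le_normcB _ _) _; rewrite Normc.normcM.
have a1 : normc (dder (T (f' - f)) z z) <= Cq * (M * (e / K)).
  apply: le_trans (hCq _) _; apply: ler_wpM2l => //.
  by apply: le_trans (hM _) _; exact: ler_wpM2l.
have a2 : normc (g z) * normc (dder (f' - f : Ap) z z) <= normc (g z) * (Cp * (e / K)).
  apply: ler_wpM2l; first exact: normc_ge0.
  by apply: le_trans (hCp _) _; exact: ler_wpM2l.
apply: le_trans (lerD a2 a1) _.
have -> : normc (g z) * (Cp * (e / K)) + Cq * (M * (e / K)) = (K - 1) * (e / K).
  by rewrite /K; ring.
have eK : 0 <= e / K by rewrite divr_ge0 ?ltW.
apply: (@le_trans _ _ (K * (e / K))); last by rewrite mulrCA divff ?mulr1// gt_eqF.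
by rewrite ler_wpM2r// gerBl.
Qed.

End symbol.

Lemma bounded_Ip (p M : R) (F : Cn -> R[i]) : 0 < p -> holo0 Omega F ->
  (forall z, Omega z -> normc (F z) <= M) -> (Ip p F < +oo)%E.
Proof.
move=> p0 hF FM; have mF := holo0_measurable hF.
have mi : measurable_fun setT (fun z : borel_Cn R n => (\1_Omega z : R)%:E).
  by apply/measurable_EFinP; apply: measurable_indic; exact: measurable_domain dom.
apply: (@le_lt_trans _ _ ((M `^ p)%:E * \int[lam]_z (\1_Omega z : R)%:E)%E).
  rewrite -ge0_integralZl_EFin ?powR_ge0//.
  apply: ge0_le_integral => //.
  - by move=> z _; rewrite lee_fin powR_ge0.
  - exact: measurable_Ip.
  - exact: measurable_funeM.
  move=> z _; rewrite -EFinM lee_fin indicE; have [Oz|Oz] := pselect (Omega z).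
    rewrite mem_set// mulr1; apply: ge0_ler_powR; rewrite ?nnegrE ?normc_ge0 ?(ltW p0)//.
      exact: le_trans (normc_ge0 _) (FM z Oz).
    exact: FM.
  by rewrite memNset// hF.2// Normc.normc0 powR0 ?mulr0// gt_eqF.
rewrite integral_indic; [|exact: measurableT|exact: measurable_domain dom].
by rewrite setIT lte_mul_pinfty ?lee_fin ?powR_ge0//; exact: domain_volume dom.
Qed.

Section extremal.
Variables (oO : open Omega) (p : R) (p1 : 1 < p).
Local Notation Ap := (bergman oO p1).

(** A source of test functions: the volume of the domain is finite, so that bounded
    functions are integrable. *)
Lemma cutoff_bergman (F : Cn -> R[i]) (M : R) : (forall z, differentiable F z) ->
  (forall z, Omega z -> normc (F z) <= M) ->
  exists f : Ap, forall z, Omega z -> f z = F z /\ forall h, dder f z h = dder F z h.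
Proof.
move=> dF FM; pose F0 z := if `[< Omega z >] then F z else 0.
have E z : Omega z -> F0 z = F z by move=> Oz; rewrite /F0; case: asboolP.
have D1 z (Oz : Omega z) := differentiable_eq_on oO Oz E (dF z).
have hF : holo0 Omega F0.
  by split => [z Oz|z Oz]; [exact: (D1 z Oz).1|rewrite /F0; case: asboolP].
have FI : (Ip p F0 < +oo)%E.
  by apply: (@bounded_Ip p M) => //; [exact: lt_trans ltr01 p1|move=> z Oz; rewrite E// FM].
exists (Bergman oO p1 (in_bergman p1 hF FI)) => z Oz.
by split; [exact: E|exact: (D1 z Oz).2].
Qed.

(** nu is the norm of the evaluation f -> D f (z)(z) on the functions satisfying S, and a
    function attaining it up to a factor 2 exists in the unit ball. *)
Lemma extremal (S : Ap -> Prop) z : Omega z ->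
  (forall (c : R[i]) (f : Ap), S f -> S (c *: f)) ->
  (exists f : Ap, S f /\ dder f z z != 0) ->
  exists nu : R, [/\ 0 < nu, forall f : Ap, S f -> normc (dder f z z) <= nu * rnorm f &
    exists f : Ap, [/\ S f, rnorm f <= 1 & nu / 2 <= normc (dder f z z)]].
Proof.
move=> Oz SZ [f0 [Sf0 f00]]; have [C C0 hC] := dder_bound dom oO p1 z Oz.
pose X : set R := [set normc (dder f z z) | f in [set f : Ap | S f /\ rnorm f <= 1]].
have f0n : 0 < rnorm f0.
  rewrite rnorm_gt0; apply: contra_neqN f00 => /eqP ->.
  by rewrite -(scale0r (0 : Ap)) dder_bergmanZ// mul0r.
have unit (f : Ap) : 0 < rnorm f -> S f ->
    X (normc (dder f z z) / rnorm f).
  move=> fn Sf; exists ((rnorm f)^-1%:C *: f) => /=.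
    split; first exact: SZ.
    by rewrite rnormZ normcR ger0_norm ?invr_ge0 ?(ltW fn)// mulVf ?gt_eqF.
  by rewrite dder_bergmanZ// Normc.normcM normcR ger0_norm ?invr_ge0 ?(ltW fn)// mulrC.
have hX : has_sup X.
  split; first by exists (normc (dder f0 z z) / rnorm f0); exact: unit.
  exists C => _ [f [Sf f1] <-]; apply: le_trans (hC f) _.
  by rewrite -[leRHS]mulr1 ler_wpM2l.
have nu0 : 0 < sup X.
  apply: lt_le_trans (ub_le_sup hX.2 (unit f0 f0n Sf0)).
  by rewrite divr_gt0// normc_gt0.
exists (sup X); split => //.
  move=> f Sf; have := rnorm_ge0 f; rewrite le_eqVlt => /predU1P[fe|fn].
    by apply: le_trans (hC f) _; rewrite -fe !mulr0.
  by rewrite -ler_pdivrMr//; apply: ub_le_sup; [exact: hX.2|exact: unit].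
have h2 : 0 < sup X / 2 by rewrite divr_gt0.
have [_ [f [Sf f1] <-] hf] := sup_adherent h2 hX.
by exists f; split => //; move: hf; lra.
Qed.

End extremal.
End extension_consequences.

(** * Necessary conditions on the symbol *)

Section coordinates.
Variables (R : realType) (n : nat).
Local Notation Cn := 'rV[R[i]]_n.
Variable k0 : 'I_n.

Definition coordinate (w : Cn) : R[i] := w 0 k0.

Lemma differentiable_coordinate w : differentiable coordinate w.
Proof. exact: differentiable_coord. Qed.

Lemma coordinate_is_linear : linear coordinate.
Proof. by move=> a u v; rewrite /coordinate !mxE. Qed.

HB.instance Definition _ := GRing.isLinear.Build _ _ _ _ coordinate coordinate_is_linear.

Lemma dder_coordinate w h : dder coordinate w h = coordinate h.
Proof.
have cc : continuous coordinate.
  by move=> v; apply: differentiable_continuous; exact: differentiable_coordinate.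
have [e e0|_ E] := @epsP_dder _ _ coordinate w coordinate cc; last exact: E.
exists 1; first exact: ltr01.
move=> v _; rewrite /= /coordinate !mxE subrr Normc.normc0.
by apply: mulr_ge0; [exact: ltW|exact: rnorm_ge0].
Qed.

Definition node_product (s : seq R[i]) (w : Cn) : R[i] := \prod_(a <- s) (coordinate w - a).

Lemma node_product_cons a s : node_product (a :: s) = (fun w => (coordinate w - a) * node_product s w).
Proof. by apply/funext => w; rewrite /node_product big_cons. Qed.

Lemma differentiable_node_product s w : differentiable (node_product s) w.
Proof.
elim: s => [|a s IH].
  rewrite (_ : node_product [::] = cst 1); first exact: differentiable_cst.
  by apply/funext => v; rewrite /node_product big_nil.
rewrite node_product_cons; apply: differentiable_mul; last exact: IH.
apply: (@differentiable_sub _ _ _ (cst a)); last exact: differentiable_cst.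
exact: differentiable_coordinate.
Qed.

Lemma node_product_bounded s (D : R) : exists M : R, forall w,
  rnorm w <= D -> normc (node_product s w) <= M.
Proof.
elim: s => [|a s [M hM]].
  by exists (normc 1) => w _; rewrite /node_product big_nil.
exists ((D + normc a) * M) => w wD; rewrite node_product_cons Normc.normcM.
apply: ler_pM; rewrite ?normc_ge0//; last exact: hM.
apply: le_trans (le_normcB _ _) _; rewrite lerD2r.
exact: le_trans (rnorm_coord w k0) wD.
Qed.

Lemma node_product_eq0 s w : (node_product s w == 0) = (coordinate w \in s).
Proof.
rewrite /node_product prodf_seq_eq0 -has_pred1; apply: eq_has => a /=.
by rewrite subr_eq0 eq_sym.
Qed.

End coordinates.

Section symbol_theorems.
Variables (R : realType) (n : nat) (Omega : set 'rV[R[i]]_n) (rho D : R).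
Local Notation Cn := 'rV[R[i]]_n.
Hypothesis dom : bounded_convex_domain Omega rho D.
Implicit Types (z w v h : Cn).

(** The evaluation f -> D f (z)(z) is an eigenvector of the transpose of T for the
    eigenvalue g z, which is therefore at most the norm of T; the factor 2 comes from
    near extremality. The evaluation is nonzero when z is, as a coordinate function
    shows. *)
Lemma symbol_bounded (oO : open Omega) (p : R) (p1 : 1 < p) (g : Cn -> R[i])
    (T : {linear bergman oO p1 -> bergman oO p1}) :
  holomorphic_on Omega g -> bounded_extension_Cg g T -> Hinfty Omega g.
Proof.
move=> hg TC; split=> //; have [M M0 hM] := extension_rnorm TC.
exists (Num.max (2 * M) (normc (g 0))) => z Oz.
have [->|z0] := eqVneq z 0; first by rewrite le_max lexx orbT.
have [k zk] : exists k, z 0 k != 0.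
  apply: contrapT => /forallNP H; move/eqP : z0; apply; apply/rowP => k; rewrite mxE.
  by have /negP := H k; rewrite negbK => /eqP.
have bk w : Omega w -> normc (coordinate k w) <= D.
  by move=> Ow; apply: le_trans (rnorm_coord w k) _; exact: domain_bound dom w Ow.
have [f0 hf0] := cutoff_bergman dom oO p1 (differentiable_coordinate k) bk.
have f0z : dder f0 z z != 0 by rewrite (hf0 z Oz).2 dder_coordinate.
have [nu [nu0 hnu [f [_ f1 fnu]]]] := @extremal _ _ _ _ _ dom oO p p1 (fun=> True) z Oz
  (fun _ _ _ => I) (ex_intro _ f0 (conj I f0z)).
rewrite le_max; apply/orP; left.
have h1 : normc (g z) * normc (dder f z z) <= nu * M.
  rewrite -Normc.normcM -(extension_radial dom hg TC f Oz).
  apply: le_trans (hnu _ I) _; apply: ler_wpM2l; first exact: ltW.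
  by apply: le_trans (hM f) _; rewrite -[leRHS]mulr1 ler_wpM2l.
have h2 : normc (g z) * (nu / 2) <= nu * M.
  by apply: le_trans h1; apply: ler_wpM2l => //; exact: normc_ge0.
by rewrite -(ler_pM2l nu0); move: h2; lra.
Qed.

(** Riesz's argument. If g does not vanish at z0, then [normc (g z0) / 2] bounds g from
    below along a sequence of points zz. Let u k be annihilated by the evaluations at
    zz j for j < k and be nearly extremal for the evaluation at zz k. For k < l the
    difference of the images of u k and u l is annihilated by the first k evaluations, while
    its evaluation at zz k is g (zz k) times that of u k; so its norm is at
    least [normc (g z0) / 4]. This contradicts the last hypothesis, which is stated
    in the exponent p because the evaluations are compared on that space. *)
Lemma symbol_zero (oO : open Omega) (p q : R) (p1 : 1 < p) (q1 : 1 < q) (g : Cn -> R[i])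
    (T : {linear bergman oO p1 -> bergman oO q1}) : (0 < n)%N -> p <= q ->
  holomorphic_on Omega g -> bounded_extension_Cg g T ->
  (forall u : nat -> bergman oO p1, (forall k, rnorm (u k) <= 1) -> forall e : R, 0 < e ->
     exists k l, (k < l)%N /\ (Ip p (fun z => T (u k) z - T (u l) z)%R <= e%:E)%E) ->
  forall z, Omega z -> g z = 0.
Proof.
have sign_neq0 (x y : R) : 0 < x -> y + (if 0 <= y then 1 else -1) * x <> 0.
  by move=> x0; case: ifP => [|/negbT]; rewrite -?ltNge; lra.
move=> n0 pq hg TC cpt z0 Oz0; apply: contrapT => /eqP gz0.
pose k0 := Ordinal n0.
pose zeta : Cn -> R[i] := coordinate k0.
have gz0' : 0 < normc (g z0) / 2 by rewrite divr_gt0// normc_gt0.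
have [d d0 hd] := differentiable_cvg (hg z0 Oz0) gz0'.
have /near_rnormP[d' d'0 hd'] : \forall w \near z0, Omega w by exact: open_nbhs_nbhs.
pose r := Num.min d d' / 2.
have r0 : 0 < r by rewrite divr_gt0// lt_min d0.
have md : Num.min d d' <= d by rewrite ge_min lexx.
have md' : Num.min d d' <= d' by rewrite ge_min lexx orbT.
have rd : r < d by rewrite /r; lra.
have rd' : r < d' by rewrite /r; lra.
clearbody r.
(* the sign keeps the coordinate zeta away from zero along the points zz *)
pose sg : R := if 0 <= complex.Re (zeta z0) then 1 else -1.
pose a (j : nat) : R := sg * (r / j.+1%:R).
have sgn : `|sg| = 1 by rewrite /sg; case: ifP => _; rewrite ?normrN normr1.
have sg0 : sg != 0 by rewrite -normr_eq0 sgn oner_eq0.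
pose zz (j : nat) : Cn := z0 + (a j)%:C *: delta_mx 0 k0.
have zzr j : rnorm (zz j - z0) <= r.
  rewrite /zz addrC addKr rnormZ normcR normrM sgn mul1r ger0_norm ?divr_ge0 ?(ltW r0)//.
  apply: (@le_trans _ _ (r * 1)); last by rewrite mulr1.
  apply: ler_pM; rewrite ?divr_ge0 ?(ltW r0) ?rnorm_ge0//.
    by rewrite ler_pdivrMr// ler_peMr ?ler1n// ltW.
  apply: rnorm_le => // l; rewrite !mxE eqxx/=.
  by case: (l == k0); rewrite ?Normc.normc1 ?Normc.normc0.
have Ozz j : Omega (zz j) by apply: hd'; exact: le_lt_trans (zzr j) rd'.
have gzz j : normc (g z0) / 2 <= normc (g (zz j)).
  have h := hd (zz j) (le_lt_trans (zzr j) rd).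
  have := le_normcB (g (zz j)) (g (zz j) - g z0); rewrite subKr; lra.
have zetaE j : zeta (zz j) = zeta z0 + (a j)%:C.
  by rewrite /zeta /coordinate !mxE !eqxx mulr1.
have zeta_inj : injective (zeta \o zz).
  move=> i j h; have {}h : zeta z0 + (a i)%:C = zeta z0 + (a j)%:C by rewrite -!zetaE.
  have aa : a i = a j by apply: complexI; exact: addrI h.
  have {}aa := mulfI (lt0r_neq0 r0) (mulfI sg0 aa); move/invr_inj : aa.
  by move/eqP; rewrite eqr_nat => /eqP[].
have zeta0 j : zeta (zz j) != 0.
  apply/eqP => /(congr1 (@complex.Re R)); rewrite zetaE raddfD/=.
  have rj : 0 < r / j.+1%:R by rewrite divr_gt0.
  exact: sign_neq0.
pose S (k : nat) (f : bergman oO p1) := forall j, (j < k)%N -> dder f (zz j) (zz j) = 0.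
have SZ k (c : R[i]) f : S k f -> S k (c *: f).
  by move=> Sf j jk; rewrite dder_bergmanZ// Sf// mulr0.
have witness k : exists f, S k f /\ dder f (zz k) (zz k) != 0.
  pose P := node_product k0 [seq zeta (zz j) | j <- iota 0 k].
  have dP w : differentiable P w by exact: differentiable_node_product.
  have [MP hMP] := node_product_bounded k0 [seq zeta (zz j) | j <- iota 0 k] D.
  have MP0 : 0 <= MP.
    by apply: le_trans (normc_ge0 _) (hMP z0 _); exact: domain_bound dom z0 Oz0.
  have Pz j : (j < k)%N -> P (zz j) = 0.
    move=> jk; apply/eqP; rewrite node_product_eq0; apply: map_f.
    by rewrite mem_iota.
  have Pk : P (zz k) != 0.
    rewrite node_product_eq0; apply/negP => /mapP[j]; rewrite mem_iota add0n /= => jk.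
    by move/zeta_inj => kj; rewrite kj ltnn in jk.
  (* the radial derivative of the square of P vanishes at the previous points; if it also
     vanishes at zz k, the product with zeta has radial derivative zeta * P ^+ 2 there *)
  pose F1 w := P w * P w; pose F2 w := zeta w * F1 w.
  have dF1 w : differentiable F1 w by exact: differentiable_mul.
  have dz w : differentiable zeta w by exact: differentiable_coordinate.
  have dF2 w : differentiable F2 w by exact: differentiable_mul.
  have F1E w : dder F1 w w = P w * dder P w w + P w * dder P w w by rewrite /F1 dder_mul.
  have F2E w : dder F2 w w = zeta w * dder F1 w w + F1 w * zeta w.
    by rewrite /F2 dder_mul// dder_coordinate.
  have F1b w : Omega w -> normc (F1 w) <= MP * MP.
    move=> Ow; have wD := domain_bound dom Ow.
    by rewrite Normc.normcM; apply: ler_pM; rewrite ?normc_ge0// hMP.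
  have F2b w : Omega w -> normc (F2 w) <= D * (MP * MP).
    move=> Ow; have wD := domain_bound dom Ow.
    rewrite Normc.normcM; apply: ler_pM; rewrite ?normc_ge0 ?F1b//.
    exact: le_trans (rnorm_coord w k0) wD.
  have [f1 hf1] := cutoff_bergman dom oO p1 dF1 F1b.
  have [f2 hf2] := cutoff_bergman dom oO p1 dF2 F2b.
  have [e0|e0] := eqVneq (dder F1 (zz k) (zz k)) 0; last first.
    exists f1; split; last by rewrite (hf1 _ (Ozz k)).2.
    by move=> j jk; rewrite (hf1 _ (Ozz j)).2 F1E Pz// mul0r addr0.
  exists f2; split.
    by move=> j jk; rewrite (hf2 _ (Ozz j)).2 F2E F1E /F1 Pz// !mul0r !addr0 mulr0.
  by rewrite (hf2 _ (Ozz k)).2 F2E e0 mulr0 add0r !mulf_neq0.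
have /choice[nu hnu] k := @extremal _ _ _ _ _ dom oO p p1 (S k) (zz k) (Ozz k)
  (SZ k) (witness k).
have /choice[u hu] k : exists f : bergman oO p1,
   [/\ S k f, rnorm f <= 1 & nu k / 2 <= normc (dder f (zz k) (zz k))].
  by have [_ _] := hnu k.
pose c := normc (g z0) / 4; have c0 : 0 < c by rewrite divr_gt0// normc_gt0.
have [k [l [kl hI]]] := cpt u (fun k => let: And3 _ h _ := hu k in h) _ (powR_gt0 p (divr_gt0 c0 (ltr0n _ 2))).
pose H := T (u k) - T (u l).
have HI : (Ip p H < +oo)%E by apply: le_lt_trans hI _; exact: ltry.
have HB := in_bergman p1 (bergman_holo0 H) HI.
pose H' : bergman oO p1 := Bergman oO p1 HB.
have eH j : dder H' (zz j) (zz j) = g (zz j) * (dder (u k) (zz j) (zz j) - dder (u l) (zz j) (zz j)).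
  rewrite -[LHS]/(dder H (zz j) (zz j)) /H dder_bergmanB//.
  by rewrite !(extension_radial dom hg TC)// mulrBr.
have [Sk k1 knu] := hu k; have [Sl l1 lnu] := hu l; have [nu0 nuS _] := hnu k.
have SH : S k H'.
  by move=> j jk; rewrite eH Sk// Sl ?(ltn_trans jk kl)// subrr mulr0.
have Hn : rnorm H' <= c / 2 by apply/bergman_rnorm_le; [rewrite divr_ge0 ?(ltW c0)|exact: hI].
have := nuS H' SH; rewrite eH Sl// subr0 Normc.normcM => h.
have h1 : normc (g z0) / 2 * (nu k / 2) <= nu k * (c / 2).
  apply: le_trans (le_trans h _); last by apply: ler_wpM2l; [exact: ltW|].
  apply: ler_pM; [exact: ltW gz0'| |exact: gzz|exact: knu].
  by rewrite divr_ge0// ltW.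
have G0 : 0 < normc (g z0) by rewrite normc_gt0.
move: h1 nu0 G0; rewrite /c; move: (nu k) (normc (g z0)) => x y; clear => h1 x0 y0.
have := mulr_gt0 y0 x0; lra.
Qed.

End symbol_theorems.

(** * Compact inclusion of Bergman spaces *)

Section compact_inclusion.
Variables (R : realType) (n : nat) (Omega : set 'rV[R[i]]_n) (rho D : R).
Local Notation Cn := 'rV[R[i]]_n.
Local Notation lam := (@lebesgue_Cn R n).
Hypothesis dom : bounded_convex_domain Omega rho D.
Implicit Types (z w v h : Cn).

Let oO := domain_open dom.
Let rho0 := domain_rho dom.
Let gO := domain_gauge (domain_open dom) (domain_convex dom) (domain_rho dom) (domain_cball dom).
Let D0 : 0 <= D := domain_bound_ge0 (domain_rho dom) (domain_cball dom) (domain_bound dom).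

(** The Bolzano-Weierstrass theorem, coordinate by coordinate. *)
Lemma ultra_vector (G : set_system Cn) (M : R) : UltraFilter G ->
  (\forall w \near G, rnorm w <= M) ->
  exists p : Cn, forall e : R, 0 < e -> \forall w \near G, rnorm (w - p) <= e.
Proof.
move=> GU hM.
have /choice[l hl] (k : 'I_n) : exists l : R[i], ccvg G (fun w : Cn => w 0 k) l.
  apply: (@ultra_bounded _ _ _ _ M); apply: filterS hM => w; apply: le_trans.
  exact: rnorm_coord.
exists (\row_k l k) => e e0.
have H : \forall w \near G, forall k : 'I_n, normc ((w : Cn) 0 k - l k) <= e.
  by apply: filter_forall => k; exact: hl.
apply: filterS H => w hw; apply: rnorm_le; first exact: ltW.
by move=> k; rewrite !mxE.
Qed.

Lemma compact_gauge_le (s : R) : s < 1 -> compact [set z | gauge Omega z <= s].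
Proof.
move=> s1; rewrite compact_ultra => G GU GK.
have [|p hp] := @ultra_vector G D GU.
  apply: filterS GK => w /= ws; apply: domain_bound dom _ _.
  by apply/gO; exact: le_lt_trans ws s1.
have Gp : G --> p.
  move=> V /near_rnormP[d d0 hV]; have d2 : 0 < d / 2 by rewrite divr_gt0.
  by apply: filterS (hp _ d2) => w hw; apply: hV; lra.
exists p; split => //=; rewrite leNgt; apply/negP => ps.
have : \forall w \near p, s < gauge Omega w.
  apply: open_nbhs_nbhs; split=> //.
  exact: (@open_gauge_gt R n Omega (domain_convex dom) rho (domain_rho dom) (domain_cball dom)).
move=> /Gp sG; have [w [/= h1 h2]] := @filter_ex _ G _ _ (filterI sG GK).
by move: h1; rewrite ltNge h2.
Qed.

Definition shell (m : nat) : set (borel_Cn R n) :=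
  Omega `&` [set z | 1 - m.+2%:R^-1 < gauge Omega z].

(** The shells decrease to the empty set and have finite measure. *)
Lemma shell_cvg (e : R) : 0 < e -> exists m, (lam (shell m) <= e%:E)%E.
Proof.
move=> e0.
have mS m : measurable (shell m).
  apply: measurableI; first exact: measurable_domain dom.
  apply: sub_sigma_algebra.
  exact: (@open_gauge_gt R n Omega (domain_convex dom) rho (domain_rho dom) (domain_cball dom)).
have cap : \bigcap_m shell m = set0.
  apply/seteqP; split => // z H.
  have /gO z1 : Omega z by have [] := H 0%N I.
  have d0 : 0 < 1 - gauge Omega z by lra.
  have [m _ hm] := natSinv_cvg d0.
  have [_ /= h] := H m I; have := hm m (leqnn m).
  have h1 : (m.+2%:R^-1 : R) <= m.+1%:R^-1 by rewrite lef_pV2 ?posrE ?ltr0n// ler_nat.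
  move=> h2; have h3 := le_lt_trans h1 h2.
  by move: h; rewrite ltNge => /negP; apply; rewrite lerBrDr -lerBrDl ltW.
have h0 : (lam (shell 0%N) < +oo)%E.
  apply: le_lt_trans (domain_volume dom); apply: le_measure; rewrite ?inE//.
    exact: measurable_domain dom.
  by move=> z [].
have mc : measurable (\bigcap_m shell m) by rewrite cap.
have hom : {homo shell : n m / (n <= m)%N >-> (m <= n)%O}.
  move=> i j ij; apply/subsetPset => z [Oz /= h]; split => //=; apply: le_lt_trans h.
  by rewrite lerD2l lerN2 lef_pV2 ?posrE ?ltr0n// ler_nat !ltnS.
have := nonincreasing_cvg_mu h0 mS mc hom; rewrite cap measure0.
move=> /fine_cvgP[fin /cvgrPdist_le/(_ _ e0) H].
near \oo => m; exists m.
have f1 : lam (shell m) \is a fin_num by near: m.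
have f2 : `|0 - fine (lam (shell m))| <= e by near: m.
rewrite -(fineK f1) lee_fin; move: f2; rewrite sub0r normrN ger0_norm//.
exact: fine_ge0.
Unshelve. all: by end_near. Qed.

Lemma powR_tail (x A t s : R) : 0 <= x -> 0 < A -> 0 < t -> t < s ->
  x `^ t <= A `^ (t - s) * x `^ s + A `^ t.
Proof.
move=> x0 A0 t0 ts; have [xA|xA] := leP x A.
  apply: (@le_trans _ _ (A `^ t)); last by rewrite lerDr mulr_ge0 ?powR_ge0.
  by apply: ge0_ler_powR; rewrite ?nnegrE// ltW.
have xp : 0 < x := lt_trans A0 xA.
apply: (@le_trans _ _ (A `^ (t - s) * x `^ s)); last by rewrite lerDl powR_ge0.
have -> : x `^ t = x `^ (t - s) * x `^ s by rewrite -powRD ?subrK// gt_eqF// implybT.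
apply: ler_wpM2r; first exact: powR_ge0.
rewrite -(opprB s t) !powRN lef_pV2 ?posrE ?powR_gt0//.
by apply: ge0_ler_powR; rewrite ?nnegrE ?ltW// subr_gt0.
Qed.

Section limit.
Variables (t s M : R) (I : Type) (F : set_system I) (f : I -> Cn -> R[i]).
Hypotheses (FU : UltraFilter F) (t1 : 1 < t) (ts : t < s).
Hypothesis fF : \forall i \near F, holo0 Omega (f i) /\ (Ip s (f i) <= M%:E)%E.

Let s1 : 1 < s := lt_trans t1 ts.

Let local_bound z : Omega z -> exists r C : R, [/\ 0 < r, cball z r `<=` Omega &
  \forall i \near F, holo_bounded (f i) z r C].
Proof.
move=> Oz; have /near_rnormP[d d0 hd] : \forall w \near z, Omega w by exact: open_nbhs_nbhs.
have d2 : 0 < d / 2 by rewrite divr_gt0.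
have [C hC] := ball_bound dom M s1 d2.
have sub w : cball z (d / 2) w -> cball w (d / 2) `<=` Omega.
  move=> wz u uw; apply: hd.
  have -> : u - z = (u - w) + (w - z) by rewrite addrA subrK.
  apply: le_lt_trans (le_rnormD _ _) _; move: uw wz; rewrite /cball/=; lra.
exists (d / 2), C; split => //; first exact: sub (cball_center z d2).
apply: filterS fF => i [hi fi] w wz; split.
  by apply: hi.1; apply: sub wz _ _; exact: cball_center.
by apply: hC => //; exact: sub.
Qed.

(** Bounded values converge along an ultrafilter; local boundedness makes the limit
    holomorphic. *)
Lemma pointwise_limit : exists f0 : Cn -> R[i], holo0 Omega f0 /\
  forall z, Omega z -> ccvg F (fun i => f i z) (f0 z).
Proof.
have /choice[f0 hf0] z : exists l : R[i], (Omega z -> ccvg F (fun i => f i z) l) /\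
    (~ Omega z -> l = 0).
  have [Oz|Oz] := pselect (Omega z); last by exists 0.
  have [r [C [r0 _ hC]]] := local_bound Oz.
  have [l hl] := @ultra_bounded _ _ F (fun i => f i z) C FU
    ltac:(by apply: filterS hC => i hi; exact: (hi z (cball_center z r0)).2).
  by exists l.
exists f0; split; last by move=> z; exact: (hf0 z).1.
split=> [z Oz|z Oz]; last exact: (hf0 z).2.
have [r [C [r0 sub hC]]] := local_bound Oz.
apply: (@limit_differentiable _ _ _ F f f0 z r C) => //.
by move=> w /sub Ow; exact: (hf0 w).1.
Qed.

Variable f0 : Cn -> R[i].
Hypothesis hf0 : holo0 Omega f0.
Hypothesis cf0 : forall z, Omega z -> ccvg F (fun i => f i z) (f0 z).

(** Equicontinuity makes the convergence locally uniform. *)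
Lemma locally_uniform_limit (sigma e : R) : sigma < 1 -> 0 < e ->
  \forall i \near F, forall z, gauge Omega z <= sigma -> normc (f i z - f0 z) <= e.
Proof.
move=> sigma1 e0.
have /compact_near_coveringP := compact_gauge_le sigma1.
move=> /(_ I F (fun i z => normc (f i z - f0 z) <= e) _).
apply=> z /= zs.
have Oz : Omega z by apply/gO; exact: le_lt_trans zs sigma1.
have [r [C [r0 sub hC]]] := local_bound Oz.
have C0 : 0 <= C.
  by have [i hi] := @filter_ex _ F _ _ hC; exact: holo_bounded_ge0 r0 hi.
pose d := Num.min (r / 2) (e / 3 * r / (32 * C + 1)).
have K0 : 0 < 32 * C + 1 by rewrite ltr_wpDl// mulr_ge0.
have d0 : 0 < d by rewrite lt_min !divr_gt0// mulr_gt0// divr_gt0.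
have r20 : 0 < r / 2 by rewrite divr_gt0.
have hb0 : holo_bounded f0 z r C.
  move=> w wz; split; first by apply: hf0.1; exact: sub.
  apply: (ccvg_le _ (cf0 (sub _ wz))).
  by apply: filterS hC => i hi; exact: (hi w wz).2.
have lip (F0 : Cn -> R[i]) w : holo_bounded F0 z r C -> rnorm (w - z) < d ->
    normc (F0 w - F0 z) <= e / 3.
  move=> hF; rewrite lt_min => /andP[w1 w2].
  apply: le_trans (holo_lipschitz r0 hF (cball_center z r20) w1) _.
  rewrite ler_pdivrMr//; move: w2; rewrite ltr_pdivlMr// => w2.
  apply: le_trans (ltW w2); rewrite [leRHS]mulrC ler_wpM2r ?rnorm_ge0//.
  by rewrite lerDl.
have e3 : 0 < e / 3 by rewrite divr_gt0.
have H2 : \forall i \near F, holo_bounded (f i) z r C /\ normc (f i z - f0 z) <= e / 3.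
  by apply: filterI => //; exact: cf0.
exists ([set w | rnorm (w - z) < d], [set i | holo_bounded (f i) z r C /\ normc (f i z - f0 z) <= e / 3]).
  by split; [apply: (near_rnormP (z : Cn) _).2; exists d|exact: H2].
move=> [w i] /= [wz [hi fi]].
have -> : f i w - f0 w = (f i w - f i z) + (f i z - f0 z) - (f0 w - f0 z) by ring.
apply: le_trans (le_normcB _ _) _.
have := le_normcD (f i w - f i z) (f i z - f0 z).
have := lip _ _ hi wz; have := lip _ _ hb0 wz; lra.
Qed.

(** Fatou's lemma holds for sequences only, so one is extracted from the filter along
    which convergence is uniform on an exhaustion of the domain. *)
Lemma limit_Ip : (Ip s f0 <= M%:E)%E.
Proof.
pose sig (m : nat) : R := 1 - m.+2%:R^-1.
have sig1 m : sig m < 1 by rewrite gtrBl invr_gt0.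
have e0 (m : nat) : 0 < (m.+1%:R^-1 : R) by rewrite invr_gt0.
have /choice[j hj] (m : nat) : exists i, (holo0 Omega (f i) /\ (Ip s (f i) <= M%:E)%E) /\
    forall z, gauge Omega z <= sig m -> normc (f i z - f0 z) <= m.+1%:R^-1.
  by apply: (@filter_ex _ F); apply: filterI => //; exact: locally_uniform_limit.
have mp (G : Cn -> R[i]) : holo0 Omega G ->
    measurable_fun setT (fun z : borel_Cn R n => normc (G z) `^ s).
  by move=> /holo0_measurable mG; have /measurable_EFinP := measurable_Ip s mG.
apply: (@fatou_bound _ _ _ lam (fun m z => normc (f (j m) z) `^ s) _ (fun=> M)).
- by move=> m; apply: mp; exact: (hj m).1.1.
- by move=> m z; exact: powR_ge0.
- move=> z; apply: cvg_powR_seq; [exact: ltW| |exact: normc_ge0|].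
    by move=> m; exact: normc_ge0.
  apply/cvgrPdist_le => e ep.
  have [Oz|Oz] := pselect (Omega z); last first.
    by apply: nearW => m; rewrite (hj m).1.1.2// hf0.2// subrr normr0 ltW.
  have d0 : 0 < 1 - gauge Omega z by rewrite subr_gt0; apply/gO.
  near=> m.
  have h1 : m.+1%:R^-1 < 1 - gauge Omega z by near: m; exact: natSinv_cvg.
  have h2 : m.+1%:R^-1 < e by near: m; exact: natSinv_cvg.
  have zm : gauge Omega z <= sig m.
    rewrite /sig lerBrDr -lerBrDl; apply: le_trans (ltW h1).
    by rewrite lef_pV2 ?posrE ?ltr0n// ler_nat.
  have h3 := (hj m).2 z zm.
  have h4 := le_normcD (f (j m) z - f0 z) (f0 z); rewrite subrK in h4.
  have h5 := le_normcD (f0 z - f (j m) z) (f (j m) z); rewrite subrK normc_distC in h5.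
  rewrite ler_norml; apply/andP; split.
    rewrite lerBrDl -lerBrDr opprK; apply: le_trans h4 _; rewrite addrC lerD2l.
    exact: le_trans h3 (ltW h2).
  rewrite lerBlDr; apply: le_trans h5 _; rewrite lerD2r; exact: le_trans h3 (ltW h2).
- by move=> m; exact: (hj m).1.2.
- exact: cvg_cst.
Unshelve. all: by end_near. Qed.

(** Inside, convergence is uniform. On a thin shell near the boundary, [powR_tail] splits
    the values at a level A: the large ones are controlled by the exponent s with the
    small factor A^(t - s), the others by the measure of the shell. *)
Lemma limit_norm (e : R) : 0 < e ->
  \forall i \near F, (Ip t (fun z => f i z - f0 z)%R <= e%:E)%E.
Proof.
move=> e0; have t0 : 0 < t := lt_trans ltr01 t1; have s0 : 0 < s := lt_trans ltr01 s1.
have M0 : 0 <= M by rewrite -lee_fin; apply: le_trans limit_Ip; exact: Ip_ge0.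
pose V := volume Omega; have V0 : 0 <= V := volume_ge0 Omega.
pose M' := 2 `^ s * (M + M); have M'0 : 0 <= M' by rewrite mulr_ge0 ?powR_ge0// addr_ge0.
have e3 : 0 < e / 3 by rewrite divr_gt0.
have e3E : e = e / 3 + e / 3 + e / 3 by lra.
(* the three constants make each of the three contributions at most e / 3 *)
pose c1 := e / 3 / (M' + 1); have c10 : 0 < c1 by rewrite divr_gt0// ltr_wpDl.
pose A := c1 `^ (t - s)^-1; have A0 : 0 < A by exact: powR_gt0.
have AE : A `^ (t - s) = c1.
  by rewrite /A -powRrM mulVf ?powRr1 ?(ltW c10)// subr_eq0 lt_eqF.
pose c2 := e / 3 / (V + 1); have c20 : 0 < c2 by rewrite divr_gt0// ltr_wpDl.
pose eta := c2 `^ t^-1; have eta0 : 0 < eta by exact: powR_gt0.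
have etaE : eta `^ t = c2.
  by rewrite /eta -powRrM mulVf ?powRr1 ?(ltW c20)// gt_eqF.
have At0 : 0 < A `^ t by exact: powR_gt0.
have [m hm] := shell_cvg (divr_gt0 e3 At0).
pose sig : R := 1 - m.+2%:R^-1.
have sig1 : sig < 1 by rewrite gtrBl invr_gt0.
apply: filterS (filterI fF (locally_uniform_limit sig1 eta0)) => i [[hi fi] ui].
pose H z := f i z - f0 z.
have hH : holo0 Omega H := holo0B hi hf0.
have mH := holo0_measurable hH.
have mO := measurable_domain dom.
have mS : measurable (shell m).
  apply: measurableI => //; apply: sub_sigma_algebra.
  exact: (@open_gauge_gt R n Omega (domain_convex dom) rho (domain_rho dom) (domain_cball dom)).
have HI : (Ip s H <= M'%:E)%E.
  have h0 : holo0 Omega (fun z => -1 * f0 z) by exact: holo0Z.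
  have hD : H = (fun z => f i z + -1 * f0 z) by apply/funext => z; rewrite mulN1r.
  rewrite hD; apply: le_trans (IpD (ltW s0) _ _ _) _.
  - exact: holo0_measurable hi.
  - exact: holo0_measurable h0.
  - by rewrite -hD.
  rewrite IpZ; last exact: holo0_measurable hf0.
  rewrite normcN Normc.normc1 powR1 mul1e EFinM EFinD.
  by apply: lee_wpmul2l; [rewrite lee_fin powR_ge0|exact: leeD fi limit_Ip].
have mi (X : set (borel_Cn R n)) : measurable X ->
    measurable_fun setT (fun z : borel_Cn R n => (\1_X z : R)%:E).
  by move=> mX; apply/measurable_EFinP; exact: measurable_indic.
have Iint (X : set (borel_Cn R n)) : measurable X -> (\int[lam]_z (\1_X z : R)%:E = lam X)%E.
  by move=> mX; rewrite integral_indic ?setIT//; exact: measurableT.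
clearbody A eta.
pose a1 (z : borel_Cn R n) : R := eta `^ t * \1_Omega z.
pose a2 (z : borel_Cn R n) : R := A `^ (t - s) * normc (H z) `^ s.
pose a3 (z : borel_Cn R n) : R := A `^ t * \1_(shell m) z.
have I1 : (\int[lam]_z (a1 z)%:E = (eta `^ t)%:E * lam Omega)%E.
  rewrite -Iint// -ge0_integralZl_EFin ?powR_ge0//.
  exact: mi.
have I2 : (\int[lam]_z (a2 z)%:E = (A `^ (t - s))%:E * Ip s H)%E.
  rewrite -ge0_integralZl_EFin ?powR_ge0//; last exact: measurable_Ip.
  by move=> z _; rewrite lee_fin powR_ge0.
have I3 : (\int[lam]_z (a3 z)%:E = (A `^ t)%:E * lam (shell m))%E.
  rewrite -Iint// -ge0_integralZl_EFin ?powR_ge0//.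
  exact: mi.
have mc (c : R) (h : borel_Cn R n -> R) : measurable_fun setT h ->
    measurable_fun setT (fun z : borel_Cn R n => (c * h z)%:E).
  by move=> mh; apply/measurable_EFinP; exact: measurable_funM.
have ma1 : measurable_fun setT (fun z : borel_Cn R n => (a1 z)%:E).
  by apply: mc; exact: measurable_indic.
have ma2 : measurable_fun setT (fun z : borel_Cn R n => (a2 z)%:E).
  by apply: mc; apply/measurable_EFinP; exact: measurable_Ip.
have ma3 : measurable_fun setT (fun z : borel_Cn R n => (a3 z)%:E).
  by apply: mc; exact: measurable_indic.
have a10 z : (0 <= (a1 z)%:E)%E by rewrite lee_fin mulr_ge0 ?powR_ge0.
have a20 z : (0 <= (a2 z)%:E)%E by rewrite lee_fin mulr_ge0 ?powR_ge0.
have a30 z : (0 <= (a3 z)%:E)%E by rewrite lee_fin mulr_ge0 ?powR_ge0.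
have m12 : measurable_fun setT (fun z : borel_Cn R n => (a1 z)%:E + (a2 z)%:E)%E by exact: emeasurable_funD.
have p12 z : (0 <= (a1 z)%:E + (a2 z)%:E)%E by exact: adde_ge0.
have ale z : normc (H z) `^ t <= a1 z + a2 z + a3 z.
  rewrite /a1 /a2 /a3 !indicE.
  have [Oz|Oz] := pselect (Omega z); last first.
    rewrite hH.2// Normc.normc0 powR0 ?gt_eqF//.
    by rewrite !addr_ge0 ?mulr_ge0 ?powR_ge0.
  have [zs|zs] := leP (gauge Omega z) sig.
    rewrite (mem_set Oz) mulr1 -addrA.
    apply: (@le_trans _ _ (eta `^ t)); last by rewrite lerDl addr_ge0 ?mulr_ge0 ?powR_ge0.
    by apply: ge0_ler_powR; rewrite ?nnegrE ?normc_ge0 ?(ltW t0) ?(ltW eta0)// ui.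
  rewrite (@mem_set _ (shell m) z) ?mulr1//.
  have h := powR_tail (normc_ge0 (H z)) A0 t0 ts.
  by apply: le_trans h _; rewrite lerD2r lerDr mulr_ge0 ?powR_ge0.
apply: (@le_trans _ _ (\int[lam]_z ((a1 z)%:E + (a2 z)%:E + (a3 z)%:E))%E).
  apply: ge0_le_integral; [exact: measurableT| | | |].
  - by move=> z _; rewrite lee_fin powR_ge0.
  - exact: measurable_Ip mH.
  - exact: emeasurable_funD.
  - by move=> z _; rewrite -!EFinD lee_fin; exact: ale.
have -> : (\int[lam]_z ((a1 z)%:E + (a2 z)%:E + (a3 z)%:E) =
    c2%:E * lam Omega + c1%:E * Ip s H + (A `^ t)%:E * lam (shell m))%E.
  rewrite -AE -etaE -I1 -I2 -I3.
  rewrite [LHS]ge0_integralD; [|exact: measurableT|by move=> z _; exact: p12|exact: m12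
    |by move=> z _; exact: a30|exact: ma3].
  by rewrite ge0_integralD; [|exact: measurableT|by move=> z _; exact: a10|exact: ma1
    |by move=> z _; exact: a20|exact: ma2].
have -> : e%:E = ((e / 3)%:E + (e / 3)%:E + (e / 3)%:E)%E.
  by rewrite -!EFinD -e3E.
apply: leeD; first apply: leeD.
- rewrite (volumeE dom) -EFinM lee_fin /c2 mulrAC ler_pdivrMr ?ltr_wpDl//.
  by rewrite ler_wpM2l ?(ltW e3)// lerDl.
- apply: (@le_trans _ _ (c1%:E * M'%:E)%E); first by apply: lee_wpmul2l; rewrite ?lee_fin ?(ltW c10).
  rewrite -EFinM lee_fin /c1 mulrAC ler_pdivrMr ?ltr_wpDl//.
  by rewrite ler_wpM2l ?(ltW e3)// lerDl.
apply: (@le_trans _ _ ((A `^ t)%:E * (e / 3 / A `^ t)%:E)%E).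
  by apply: lee_wpmul2l => //; rewrite lee_fin ltW.
by rewrite -EFinM lee_fin mulrCA divff ?mulr1// gt_eqF.
Qed.

End limit.

(** Ultrafilters serve both for compactness of balls and for extraction from sequences. *)
Lemma compact_inclusion (t s M : R) (I : Type) (F : set_system I) (f : I -> Cn -> R[i]) :
  UltraFilter F -> 1 < t -> t < s ->
  (\forall i \near F, holo0 Omega (f i) /\ (Ip s (f i) <= M%:E)%E) ->
  exists f0, [/\ holo0 Omega f0, (Ip s f0 <= M%:E)%E & forall e : R, 0 < e ->
    \forall i \near F, (Ip t (fun z => f i z - f0 z)%R <= e%:E)%E].
Proof.
move=> FU t1 ts fF; have [f0 [hf0 cf0]] := pointwise_limit FU t1 ts fF.
exists f0; split; [exact: hf0|exact: (limit_Ip FU t1 ts fF hf0 cf0)|].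
by move=> e e0; exact: (limit_norm FU t1 ts fF hf0 cf0 e0).
Qed.

End compact_inclusion.

(** * The zero symbol and compactness *)

Section domain_hypotheses.
Variables (R : realType) (n : nat).
Local Notation Cn := 'rV[R[i]]_n.

Lemma bounded_convex_domainP (Omega : set Cn) : open Omega -> bounded_set Omega ->
  convex_set (Omega : set (convex_lmodType Cn)) -> Omega 0 ->
  exists rho D : R, bounded_convex_domain Omega rho D.
Proof.
move=> oO [M [Mr hM]] cO O0.
have /near_rnormP[rho rho0 hrho] : \forall w \near (0 : Cn), Omega w.
  by apply: open_nbhs_nbhs.
exists rho, (complex.Re (M + 1)); split => //.
- move=> z w t /andP[t0 t1] Oz Ow.
  have c0 : 0 <= t%:C :> R[i] by rewrite ler0c.
  have c1 : t%:C <= 1 :> R[i] by rewrite -[1]/(1%:C) lecR.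
  have := cO w z (Itv01 c0 c1) (mem_set Ow) (mem_set Oz); rewrite inE.
  rewrite -[conv _ _ _]/(t%:C *: w + (1 - t%:C) *: z).
  by rewrite addrC rmorphB rmorph1.
- by move=> z hz; apply: hrho; rewrite subr0.
move=> z Oz; have := hM (M + 1) _ z Oz; rewrite ltrDl ltr01 => /(_ isT).
by rewrite /= rnormE lecE => /andP[_].
Qed.

End domain_hypotheses.

Section main.
Variables (R : realType) (n : nat) (Omega : set 'rV[R[i]]_n) (rho D : R).
Local Notation Cn := 'rV[R[i]]_n.
Hypothesis dom : bounded_convex_domain Omega rho D.
Variable oO : open Omega.
Implicit Types (z : Cn).

Lemma Cg_zero (p q : R) (p1 : 1 < p) (q1 : 1 < q) (g : Cn -> R[i]) :
  holomorphic_on Omega g -> (forall z, Omega z -> g z = 0) ->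
  exists2 T : {linear bergman oO p1 -> bergman oO q1}, bounded_extension_Cg g T &
    forall f, T f = 0.
Proof.
move=> hg g0.
have lin : linear (fun _ : bergman oO p1 => 0 : bergman oO q1).
  by move=> a u v; rewrite scaler0 addr0.
pose T : {linear bergman oO p1 -> bergman oO q1} :=
  HB.pack (fun _ : bergman oO p1 => 0 : bergman oO q1) (GRing.isLinear.Build _ _ _ _ _ lin).
exists T => //; split.
  by exists 0 => f; rewrite /= normr0 mul0r.
move=> f _ z Oz; rewrite (CgE dom (bergman_holo0 f).1 hg Oz).
rewrite (@eq_cint _ _ _ _ (fun=> 0)); last first.
  move=> t t01; rewrite /kern g0 ?mulr0//.
  have sO := domain_scale (domain_open dom) (domain_convex dom) (domain_rho dom) (domain_cball dom).
  exact: sO t01 Oz.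
by rewrite cint_cst// mulr0.
Qed.

(** The images are bounded in the exponent q, hence cluster in the smaller exponent p
    by [compact_inclusion]. *)
Lemma close_terms_inclusion (p q : R) (p1 : 1 < p) (q1 : 1 < q) (g : Cn -> R[i])
    (T : {linear bergman oO p1 -> bergman oO q1}) : p < q -> bounded_extension_Cg g T ->
  forall u : nat -> bergman oO p1, (forall k, rnorm (u k) <= 1) -> forall e : R, 0 < e ->
     exists k l, (k < l)%N /\ (Ip p (fun z => T (u k) z - T (u l) z)%R <= e%:E)%E.
Proof.
move=> pq TC u u1 e e0; have [M M0 hM] := extension_rnorm TC.
have p0 : 0 < p := lt_trans ltr01 p1.
have [G [GU oG]] := ultraFilterLemma eventually_filter.
have fG : \forall k \near G, holo0 Omega (T (u k)) /\ (Ip q (T (u k)) <= (M `^ q)%:E)%E.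
  apply: nearW => k; split; first exact: bergman_holo0.
  apply/bergman_rnorm_le => //; apply: le_trans (hM _) _.
  by rewrite -[leRHS]mulr1 ler_wpM2l.
have [f0 [hf0 _ cf0]] := compact_inclusion dom GU p1 pq fG.
pose c := e / (2 `^ p * 2); have c20 : 0 < 2 `^ p * 2 :> R by rewrite mulr_gt0 ?powR_gt0.
have c0 : 0 < c by rewrite divr_gt0.
have Gc := cf0 c c0.
have [k hk] := @filter_ex _ G _ _ Gc.
have Gl : \forall l \near G, (k < l)%N by apply: oG; exact: nbhs_infty_gt.
have [l [hl kl]] := @filter_ex _ G _ _ (filterI Gc Gl).
exists k, l; split => //.
have hfk := bergman_holo0 (T (u k)); have hfl := bergman_holo0 (T (u l)).
have hA := holo0B hfk hf0; have hB := holo0Z (-1) (holo0B hfl hf0).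
have E : (fun z => T (u k) z - T (u l) z) = (fun z => (T (u k) z - f0 z) + -1 * (T (u l) z - f0 z)).
  by apply/funext => z; ring.
rewrite E; apply: le_trans (IpD (ltW p0) _ _ _) _.
- exact: holo0_measurable hA.
- exact: holo0_measurable hB.
- by rewrite -E; exact: holo0_measurable (holo0B hfk hfl).
rewrite IpZ; last exact: holo0_measurable (holo0B hfl hf0).
rewrite normcN Normc.normc1 powR1 mul1e.
have -> : e = 2 `^ p * (c + c).
  by rewrite /c; field; rewrite gt_eqF// powR_gt0.
rewrite [leRHS]EFinM; apply: lee_wpmul2l; first by rewrite lee_fin powR_ge0.
rewrite EFinD; apply: leeD; [exact: hk|exact: hl].
Qed.

Lemma close_terms_compact (p : R) (p1 : 1 < p)
    (T : {linear bergman oO p1 -> bergman oO p1}) :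
  precompact (T @` [set f : bergman oO p1 | `|f| <= 1]) ->
  forall u : nat -> bergman oO p1, (forall k, rnorm (u k) <= 1) -> forall e : R, 0 < e ->
     exists k l, (k < l)%N /\ (Ip p (fun z => T (u k) z - T (u l) z)%R <= e%:E)%E.
Proof.
move=> [U subU [cU _]] u u1 e e0; have p0 : 0 < p := lt_trans ltr01 p1.
pose F := fmap (fun k => T (u k)) (\oo : set_system nat).
have FU : F U.
  exists 0%N => // k _; apply: subU; exists (u k) => //=.
  by rewrite rnormE -[1]/(1%:C) lecR.
have [h [_ clh]] := cU F _ FU.
pose d := e `^ p^-1; have d0 : 0 < d by exact: powR_gt0.
have d2 : 0 < d / 2 by rewrite divr_gt0.
have close N : exists2 k, (N <= k)%N & rnorm (T (u k) - h) < d / 2.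
  have FN : F [set T (u k) | k in [set k | (N <= k)%N]].
    by exists N => // k /= Nk; exists k.
  have nh : nbhs h [set w | rnorm (w - h) < d / 2].
    by apply: (near_rnormP h _).2; exists (d / 2).
  by have [_ [[k Nk <-] hk]] := clh _ _ FN nh; exists k.
have [k _ hk] := close 0%N; have [l kl hl] := close k.+1.
exists k, l; split => //.
have -> : e = d `^ p by rewrite /d -powRrM mulVf ?powRr1 ?gt_eqF// ltW.
apply/(bergman_rnorm_le (T (u k) - T (u l)) (ltW d0)).
have -> : T (u k) - T (u l) = (T (u k) - h) + (h - T (u l)) by rewrite addrA subrK.
apply: le_trans (le_rnormD _ _) _; rewrite (rnorm_distC h) [d]splitr.
exact: ltW (ltrD hk hl).
Qed.

(** The limit of [compact_inclusion] satisfies the same bound, so the ball is closed as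
    well as relatively compact. *)
Lemma compact_ball (p q : R) (q1 : 1 < q) (M : R) : q < p ->
  compact [set h : bergman oO q1 | (Ip p h <= M%:E)%E].
Proof.
move=> qp; rewrite compact_ultra => F FU FB.
have q0 : 0 < q := lt_trans ltr01 q1.
have fF : \forall h \near F, holo0 Omega (h : bergman oO q1) /\ (Ip p h <= M%:E)%E.
  by apply: filterS FB => h hh; split => //; exact: bergman_holo0.
have [f0 [hf0 f0M cf0]] := compact_inclusion dom FU q1 qp fF.
have f0q : (Ip q f0 < +oo)%E.
  apply: le_lt_trans (Ip_mono dom q0 (ltW qp) hf0) _.
  by rewrite lte_add_pinfty ?ltry//; apply: le_lt_trans f0M _; exact: ltry.
pose h0 : bergman oO q1 := Bergman oO q1 (in_bergman q1 hf0 f0q).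
exists h0; split => // V /(near_rnormP h0)[d d0 hV].
have d2 : 0 < d / 2 by rewrite divr_gt0.
apply: filterS (cf0 _ (powR_gt0 q d2)) => h hh; apply: hV.
apply: (@le_lt_trans _ _ (d / 2)); last by lra.
by apply/bergman_rnorm_le; [exact: ltW|exact: hh].
Qed.

End main.

(** * The theorem *)

Theorem mainTheorem7 (R : realType) (n : nat) (n_ge1 : (1 <= n)%N)
    (Omega : set 'rV[R[i]]_n) (Omega_open : open Omega)
    (Omega_bounded : bounded_set Omega)
    (Omega_convex : convex_set (Omega : set (convex_lmodType 'rV[R[i]]_n)))
    (Omega_smooth : smooth_boundary Omega) (Omega_finite : finite_type Omega)
    (Omega_0 : Omega 0)
    (p q : R) (p_gt1 : 1 < p) (q_gt1 : 1 < q)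
    (g : 'rV[R[i]]_n -> R[i]) (g_hol : holomorphic_on Omega g) :
  [/\ p < q ->
        (Cg_bounded Omega_open p_gt1 q_gt1 g <-> forall z, Omega z -> g z = 0),
      p = q -> (Cg_bounded Omega_open p_gt1 q_gt1 g <-> Hinfty Omega g),
      p = q ->
        (Cg_compact Omega_open p_gt1 q_gt1 g <-> forall z, Omega z -> g z = 0) &
      q < p -> Hinfty Omega g -> Cg_compact Omega_open p_gt1 q_gt1 g].

Proof.
have [rho [D dom]] := bounded_convex_domainP Omega_open Omega_bounded Omega_convex Omega_0.
split.
- move=> pq; split => [[T TC]|g0]; last first.
    by have [T TC _] := Cg_zero dom Omega_open p_gt1 q_gt1 g_hol g0; exists T.
  exact: (symbol_zero dom n_ge1 (ltW pq) g_hol TC (close_terms_inclusion dom pq TC)).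
- move=> pq; subst q; rewrite (bool_irrelevance q_gt1 p_gt1).
  split => [[T TC]|hg]; first exact: (symbol_bounded dom g_hol TC).
  by have [T [TC _]] := Cg_extension dom Omega_open p_gt1 p_gt1 hg (lexx p); exists T.
- move=> pq; subst q; rewrite (bool_irrelevance q_gt1 p_gt1).
  split => [[T TC cT]|g0].
    exact: (symbol_zero dom n_ge1 (lexx p) g_hol TC (close_terms_compact cT)).
  have [T TC T0] := Cg_zero dom Omega_open p_gt1 p_gt1 g_hol g0; exists T => //.
  apply: (@precompact_subset _ _ [set 0]); first by move=> _ [f _ <-] /=; exact: T0.
  by apply: compact_precompact; [exact: norm_hausdorff|exact: compact_set1].
- move=> qp hg.
  have [T [TC [C hC]]] := Cg_extension dom Omega_open p_gt1 q_gt1 hg (ltW qp).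
  exists T => //.
  have cB := @compact_ball _ _ _ _ _ dom Omega_open p q q_gt1 C qp.
  have pB := compact_precompact (@norm_hausdorff _ (bergman Omega_open q_gt1)) cB.
  apply: (precompact_subset _ pB).
  move=> _ [f /= f1 <-]; apply: hC.
  by rewrite -lecR -rnormE.
Qed.
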